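(* Assume (H1), (H2), (H3), and let $L\in\mathbb R$. Then the number of positive eigenvalues of $\mathcal L_L$ (counted with multiplicity) is equal to the number of conjugate points in $(-\infty,L)$ counted with multiplicity, i.e. $\sum_{x\in(-\infty,L)}\dim\big(\mathbb E^u_-(x,0)\cap\ell_*^{sand}\big)$.
   Context: Fix real $\nu,\mu$, $f(u)=\nu u^2-u^3-\mu u$. (H1): $\varphi$ is a smooth stationary solution of $u_t=-(1+\partial_x^2)^2u+f(u)$ with $\varphi\to0$ at $\pm\infty$. (H2): $f'(0)<0$. For $s\in\mathbb R$, $\mathcal L_s=-\partial_x^4-2\partial_x^2-1+f'(\varphi(x))$ on $(-\infty,s]$ with domain $\{u\in H^4((-\infty,s]):u(s)=u'(s)=0\}$. With $q=(u,u_{xx},u_{xxx}+2u_x,u_x)$, $\mathcal Lu=\lambda u$ becomes $q'=B(x,\lambda)q$, $B(x,\lambda)=\begin{pmatrix}0&0&0&1\\0&0&1&-2\\-\lambda-1+f'(\varphi(x))&0&0&0\\0&1&0&0\end{pmatrix}$. $\mathbb E^u_-(x,\lambda)$ is the set of values $q(x)$ of solutions with $q(y)\to0$ as $y\to-\infty$. $\ell_*^{sand}=\{q\in\mathbb R^4:q_1=q_4=0\}$. A conjugate point is an $x$ with $\mathbb E^u_-(x,0)\cap\ell_*^{sand}\neq\{0\}$, multiplicity being the dimension of the intersection. (H3): $\dim(\mathbb E^u_-(x,0)\cap\ell_*^{sand})\le1$ for all $x$. *)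

(* Defs.v *)
From Stdlib Require Import Reals List.
From Coquelicot Require Import Coquelicot.
Open Scope R_scope.

Definition f (nu mu : R) (u : R) : R := nu * u ^ 2 - u ^ 3 - mu * u.

Fixpoint lincomb {T : Type} (d : nat) (c : nat -> R) (b : nat -> T -> R) (t : T) : R :=
  match d with
  | O => 0
  | S k => lincomb k c b t + c k * b k t
  end.

(* The (linear) set V of real functions on T, where functions are identified
   when they agree on the domain D, has dimension d: it has a basis of d elements. *)
Definition dim_on {T : Type} (D : T -> Prop) (V : (T -> R) -> Prop) (d : nat) : Prop :=
  exists b : nat -> T -> R,
    (forall i, (i < d)%nat -> V (b i)) /\
    (forall c : nat -> R,
        (forall t, D t -> lincomb d c b t = 0) -> forall i, (i < d)%nat -> c i = 0) /\
    (forall u, V u -> exists c : nat -> R, forall t, D t -> u t = lincomb d c b t).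

(* (H1): phi smooth stationary solution of u_t = -(1+d_x^2)^2 u + f(u), phi -> 0 at +-oo *)
Definition H1 (nu mu : R) (phi : R -> R) : Prop :=
  (forall (n : nat) (x : R), ex_derive_n phi n x) /\
  (forall x : R,
     - (phi x + 2 * Derive_n phi 2 x + Derive_n phi 4 x) + f nu mu (phi x) = 0) /\
  is_lim phi p_infty 0 /\ is_lim phi m_infty 0.

Definition H2 (nu mu : R) : Prop := Derive (f nu mu) 0 < 0.

(* Eigenspace of L_s = -d^4 - 2 d^2 - 1 + f'(phi(x)) on (-oo, s] with domain
   { u in H^4((-oo,s]) : u(s) = u'(s) = 0 } for the value lam.  Elements are
   represented by real functions on R (extensions of functions on (-oo,s]);
   they are identified when they agree on (-oo,s] (see dim_on with D = (-oo,s]). *)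
Definition eigenspace (nu mu : R) (phi : R -> R) (s lam : R) (u : R -> R) : Prop :=
  (forall (k : nat) (x : R), (k <= 4)%nat -> ex_derive_n u k x) /\
  (forall k : nat, (k <= 4)%nat ->
     ex_RInt_gen (fun x => (Derive_n u k x) ^ 2) (Rbar_locally m_infty) (at_point s)) /\
  u s = 0 /\ Derive u s = 0 /\
  (forall x : R, x <= s ->
     - Derive_n u 4 x - 2 * Derive_n u 2 x - u x + Derive (f nu mu) (phi x) * u x
     = lam * u x).

(* Solutions q = (q_1,q_2,q_3,q_4) (indices 0..3) of q' = B(x,lam) q on R. *)
Definition first_order_sol (nu mu : R) (phi : R -> R) (lam : R) (q : R -> nat -> R) : Prop :=
  (forall (i : nat) (y : R), (i < 4)%nat -> ex_derive (fun t => q t i) y) /\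
  (forall y : R,
     Derive (fun t => q t 0%nat) y = q y 3%nat /\
     Derive (fun t => q t 1%nat) y = q y 2%nat - 2 * q y 3%nat /\
     Derive (fun t => q t 2%nat) y = (- lam - 1 + Derive (f nu mu) (phi y)) * q y 0%nat /\
     Derive (fun t => q t 3%nat) y = q y 1%nat).

Definition Eu_minus (nu mu : R) (phi : R -> R) (x lam : R) (v : nat -> R) : Prop :=
  exists q : R -> nat -> R,
    first_order_sol nu mu phi lam q /\
    (forall i : nat, (i < 4)%nat -> is_lim (fun y => q y i) m_infty 0) /\
    (forall i : nat, (i < 4)%nat -> v i = q x i).

Definition ell_sand (v : nat -> R) : Prop := v 0%nat = 0 /\ v 3%nat = 0.

Definition idx4 (i : nat) : Prop := (i < 4)%nat.

Definition conj_space (nu mu : R) (phi : R -> R) (x : R) (v : nat -> R) : Prop :=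
  Eu_minus nu mu phi x 0 v /\ ell_sand v.

Definition H3 (nu mu : R) (phi : R -> R) : Prop :=
  forall (x : R) (m : nat), dim_on idx4 (conj_space nu mu phi x) m -> (m <= 1)%nat.

Fixpoint sum_snd (l : list (R * nat)) : nat :=
  match l with nil => O | p :: l' => (snd p + sum_snd l')%nat end.

(* Sum over points x with P x of multiplicities mult x (a relation x |-> m) is
   finite and equals n: finitely many x in P have positive multiplicity. *)
Definition count_with_mult (P : R -> Prop) (mult : R -> nat -> Prop) (n : nat) : Prop :=
  exists l : list (R * nat),
    NoDup (map fst l) /\
    (forall p, In p l -> P (fst p) /\ mult (fst p) (snd p) /\ (0 < snd p)%nat) /\
    (forall x, P x -> ~ In x (map fst l) -> mult x O) /\
    sum_snd l = n.

(* Main.v *)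
(* Write the fourth-order equation as a Hamiltonian system on R^4. For lam > - m the
   solutions decaying at minus infinity form a Lagrangian plane E(lam); near minus
   infinity the energy is positive definite, and E(lam) is a monotone limit of
   Dirichlet planes. Let nu(s, lam) be the dimension of the space of decaying solutions
   with u(s) = u'(s) = 0: it is the multiplicity of lam as an eigenvalue of L_s, and
   nu(s, 0) is the multiplicity of s as a conjugate point.
   Near any (s, lam), nu is the corank of a symmetric 2 x 2 matrix which is strictly
   increasing in lam and strictly decreasing in s (decaying plane at a nearby s1 < s
   against the plane of solutions vanishing at s, both as graphs over (u, u')(s1)). So
   the two ways of going around a small rectangle count the same number of zero
   eigenvalues, namely the change in the number of negative ones. By compactness the same
   holds for the rectangle [s0 + 1, L] x [0, Lam]; energy positivity makes nu vanish on
   its left and top sides, leaving conjugate points at the bottom and positive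
   eigenvalues at the right. *)

Require Import Defs.
From Stdlib Require Import Reals List.
From Coquelicot Require Import Coquelicot.
From Stdlib Require Import Lra Lia Psatz ClassicalEpsilon Permutation.
From Stdlib Require PSeries_reg Ranalysis5 FinFun.
Open Scope R_scope.

(** For two solutions with equal position at a point, [omega] there is the difference of their
    values of [pair z z]; along the flow it changes only at the rate of the difference of the
    potentials times the product of the positions. Monotonicity in s and in lam is therefore a
    comparison of energies, as in the minimum principle for the integral of (u + u'')^2 + V u^2.
    Nothing is differentiated in lam: continuity comes from two-sided energy inequalities,
    strictness from a bound near each lam separately, made global by compactness. The auxiliary
    point s1 is forced: exactly where nu is positive the decaying plane fails to be a graph over the
    position (u, u')(s). At s1 it must be one, which holds on a dense set of points, and so must the
    plane of solutions vanishing at s. The latter is ensured by s - s1 <= 1/(K + 4), where - K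
    bounds the potentials from below: on such an interval the energy becomes definite after adding a
    null Lagrangian. Edges of a rectangle are half-open, [a, b) in s and (l, k] in lam, so that they
    concatenate and the corner (L, 0) enters neither final count. *)

(** * Derivatives, monotonicity and compactness on intervals *)

Lemma is_derive_eq (f : R -> R) (x l l' : R) : is_derive f x l -> l = l' -> is_derive f x l'.
Proof. intros H <-; exact H. Qed.

Lemma is_derive_Rplus (f g : R -> R) (x a b : R) :
  is_derive f x a -> is_derive g x b -> is_derive (fun t => f t + g t) x (a + b).
Proof. intros; apply (is_derive_plus f g); assumption. Qed.

Lemma is_derive_Rminus (f g : R -> R) (x a b : R) :
  is_derive f x a -> is_derive g x b -> is_derive (fun t => f t - g t) x (a - b).
Proof. intros; apply (is_derive_minus f g); assumption. Qed.

Lemma is_derive_Ropp (f : R -> R) (x a : R) :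
  is_derive f x a -> is_derive (fun t => - f t) x (- a).
Proof. intros; apply (is_derive_opp f); assumption. Qed.

Lemma is_derive_Rmult (f g : R -> R) (x a b : R) :
  is_derive f x a -> is_derive g x b ->
  is_derive (fun t => f t * g t) x (a * g x + f x * b).
Proof. intros; apply (is_derive_mult f g); try assumption. exact Rmult_comm. Qed.

Lemma is_derive_Rsqr (f : R -> R) (x a : R) :
  is_derive f x a -> is_derive (fun t => f t ^ 2) x (2 * f x * a).
Proof.
  intros H. apply is_derive_ext with (fun t => f t * f t); [intros t; change (f t * f t = f t ^ 2); ring|].
  eapply is_derive_eq; [apply is_derive_Rmult; exact H | ring].
Qed.

Lemma is_derive_Rconst (c x : R) : is_derive (fun _ : R => c) x 0.
Proof. apply (is_derive_const c x). Qed.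

Lemma is_derive_Rid (x : R) : is_derive (fun t : R => t) x 1.
Proof. apply (is_derive_id x). Qed.

Ltac dstep :=
  lazymatch goal with
  | |- is_derive (fun _ => ?c) _ _ => apply (is_derive_Rconst c)
  | |- is_derive (fun t => t) _ _ => apply is_derive_Rid
  | |- is_derive (fun t => @?f t + @?g t) _ _ => apply (is_derive_Rplus f g)
  | |- is_derive (fun t => @?f t - @?g t) _ _ => apply (is_derive_Rminus f g)
  | |- is_derive (fun t => @?f t * @?g t) _ _ => apply (is_derive_Rmult f g)
  | |- is_derive (fun t => - @?f t) _ _ => apply (is_derive_Ropp f)
  | |- is_derive (fun t => @?f t ^ 2) _ _ => apply (is_derive_Rsqr f)
  | |- _ => eassumption
  end.
Ltac dsolve := eapply is_derive_eq; [ repeat dstep | cbv beta ].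

Lemma is_derive_cont (f : R -> R) (x l : R) : is_derive f x l -> continuous f x.
Proof. intros H. apply (ex_derive_continuous f x). exists l; exact H. Qed.

Lemma derive_le_incr (F G F' G' : R -> R) (a b : R) : a <= b ->
  (forall t, a <= t <= b -> is_derive F t (F' t)) ->
  (forall t, a <= t <= b -> is_derive G t (G' t)) ->
  (forall t, a <= t <= b -> F' t <= G' t) -> F b - F a <= G b - G a.
Proof.
  intros ab dF dG le.
  destruct (MVT_gen (fun t => G t - F t) a b (fun t => G' t - F' t)) as [c [hc e]].
  - rewrite Rmin_left, Rmax_right by lra. intros x hx.
    apply is_derive_Rminus; [apply dG | apply dF]; lra.
  - rewrite Rmin_left, Rmax_right by lra. intros x hx.
    apply continuity_pt_filterlim, (is_derive_cont (fun t => G t - F t) x (G' x - F' x)).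
    apply is_derive_Rminus; [apply dG | apply dF]; lra.
  - rewrite Rmin_left, Rmax_right in hc by lra.
    assert (0 <= (G' c - F' c) * (b - a)).
    { apply Rmult_le_pos; [specialize (le c hc)|]; lra. }
    lra.
Qed.

Lemma derive_nonneg_incr (F F' : R -> R) (a b : R) : a <= b ->
  (forall t, a <= t <= b -> is_derive F t (F' t)) ->
  (forall t, a <= t <= b -> 0 <= F' t) -> F a <= F b.
Proof.
  intros ab dF le.
  assert (H := derive_le_incr (fun _ => 0) F (fun _ => 0) F' a b ab
    (fun t _ => is_derive_Rconst 0 t) dF le). simpl in H; lra.
Qed.

Lemma derive_zero_on (g g' : R -> R) (a b : R) :
  (forall t, a < t < b -> g t = 0) -> (forall t, a < t < b -> is_derive g t (g' t)) ->
  forall t, a < t < b -> g' t = 0.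
Proof.
  intros z d t ht.
  assert (d0 : is_derive g t 0).
  { apply is_derive_ext_loc with (fun _ => 0); [|apply is_derive_Rconst].
    assert (p : 0 < Rmin (t - a) (b - t)) by (apply Rmin_pos; lra).
    exists (mkposreal _ p). intros y hy. symmetry; apply z.
    unfold ball in hy; simpl in hy; unfold AbsRing_ball, abs, minus, plus, opp in hy; simpl in hy.
    assert (h1 := Rmin_l (t - a) (b - t)). assert (h2 := Rmin_r (t - a) (b - t)).
    apply Rabs_def2 in hy; lra. }
  assert (u1 := is_derive_unique _ _ _ d0).
  assert (u2 := is_derive_unique _ _ _ (d t ht)). congruence.
Qed.

(** The equality case of the energy comparisons: a nondecreasing function that does not grow is
    constant. *)
Lemma derive_zero_of_const (F F' : R -> R) (a b : R) : a < b ->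
  (forall t, a <= t <= b -> is_derive F t (F' t)) ->
  (forall t, a <= t <= b -> 0 <= F' t) -> F b <= F a ->
  forall t, a < t < b -> F' t = 0.
Proof.
  intros ab dF le e.
  apply (derive_zero_on (fun s => F s - F a) F' a b).
  - intros s hs.
    assert (F a <= F s) by (apply derive_nonneg_incr with F'; intros; try apply dF; try apply le; lra).
    assert (F s <= F b) by (apply derive_nonneg_incr with F'; intros; try apply dF; try apply le; lra).
    lra.
  - intros s hs. specialize (dF s ltac:(lra)). dsolve. ring.
Qed.

(* Compactness of [A, B] in the form of an induction principle for interval predicates. *)
Lemma cousin (P : R -> R -> Prop) (A B : R) : A <= B ->
  (forall a b c, a <= b <= c -> P a b -> P b c -> P a c) ->
  (forall x, A <= x <= B -> exists d, 0 < d /\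
     forall a b, A <= a <= x -> x <= b <= B -> x - d < a -> b < x + d -> P a b) ->
  P A B.
Proof.
  intros AB add loc.
  set (E := fun t => A <= t <= B /\ P A t).
  destruct (completeness E) as [s [ub lub]].
  { exists B. intros t [ht _]; lra. }
  { exists A. split; [lra|]. destruct (loc A) as [d [d0 h]]; [lra|]. apply h; lra. }
  assert (sA : A <= s).
  { apply ub. split; [lra|]. destruct (loc A) as [d [d0 h]]; [lra|]. apply h; lra. }
  assert (sB : s <= B). { apply lub. intros t [ht _]; lra. }
  destruct (loc s) as [d [d0 h]]; [lra|].
  assert (exists t, E t /\ s - d < t) as [t [[ht Pt] hd]].
  { destruct (classic (exists t, E t /\ s - d < t)) as [|n]; [assumption|].
    exfalso. assert (s <= s - d); [|lra]. apply lub. intros t Et.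
    destruct (Rle_dec t (s - d)); [assumption|]. exfalso; apply n; exists t; split; [assumption|lra]. }
  assert (ts : t <= s) by (apply ub; split; assumption).
  set (r := Rmin B (s + d / 2)).
  assert (r1 := Rmin_l B (s + d / 2)). assert (r2 := Rmin_r B (s + d / 2)). fold r in r1, r2.
  assert (sr : s <= r) by (apply Rmin_glb; lra).
  assert (Pr : P A r).
  { apply add with t; [lra|assumption|]. apply h; lra. }
  assert (r <= s). { apply ub. split; [lra|assumption]. }
  assert (r = B). { unfold r, Rmin in *. destruct (Rle_dec B (s + d / 2)); lra. }
  congruence.
Qed.

(** Each point is compared only with its neighbours, within a radius that depends on the point. This
    is the form in which strict growth of the crossing forms in lam is available. *)
Lemma strict_incr_of_local (g : R -> R) (a b : R) : a < b ->
  (forall x, a <= x <= b -> exists d, 0 < d /\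
     forall y, a <= y <= b -> Rabs (y - x) < d -> y <> x -> 0 < (g y - g x) * (y - x)) ->
  g a < g b.
Proof.
  intros ab loc.
  assert (H : a < b -> g a < g b); [|tauto].
  apply (cousin (fun u v => u < v -> g u < g v) a b); [lra| |].
  - intros u v w huv h1 h2 uw.
    destruct (Req_dec u v) as [->|n1]; [tauto|]. destruct (Req_dec v w) as [<-|n2]; [tauto|].
    apply Rlt_trans with (g v); [apply h1 | apply h2]; lra.
  - intros x hx. destruct (loc x hx) as [d [d0 h]]. exists d; split; [assumption|].
    intros u v hu hv hu' hv' uv.
    assert (l1 : u < x -> g u < g x).
    { intros l. assert (q := h u ltac:(lra) ltac:(apply Rabs_def1; lra) ltac:(lra)).
      apply Rnot_le_lt; intros c. assert (0 <= (g u - g x) * (x - u)) by (apply Rmult_le_pos; lra). lra. }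
    assert (l2 : x < v -> g x < g v).
    { intros l. assert (q := h v ltac:(lra) ltac:(apply Rabs_def1; lra) ltac:(lra)).
      apply Rnot_le_lt; intros c. assert (0 <= (g x - g v) * (v - x)) by (apply Rmult_le_pos; lra). lra. }
    destruct (Req_dec u x) as [->|n1]; [apply l2; lra|]. destruct (Req_dec x v) as [<-|n2]; [apply l1; lra|].
    apply Rlt_trans with (g x); [apply l1 | apply l2]; lra.
Qed.

(** * Linear systems: existence *)

Lemma ex_series_Rscal (c : R) (a : nat -> R) : ex_series a -> ex_series (fun n => c * a n).
Proof. intros h. apply (@ex_series_scal R_AbsRing R_NormedModule c a h). Qed.

Lemma ex_series_geom_dom (a : nat -> R) (B : R) :
  (forall n, Rabs (a n) <= B * (1 / 2) ^ n) -> ex_series a.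
Proof.
  intros h. apply (@ex_series_le R_AbsRing R_CompleteNormedModule a (fun n => B * (1 / 2) ^ n)); [exact h|].
  apply (ex_series_Rscal B). apply ex_series_geom. rewrite Rabs_right; lra.
Qed.

Lemma Series_geom_dom (a : nat -> R) (B : R) :
  (forall n, Rabs (a n) <= B * (1 / 2) ^ n) -> Rabs (Series a) <= 2 * B.
Proof.
  intros h.
  assert (g : Rabs (1 / 2) < 1) by (rewrite Rabs_right; lra).
  eapply Rle_trans; [apply Series_Rabs|].
  { apply ex_series_geom_dom with B. intros n. rewrite Rabs_Rabsolu; apply h. }
  eapply Rle_trans; [apply (Series_le _ (fun n => B * (1 / 2) ^ n))|].
  { intros n; split; [apply Rabs_pos | apply h]. }
  { apply (ex_series_Rscal B). apply ex_series_geom; assumption. }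
  rewrite Series_scal_l, Series_geom by assumption. lra.
Qed.

(** Weierstrass test on the unit ball around [t] only: [B] may depend on [t], since the bounds for
    the Picard terms grow exponentially with the distance to the initial time. *)
Lemma is_derive_Series (c c' : nat -> R -> R) (B t : R) :
  (forall n y, is_derive (c n) y (c' n y)) ->
  (forall n y, continuous (c' n) y) ->
  (forall n y, Rabs (y - t) < 1 -> Rabs (c n y) <= B * (1 / 2) ^ n) ->
  (forall n y, Rabs (y - t) < 1 -> Rabs (c' n y) <= B * (1 / 2) ^ n) ->
  is_derive (fun y => Series (fun n => c n y)) t (Series (fun n => c' n t)).
Proof.
  intros dc cc bc bc'.
  set (r := mkposreal 1 Rlt_0_1).
  assert (cvu : PSeries_reg.CVU (fun n y => sum_n (fun k => c' k y) n)
     (fun y => Series (fun n => c' n y)) t r).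
  { intros eps he.
    assert (B0 : 0 <= B).
    { assert (q := bc' 0%nat t). rewrite Rminus_diag, Rabs_R0 in q. specialize (q Rlt_0_1).
      assert (q' := Rabs_pos (c' 0%nat t)). simpl in q. lra. }
    destruct (pow_lt_1_zero (1 / 2) ltac:(rewrite Rabs_right; lra) (eps / (2 * B + 1))) as [N hN].
    { apply Rdiv_lt_0_compat; lra. }
    exists N. intros n y hn hy.
    assert (ex : ex_series (fun k => c' k y)) by (apply ex_series_geom_dom with B; intros; apply bc'; exact hy).
    rewrite (Series_incr_n _ (S n) ltac:(lia) ex). simpl Init.Nat.pred.
    rewrite sum_n_Reals.
    match goal with |- Rabs (?a + ?b - ?c) < _ => replace (a + b - c) with b by ring end.
    eapply Rle_lt_trans; [apply (Series_geom_dom _ (B * (1 / 2) ^ S n))|].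
    { intros k. replace (B * (1 / 2) ^ S n * (1 / 2) ^ k) with (B * (1 / 2) ^ (S n + k)).
      apply bc'; exact hy. rewrite pow_add; ring. }
    assert (q := hN (S n) ltac:(lia)). rewrite Rabs_right in q by (apply Rle_ge, pow_le; lra).
    assert (0 <= (1 / 2) ^ S n) by (apply pow_le; lra).
    apply Rlt_div_r in q; [|lra].
    replace (2 * (B * (1 / 2) ^ S n)) with ((1 / 2) ^ S n * (2 * B)) by ring.
    assert ((1 / 2) ^ S n * (2 * B) <= (1 / 2) ^ S n * (2 * B + 1)) by (apply Rmult_le_compat_l; lra).
    lra. }
  apply is_derive_Reals.
  apply (Ranalysis5.derivable_pt_lim_CVU (fun n y => sum_n (fun k => c k y) n)
     (fun n y => sum_n (fun k => c' k y) n) _ (fun y => Series (fun n => c' n y)) t t r).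
  - unfold Boule; simpl. rewrite Rminus_diag, Rabs_R0; lra.
  - intros y n _. apply is_derive_Reals. apply (is_derive_sum_n (fun k y => c k y) n y (fun k => c' k y)). intros; apply dc.
  - intros y hy.
    assert (ex : ex_series (fun k => c k y)) by (apply ex_series_geom_dom with B; intros; apply bc; exact hy).
    apply is_lim_seq_Reals. apply Series_correct in ex. exact ex.
  - exact cvu.
  - apply (PSeries_reg.CVU_continuity _ _ _ _ cvu).
    intros n y _. apply continuity_pt_filterlim.
    induction n as [|n IH].
    + apply continuous_ext with (c' 0%nat); [|apply cc]. intros x; rewrite sum_O; reflexivity.
    + apply continuous_ext with (fun x => plus (sum_n (fun k => c' k x) n) (c' (S n) x)).
      * intros x; rewrite sum_Sn; reflexivity.
      * apply (continuous_plus (fun x => sum_n (fun k => c' k x) n)); [exact IH | apply cc].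
Qed.

Lemma is_derive_RInt_cont (h : R -> R) (t0 t : R) : (forall y, continuous h y) ->
  is_derive (fun x => RInt h t0 x) t (h t).
Proof.
  intros ch. apply (is_derive_RInt h _ t0 t); [|apply ch].
  apply filter_forall. intros x. apply (RInt_correct (V := R_CompleteNormedModule)), (ex_RInt_continuous (V := R_CompleteNormedModule)). intros; apply ch.
Qed.

Ltac split4 := split; [|split; [|split]].

(* The weight that makes Picard iteration a contraction, in both time directions at once. *)
Definition weight (a t0 t : R) : R := exp (a * (t - t0)) + exp (- a * (t - t0)).

(** An antiderivative of B * [weight] is B / a times the difference of the two exponentials, which
    their sum dominates on both sides of [t0]. The factor 1 / a is the gain that contracts. *)
Lemma RInt_weight (h : R -> R) (B a t0 t : R) : 0 < a ->
  (forall y, continuous h y) -> (forall y, Rabs (h y) <= B * weight a t0 y) ->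
  Rabs (RInt h t0 t) <= B / a * weight a t0 t.
Proof.
  intros a0 ch bh.
  assert (dF := fun y => is_derive_RInt_cont h t0 y ch).
  set (F := fun x => RInt h t0 x) in *.
  set (G := fun x => B / a * (exp (a * (x - t0)) - exp (- a * (x - t0)))).
  assert (dG : forall y, is_derive G y (B * weight a t0 y)).
  { intros y. unfold G, weight. auto_derive; [trivial|]. unfold Rminus. field; lra. }
  assert (F0 : F t0 = 0) by (unfold F; apply (RInt_point t0 h)).
  assert (G0 : G t0 = 0) by (unfold G; rewrite Rminus_diag, !Rmult_0_r; ring).
  assert (B0 : 0 <= B).
  { assert (q := bh t0). unfold weight in q. rewrite Rminus_diag, !Rmult_0_r, exp_0 in q.
    assert (q' := Rabs_pos (h t0)). lra. }
  assert (Ba : 0 <= B / a) by (apply Rmult_le_pos; [lra | left; apply Rinv_0_lt_compat; lra]).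
  assert (e1 := exp_pos (a * (t - t0))). assert (e2 := exp_pos (- a * (t - t0))).
  assert (Gb : Rabs (G t) <= B / a * weight a t0 t).
  { unfold G, weight. rewrite Rabs_mult, (Rabs_right (B / a)) by lra.
    apply Rmult_le_compat_l; [assumption|]. apply Rabs_le; lra. }
  apply Rabs_le_between in Gb. apply Rabs_le.
  change (RInt h t0 t) with (F t).
  assert (bh' := fun y => proj1 (Rabs_le_between _ _) (bh y)).
  destruct (Rle_dec t0 t) as [l|l].
  - assert (q1 := derive_le_incr F G h _ t0 t l (fun y _ => dF y) (fun y _ => dG y)
      (fun y _ => proj2 (bh' y))).
    assert (q2 := derive_le_incr (fun y => - F y) G (fun y => - h y) _ t0 t l
      (fun y _ => is_derive_Ropp _ _ _ (dF y)) (fun y _ => dG y)).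
    simpl in q2. assert (q3 : forall y, t0 <= y <= t -> - h y <= B * weight a t0 y).
    { intros y _; specialize (bh' y); lra. }
    specialize (q2 q3). lra.
  - assert (l' : t <= t0) by lra.
    assert (q1 := derive_le_incr F G h _ t t0 l' (fun y _ => dF y) (fun y _ => dG y)
      (fun y _ => proj2 (bh' y))).
    assert (q2 := derive_le_incr (fun y => - F y) G (fun y => - h y) _ t t0 l'
      (fun y _ => is_derive_Ropp _ _ _ (dF y)) (fun y _ => dG y)).
    simpl in q2. assert (q3 : forall y, t <= y <= t0 -> - h y <= B * weight a t0 y).
    { intros y _; specialize (bh' y); lra. }
    specialize (q2 q3). lra.
Qed.

(* Canonical coordinates of q = (u, u_xx, u_xxx + 2 u_x, u_x):
   (dsp, vel) = (u, u') with conjugate momenta mdsp = - u''' - u', mvel = u + u''. *)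
Record phase := Phase { dsp : R; vel : R; mdsp : R; mvel : R }.

(** With u = [dsp] this is u'''' + 2 u'' + (1 + V) u = 0 in Hamiltonian form; the eigenvalue
    equation is the case V = lam - f'(phi). *)
Definition sol_at (V : R -> R) (z : R -> phase) (t : R) : Prop :=
  is_derive (fun s => dsp (z s)) t (vel (z t)) /\
  is_derive (fun s => vel (z s)) t (mvel (z t) - dsp (z t)) /\
  is_derive (fun s => mdsp (z s)) t (mvel (z t) + V t * dsp (z t)) /\
  is_derive (fun s => mvel (z s)) t (- mdsp (z t)).

(** These are the increments of Picard iteration, not the iterates. As the system is linear, each
    increment is determined by the preceding one, and the solution is their sum over [n]. *)
Fixpoint picard (V : R -> R) (t0 : R) (z0 : phase) (n : nat) : R -> phase :=
  match n with
  | O => fun _ => z0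
  | S n => let d := picard V t0 z0 n in fun t =>
      Phase (RInt (fun s => vel (d s)) t0 t)
            (RInt (fun s => mvel (d s) - dsp (d s)) t0 t)
            (RInt (fun s => mvel (d s) + V s * dsp (d s)) t0 t)
            (RInt (fun s => - mdsp (d s)) t0 t)
  end.

Section Picard.
Variables (V : R -> R) (M : R) (t0 : R) (z0 : phase).
Hypotheses (cV : forall t, continuous V t) (bV : forall t, Rabs (V t) <= M).

Let d := picard V t0 z0.

Let M0 : 0 <= M.
Proof. assert (q := bV 0). assert (q' := Rabs_pos (V 0)). lra. Qed.

Let rhs_continuous (e : R -> phase) :
  (forall t, continuous (fun s => dsp (e s)) t /\ continuous (fun s => vel (e s)) t /\
    continuous (fun s => mdsp (e s)) t /\ continuous (fun s => mvel (e s)) t) ->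
  (forall t, continuous (fun s => vel (e s)) t) /\
  (forall t, continuous (fun s => mvel (e s) - dsp (e s)) t) /\
  (forall t, continuous (fun s => mvel (e s) + V s * dsp (e s)) t) /\
  (forall t, continuous (fun s => - mdsp (e s)) t).
Proof.
  intros h. split4; intros t; destruct (h t) as (c1 & c2 & c3 & c4).
  - exact c2.
  - exact (continuous_minus _ _ t c4 c1).
  - exact (continuous_plus _ _ t c4 (continuous_mult _ _ t (cV t) c1)).
  - exact (continuous_opp _ t c3).
Qed.

Lemma picard_continuous n t :
  continuous (fun s => dsp (d n s)) t /\ continuous (fun s => vel (d n s)) t /\
  continuous (fun s => mdsp (d n s)) t /\ continuous (fun s => mvel (d n s)) t.
Proof.
  revert t. induction n as [|n IH]; intros t.
  - split4; apply continuous_const.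
  - destruct (rhs_continuous _ IH) as (c1 & c2 & c3 & c4).
    split4; eapply is_derive_cont; apply is_derive_RInt_cont; assumption.
Qed.

Lemma picard_derive n t :
  is_derive (fun s => dsp (d (S n) s)) t (vel (d n t)) /\
  is_derive (fun s => vel (d (S n) s)) t (mvel (d n t) - dsp (d n t)) /\
  is_derive (fun s => mdsp (d (S n) s)) t (mvel (d n t) + V t * dsp (d n t)) /\
  is_derive (fun s => mvel (d (S n) s)) t (- mdsp (d n t)).
Proof.
  destruct (rhs_continuous _ (picard_continuous n)) as (c1 & c2 & c3 & c4).
  split4;
    [ apply (is_derive_RInt_cont (fun s => vel (d n s)))
    | apply (is_derive_RInt_cont (fun s => mvel (d n s) - dsp (d n s)))
    | apply (is_derive_RInt_cont (fun s => mvel (d n s) + V s * dsp (d n s)))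
    | apply (is_derive_RInt_cont (fun s => - mdsp (d n s))) ]; assumption.
Qed.

(** M + 2 exceeds the row sums 1, 2, 1 + M and 1 of the system. With the rate 2 K in the weight,
    each integration halves the bound. *)
Let K := M + 2.
Let C := Rabs (dsp z0) + Rabs (vel z0) + Rabs (mdsp z0) + Rabs (mvel z0).
Let w := weight (2 * K) t0.

Let w1 t : 1 <= w t.
Proof.
  unfold w, weight. assert (e1 := exp_pos (2 * K * (t - t0))).
  assert (e2 := exp_pos (- (2 * K) * (t - t0))).
  assert (e3 := exp_ineq1_le (2 * K * (t - t0))).
  assert (e4 := exp_ineq1_le (- (2 * K) * (t - t0))). lra.
Qed.

Lemma picard_bound n t :
  Rabs (dsp (d n t)) <= C * (1 / 2) ^ n * w t /\ Rabs (vel (d n t)) <= C * (1 / 2) ^ n * w t /\ Rabs (mdsp (d n t)) <= C * (1 / 2) ^ n * w t /\ Rabs (mvel (d n t)) <= C * (1 / 2) ^ n * w t.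
Proof.
  revert t. induction n as [|n IH]; intros t.
  - assert (c : C <= C * (1 / 2) ^ 0 * w t).
    { simpl. rewrite Rmult_1_r. rewrite <- (Rmult_1_r C) at 1. apply Rmult_le_compat_l; [|apply w1].
      unfold C. assert (q1 := Rabs_pos (dsp z0)). assert (q2 := Rabs_pos (vel z0)).
      assert (q3 := Rabs_pos (mdsp z0)). assert (q4 := Rabs_pos (mvel z0)). lra. }
    unfold d; simpl. revert c. unfold C. assert (q1 := Rabs_pos (dsp z0)). assert (q2 := Rabs_pos (vel z0)).
    assert (q3 := Rabs_pos (mdsp z0)). assert (q4 := Rabs_pos (mvel z0)). simpl. intros c. split4; lra.
  - assert (K0 : 0 < 2 * K) by (unfold K; lra).
    assert (red : forall h, (forall y, continuous h y) ->
      (forall y, Rabs (h y) <= K * (C * (1 / 2) ^ n * w y)) ->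
      Rabs (RInt h t0 t) <= C * (1 / 2) ^ S n * w t).
    { intros h ch bh. eapply Rle_trans; [apply (RInt_weight h (K * (C * (1 / 2) ^ n)) (2 * K)); try assumption|].
      - intros y. eapply Rle_trans; [apply bh|]. apply Req_le; unfold w; ring.
      - apply Req_le. simpl. unfold w. field. lra. }
    assert (pz : forall y, 0 <= C * (1 / 2) ^ n * w y).
    { intros y. destruct (IH y) as [q _]. assert (q' := Rabs_pos (dsp (d n y))). lra. }
    destruct (rhs_continuous _ (picard_continuous n)) as (c1 & c2 & c3 & c4).
    unfold d; simpl picard. cbn [dsp vel mdsp mvel]. fold d.
    assert (pM : forall y, 0 <= M * (C * (1 / 2) ^ n * w y)) by (intros; apply Rmult_le_pos; auto).
    split4; apply red; try assumption; intros y; destruct (IH y) as (b1 & b2 & b3 & b4);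
      specialize (pz y); specialize (pM y).
    + unfold K; lra.
    + eapply Rle_trans; [apply Rabs_triang|]. rewrite Rabs_Ropp. unfold K; lra.
    + eapply Rle_trans; [apply Rabs_triang|]. rewrite Rabs_mult.
      assert (Rabs (V y) * Rabs (dsp (d n y)) <= M * (C * (1 / 2) ^ n * w y)).
      { apply Rmult_le_compat; try apply Rabs_pos; [apply bV | assumption]. }
      unfold K; lra.
    + rewrite Rabs_Ropp. unfold K; lra.
Qed.

Let B t := C * (2 * exp (2 * K * (Rabs (t - t0) + 1))).

Let wB t y : Rabs (y - t) < 1 -> w y <= 2 * exp (2 * K * (Rabs (t - t0) + 1)).
Proof.
  intros h. unfold w, weight.
  assert (q : Rabs (y - t0) <= Rabs (t - t0) + 1).
  { replace (y - t0) with ((y - t) + (t - t0)) by ring.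
    eapply Rle_trans; [apply Rabs_triang|]. lra. }
  apply Rabs_le_between in q.
  assert (K0 : 0 < 2 * K) by (unfold K; lra).
  assert (m : forall u v, u <= v -> exp u <= exp v).
  { intros u v hl; destruct hl as [l|l]; [|subst]; [left; apply exp_increasing; assumption | lra]. }
  assert (exp (2 * K * (y - t0)) <= exp (2 * K * (Rabs (t - t0) + 1))).
  { apply m, Rmult_le_compat_l; lra. }
  assert (exp (- (2 * K) * (y - t0)) <= exp (2 * K * (Rabs (t - t0) + 1))).
  { apply m. replace (- (2 * K) * (y - t0)) with (2 * K * (- (y - t0))) by ring.
    apply Rmult_le_compat_l; lra. }
  lra.
Qed.

Let C0 : 0 <= C.
Proof.
  unfold C. assert (q1 := Rabs_pos (dsp z0)). assert (q2 := Rabs_pos (vel z0)).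
  assert (q3 := Rabs_pos (mdsp z0)). assert (q4 := Rabs_pos (mvel z0)). lra.
Qed.

Lemma picard_local_bound n t y : Rabs (y - t) < 1 ->
  Rabs (dsp (d n y)) <= B t * (1 / 2) ^ n /\ Rabs (vel (d n y)) <= B t * (1 / 2) ^ n /\ Rabs (mdsp (d n y)) <= B t * (1 / 2) ^ n /\ Rabs (mvel (d n y)) <= B t * (1 / 2) ^ n.
Proof.
  intros h. destruct (picard_bound n y) as (b1 & b2 & b3 & b4).
  assert (q : C * (1 / 2) ^ n * w y <= B t * (1 / 2) ^ n).
  { unfold B. replace (C * (2 * exp (2 * K * (Rabs (t - t0) + 1))) * (1 / 2) ^ n)
      with (C * (1 / 2) ^ n * (2 * exp (2 * K * (Rabs (t - t0) + 1)))) by ring.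
    apply Rmult_le_compat_l; [|apply wB; assumption].
    apply Rmult_le_pos; [apply C0 | apply pow_le; lra]. }
  split4; lra.
Qed.

Lemma flow_exists : exists z, z t0 = z0 /\ forall t, sol_at V z t.
Proof.
  exists (fun t => Phase (Series (fun n => dsp (d n t))) (Series (fun n => vel (d n t)))
                  (Series (fun n => mdsp (d n t))) (Series (fun n => mvel (d n t)))).
  assert (ex : forall t, ex_series (fun n => dsp (d n t)) /\ ex_series (fun n => vel (d n t)) /\    ex_series (fun n => mdsp (d n t)) /\ ex_series (fun n => mvel (d n t))).
  { intros t. assert (h : Rabs (t - t) < 1) by (rewrite Rminus_diag, Rabs_R0; lra).
    split4; apply (ex_series_geom_dom _ (B t)); intros n; apply (picard_local_bound n t t h). }
  split.
  - assert (s0 : forall a, ex_series a -> (forall n, a (S n) = 0) -> Series a = a 0%nat).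
    { intros a ea ha. rewrite Series_incr_1 by assumption.
      rewrite (Series_ext _ (fun _ => 0 * 0)); [rewrite Series_scal_l; ring|]. intros n; rewrite ha; ring. }
    destruct (ex t0) as (e1 & e2 & e3 & e4).
    rewrite (s0 _ e1), (s0 _ e2), (s0 _ e3), (s0 _ e4);
      [unfold d; destruct z0; reflexivity|..];
      intros n; exact (RInt_point t0 _).
  - intros t.
    assert (h0 : Rabs (t - t) < 1) by (rewrite Rminus_diag, Rabs_R0; lra).
    assert (gen : forall (p : phase -> R) (q : R -> nat -> R),
      (forall n y, is_derive (fun s => p (d (S n) s)) y (q y n)) ->
      (forall n y, continuous (fun y => q y n) y) ->
      (forall n y, Rabs (y - t) < 1 -> Rabs (p (d n y)) <= B t * (1 / 2) ^ n) ->
      (forall n y, Rabs (y - t) < 1 -> Rabs (q y n) <= K * (B t * (1 / 2) ^ n)) ->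
      is_derive (fun y => Series (fun n => p (d n y))) t (Series (q t))).
    { intros p q dp cq bp bq.
      assert (K2 : 2 <= 2 * K) by (unfold K; lra).
      assert (B0 : 0 <= B t).
      { assert (u := bp 0%nat t h0). assert (u' := Rabs_pos (p (d 0%nat t))). simpl in u. lra. }
      assert (pw : forall n, 0 <= B t * (1 / 2) ^ n) by (intros; apply Rmult_le_pos; [|apply pow_le]; lra).
      (* Term [S n] has derivative [q y n], bounded by K B (1/2)^n; in terms of its own index the
         constant is 2 K B. Term 0 is constant in time. *)
      assert (dS := is_derive_Series (fun n y => p (d n y))
        (fun n y => match n with O => 0 | S n => q y n end) (2 * K * B t) t).
      eapply is_derive_eq; [apply dS|].
      - intros [|n] y; [unfold d; simpl; apply is_derive_Rconst | apply dp].
      - intros [|n] y; [apply continuous_const | apply cq].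
      - intros n y hy. eapply Rle_trans; [apply bp; assumption|].
        rewrite Rmult_assoc. rewrite <- (Rmult_1_l (B t * _)) at 1. apply Rmult_le_compat_r; [apply pw | lra].
      - intros [|n] y hy; [rewrite Rabs_R0; rewrite Rmult_assoc; apply Rmult_le_pos; [lra|apply (pw 0%nat)]|].
        eapply Rle_trans; [apply bq; assumption|]. simpl. apply Req_le; field.
      - rewrite Series_incr_1; [apply Rplus_0_l|].
        apply ex_series_incr_1. apply (ex_series_geom_dom _ (K * B t)).
        intros n. eapply Rle_trans; [apply bq; assumption|]. apply Req_le; ring. }
    assert (K2 : M + 2 <= K) by (unfold K; lra).
    assert (pw : forall n, 0 <= B t * (1 / 2) ^ n).
    { intros n. destruct (picard_local_bound n t t h0) as [u _]. assert (u' := Rabs_pos (dsp (d n t))). lra. }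
    assert (le1 : forall n x, x <= 2 * (B t * (1 / 2) ^ n) -> x <= K * (B t * (1 / 2) ^ n)).
    { intros n x hx. assert (2 * (B t * (1 / 2) ^ n) <= K * (B t * (1 / 2) ^ n)); [|lra].
      apply Rmult_le_compat_r; [apply pw | unfold K; lra]. }
    destruct (ex t) as (e1 & e2 & e3 & e4).
    assert (e1' : ex_series (fun n => V t * dsp (d n t))) by (apply (ex_series_Rscal (V t)); assumption).
    assert (eo : forall a, ex_series a -> Series (fun n => - a n) = - Series a).
    { intros a _. rewrite <- Series_opp. reflexivity. }
    assert (pd := picard_derive). assert (rc := fun n => rhs_continuous _ (picard_continuous n)).
    assert (lb := fun n => picard_local_bound n t).
    unfold sol_at; cbn [dsp vel mdsp mvel]. split4.
    + apply (gen dsp (fun y n => vel (d n y))); intros n y.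
      * exact (proj1 (pd n y)).
      * exact (proj1 (rc n) y).
      * intros hy; exact (proj1 (lb n y hy)).
      * intros hy; destruct (lb n y hy) as (b1 & b2 & b3 & b4).
        apply le1. specialize (pw n); lra.
    + rewrite <- Series_minus by assumption.
      apply (gen vel (fun y n => mvel (d n y) - dsp (d n y))); intros n y.
      * exact (proj1 (proj2 (pd n y))).
      * exact (proj1 (proj2 (rc n)) y).
      * intros hy; exact (proj1 (proj2 (lb n y hy))).
      * intros hy; destruct (lb n y hy) as (b1 & b2 & b3 & b4).
        apply le1. eapply Rle_trans; [apply Rabs_triang|]. rewrite Rabs_Ropp; lra.
    + rewrite <- Series_scal_l, <- Series_plus by assumption.
      apply (gen mdsp (fun y n => mvel (d n y) + V y * dsp (d n y))); intros n y.
      * exact (proj1 (proj2 (proj2 (pd n y)))).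
      * exact (proj1 (proj2 (proj2 (rc n))) y).
      * intros hy; exact (proj1 (proj2 (proj2 (lb n y hy)))).
      * intros hy; destruct (lb n y hy) as (b1 & b2 & b3 & b4).
        eapply Rle_trans; [apply Rabs_triang|]. rewrite Rabs_mult.
        assert (Rabs (V y) * Rabs (dsp (d n y)) <= M * (B t * (1 / 2) ^ n)).
        { apply Rmult_le_compat; try apply Rabs_pos; [apply bV | assumption]. }
        specialize (pw n). unfold K; lra.
    + rewrite <- eo by assumption.
      apply (gen mvel (fun y n => - mdsp (d n y))); intros n y.
      * exact (proj2 (proj2 (proj2 (pd n y)))).
      * exact (proj2 (proj2 (proj2 (rc n))) y).
      * intros hy; exact (proj2 (proj2 (proj2 (lb n y hy)))).
      * intros hy; destruct (lb n y hy) as (b1 & b2 & b3 & b4).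
        rewrite Rabs_Ropp. apply le1. specialize (pw n); lra.
Qed.
End Picard.

(** * Square integrability near minus infinity *)

(* Square integrability on (-oo, a], through a dominating antiderivative bounded below. *)
Definition L2 (a : R) (g : R -> R) : Prop :=
  exists (G G' : R -> R) (m : R),
    forall t, t <= a -> is_derive G t (G' t) /\ g t ^ 2 <= G' t /\ m <= G t.

Lemma L2_ext a g h : (forall t, t <= a -> g t = h t) -> L2 a g -> L2 a h.
Proof.
  intros e (G & G' & m & H). exists G, G', m. intros t ht. rewrite <- e by assumption. auto.
Qed.

Lemma L2_mult_bdd a k M g : (forall t, t <= a -> Rabs (k t) <= M) -> L2 a g ->
  L2 a (fun t => k t * g t).
Proof.
  intros bk (G & G' & m & H).
  exists (fun t => M ^ 2 * G t), (fun t => M ^ 2 * G' t), (M ^ 2 * m).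
  assert (M2 : 0 <= M ^ 2) by nra.
  intros t ht. destruct (H t ht) as (d & l & b). split; [|split].
  - dsolve. ring.
  - assert (k t ^ 2 <= M ^ 2).
    { rewrite <- (pow2_abs (k t)). apply pow_incr. split; [apply Rabs_pos | apply bk; assumption]. }
    rewrite Rpow_mult_distr. apply Rmult_le_compat; try assumption; nra.
  - apply Rmult_le_compat_l; assumption.
Qed.

Lemma L2_lin a c1 c2 g1 g2 : L2 a g1 -> L2 a g2 -> L2 a (fun t => c1 * g1 t + c2 * g2 t).
Proof.
  intros (G1 & G1' & m1 & H1) (G2 & G2' & m2 & H2).
  set (k := 2 * (c1 ^ 2 + c2 ^ 2)). assert (k0 : 0 <= k) by (unfold k; nra).
  exists (fun t => k * (G1 t + G2 t)), (fun t => k * (G1' t + G2' t)), (k * (m1 + m2)).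
  intros t ht. destruct (H1 t ht) as (d1 & l1 & b1), (H2 t ht) as (d2 & l2 & b2). split; [|split].
  - dsolve. ring.
  - apply Rle_trans with (k * (g1 t ^ 2 + g2 t ^ 2)).
    + unfold k. assert (0 <= (c1 * g2 t - c2 * g1 t) ^ 2) by apply pow2_ge_0.
      assert (0 <= (c1 * g1 t) ^ 2 + (c2 * g2 t) ^ 2 + (c1 * g2 t) ^ 2 + (c2 * g1 t) ^ 2) by nra. nra.
    + apply Rmult_le_compat_l; lra.
  - apply Rmult_le_compat_l; lra.
Qed.

(* The derivative of [(s - t + 1)^2 g g'] bounds [g g'] from below at [t] by integrals
   of [g^2] and [g''^2] over [[t - 1, t]]. *)
Lemma L2_interpolation a g g' g'' :
  (forall t, t <= a -> is_derive g t (g' t)) -> (forall t, t <= a -> is_derive g' t (g'' t)) ->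
  L2 a g -> L2 a g'' -> L2 a g'.
Proof.
  intros d1 d2 (G & G' & m & HG) (H & H' & n & HH).
  assert (low : forall t, t <= a -> - (2 * G a + H a - 2 * m - n) <= g t * g' t).
  { intros t ht.
    assert (q := derive_le_incr (fun s => - (2 * G s + H s)) (fun s => (s - t + 1) ^ 2 * (g s * g' s))
      (fun s => - (2 * G' s + H' s))
      (fun s => 2 * (s - t + 1) * (g s * g' s) + (s - t + 1) ^ 2 * (g' s ^ 2 + g s * g'' s))
      (t - 1) t ltac:(lra)).
    cbv beta in q. replace (t - t + 1) with 1 in q by ring. replace (t - 1 - t + 1) with 0 in q by ring.
    assert (mG : G t <= G a).
    { apply derive_nonneg_incr with G'; [assumption| |]; intros s hs; destruct (HG s ltac:(lra)) as (u1 & u2 & u3);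
        [assumption | assert (v := pow2_ge_0 (g s)); lra]. }
    assert (mH : H t <= H a).
    { apply derive_nonneg_incr with H'; [assumption| |]; intros s hs; destruct (HH s ltac:(lra)) as (u1 & u2 & u3);
        [assumption | assert (v := pow2_ge_0 (g'' s)); lra]. }
    destruct (HG (t - 1) ltac:(lra)) as (_ & _ & u). destruct (HH (t - 1) ltac:(lra)) as (_ & _ & u').
    enough (- (2 * G t + H t) - - (2 * G (t - 1) + H (t - 1)) <= 1 ^ 2 * (g t * g' t) - 0 ^ 2 * (g (t - 1) * g' (t - 1))) by lra.
    apply q; intros s hs; destruct (HG s ltac:(lra)) as (u1 & u2 & u3); destruct (HH s ltac:(lra)) as (v1 & v2 & v3).
    - dsolve. ring.
    - assert (e1 := d1 s ltac:(lra)). assert (e2 := d2 s ltac:(lra)). dsolve. ring.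
    - set (c := s - t + 1). assert (c0 : 0 <= c <= 1) by (unfold c; lra).
      assert (0 <= (g s + c * g' s) ^ 2) by apply pow2_ge_0.
      assert (0 <= (g s + g'' s) ^ 2) by apply pow2_ge_0.
      assert (c2 : 0 <= c ^ 2 <= 1) by nra.
      assert (- (g s ^ 2 + g'' s ^ 2) / 2 <= c ^ 2 * (g s * g'' s)).
      { assert (- (g s ^ 2 + g'' s ^ 2) / 2 <= g s * g'' s) by nra.
        assert (0 <= (g s ^ 2 + g'' s ^ 2) / 2) by nra.
        assert (c ^ 2 * (- (g s ^ 2 + g'' s ^ 2) / 2) <= c ^ 2 * (g s * g'' s)) by (apply Rmult_le_compat_l; lra).
        nra. }
      nra. }
  (* In (g g')' = g'^2 + g g'' the product g g'' is absorbed by half of g^2 + g''^2, hence the added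
     half of [G + H]; [low] bounds the result from below. *)
  exists (fun t => g t * g' t + / 2 * (G t + H t)), (fun t => g' t ^ 2 + g t * g'' t + / 2 * (G' t + H' t)),
    (- (2 * G a + H a - 2 * m - n) + / 2 * (m + n)).
  intros t ht. destruct (HG t ht) as (u1 & u2 & u3). destruct (HH t ht) as (v1 & v2 & v3).
  assert (e1 := d1 t ht). assert (e2 := d2 t ht). split; [|split].
  - dsolve. ring.
  - assert (0 <= (g t + g'' t) ^ 2) by apply pow2_ge_0. nra.
  - specialize (low t ht). lra.
Qed.

Lemma incr_bounded_tail (F F' : R -> R) a m :
  (forall t, t <= a -> is_derive F t (F' t) /\ 0 <= F' t /\ m <= F t) ->
  forall eps, 0 < eps -> exists T, T <= a /\ forall t, t <= T -> F T - F t < eps.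
Proof.
  intros h eps e0.
  destruct (completeness (fun y => exists t, t <= a /\ y = - F t)) as [s [ub lub]].
  { exists (- m). intros y (t & ht & ->). destruct (h t ht) as (_ & _ & q); lra. }
  { exists (- F a), a. split; [lra | reflexivity]. }
  destruct (classic (exists T, T <= a /\ s - eps < - F T)) as [(T & hT & q)|n].
  - exists T. split; [assumption|]. intros t ht.
    assert (- F t <= s) by (apply ub; exists t; split; [lra | reflexivity]). lra.
  - exfalso. assert (s <= s - eps); [|lra]. apply lub. intros y (t & ht & ->).
    destruct (Rle_dec (- F t) (s - eps)); [assumption|]. exfalso; apply n; exists t; split; [assumption | lra].
Qed.

Lemma is_lim_m_infty_0 (g : R -> R) :
  (forall eps, 0 < eps -> exists T, forall t, t <= T -> g t ^ 2 < eps) -> is_lim g m_infty 0.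
Proof.
  intros h. apply is_lim_spec. intros [eps e0]. simpl.
  destruct (h (eps ^ 2) ltac:(nra)) as [T hT]. exists T. intros t ht.
  rewrite Rminus_0_r. specialize (hT t ltac:(lra)).
  apply Rabs_def1; apply Rnot_le_lt; intros c; nra.
Qed.

(** The derivative of (s - t + 1) g^2 on [t - 1, t] is at most 2 g^2 + g'^2. So g(t)^2 is bounded by
    the growth of the dominating antiderivatives over a unit interval, which tends to 0 at minus
    infinity. *)
Lemma L2_lim a g g' : (forall t, t <= a -> is_derive g t (g' t)) ->
  L2 a g -> L2 a g' -> is_lim g m_infty 0.
Proof.
  intros d1 (G & G' & m & HG) (H & H' & n & HH).
  apply is_lim_m_infty_0. intros eps e0.
  destruct (incr_bounded_tail (fun t => 2 * G t + H t) (fun t => 2 * G' t + H' t) a (2 * m + n)) with eps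
    as (T & Ta & hT); [|assumption|].
  { intros t ht. destruct (HG t ht) as (u1 & u2 & u3). destruct (HH t ht) as (v1 & v2 & v3). split; [|split].
    - dsolve. ring.
    - assert (0 <= g t ^ 2) by apply pow2_ge_0. assert (0 <= g' t ^ 2) by apply pow2_ge_0. lra.
    - lra. }
  exists T. intros t ht.
  assert (q := derive_le_incr (fun s => (s - t + 1) * g s ^ 2) (fun s => 2 * G s + H s)
    (fun s => g s ^ 2 + (s - t + 1) * (2 * g s * g' s)) (fun s => 2 * G' s + H' s) (t - 1) t ltac:(lra)).
  cbv beta in q. replace (t - t + 1) with 1 in q by ring. replace (t - 1 - t + 1) with 0 in q by ring.
  assert (2 * G t + H t <= 2 * G T + H T).
  { apply (derive_nonneg_incr (fun s => 2 * G s + H s) (fun s => 2 * G' s + H' s)); [assumption| |];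
      intros s hs; destruct (HG s ltac:(lra)) as (u1 & u2 & u3); destruct (HH s ltac:(lra)) as (v1 & v2 & v3).
    - dsolve. ring.
    - assert (0 <= g s ^ 2) by apply pow2_ge_0. assert (0 <= g' s ^ 2) by apply pow2_ge_0. lra. }
  specialize (hT (t - 1) ltac:(lra)).
  enough (1 * g t ^ 2 - 0 * g (t - 1) ^ 2 <= 2 * G t + H t - (2 * G (t - 1) + H (t - 1))) by lra.
  apply q; intros s hs; destruct (HG s ltac:(lra)) as (u1 & u2 & u3); destruct (HH s ltac:(lra)) as (v1 & v2 & v3).
  - assert (e1 := d1 s ltac:(lra)). dsolve. ring.
  - dsolve. ring.
  - assert (0 <= (g s - g' s) ^ 2) by apply pow2_ge_0. assert (0 <= (g s + g' s) ^ 2) by apply pow2_ge_0.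
    assert (0 <= g s ^ 2) by apply pow2_ge_0. assert (0 <= g' s ^ 2) by apply pow2_ge_0.
    assert ((s - t + 1) * (2 * g s * g' s) <= g s ^ 2 + g' s ^ 2); [|lra].
    destruct (Rle_dec 0 (g s * g' s)).
    + assert ((s - t + 1) * (2 * g s * g' s) <= 1 * (2 * g s * g' s)) by (apply Rmult_le_compat_r; lra). lra.
    + assert (0 <= (s - t + 1) * - (g s * g' s)) by (apply Rmult_le_pos; lra). lra.
Qed.

(** * The Hamiltonian system *)

Definition comb (c1 : R) (z1 : phase) (c2 : R) (z2 : phase) : phase :=
  Phase (c1 * dsp z1 + c2 * dsp z2) (c1 * vel z1 + c2 * vel z2)
        (c1 * mdsp z1 + c2 * mdsp z2) (c1 * mvel z1 + c2 * mvel z2).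

Definition pzero : phase := Phase 0 0 0 0.

(** On the diagonal this is the boundary term when (u + u'')^2 + V u^2 is integrated by parts. On a
    plane that is a graph over positions it is the bilinear form of the graph, symmetric exactly
    when the plane is Lagrangian. *)
Definition pair (z w : phase) : R := mdsp z * dsp w + mvel z * vel w.

Definition omega (z w : phase) : R := pair z w - pair w z.

Definition nsq (z : phase) : R := dsp z ^ 2 + vel z ^ 2 + mdsp z ^ 2 + mvel z ^ 2.

Lemma phase_eq z w : dsp z = dsp w -> vel z = vel w -> mdsp z = mdsp w -> mvel z = mvel w -> z = w.
Proof. destruct z, w; simpl; intros -> -> -> ->; reflexivity. Qed.

Lemma nsq_pos z : 0 <= nsq z.
Proof. unfold nsq. nra. Qed.

Lemma nsq_zero z : nsq z <= 0 -> z = pzero.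
Proof.
  unfold nsq; intros h.
  assert (h1 := pow2_ge_0 (dsp z)); assert (h2 := pow2_ge_0 (vel z));
  assert (h3 := pow2_ge_0 (mdsp z)); assert (h4 := pow2_ge_0 (mvel z)).
  apply phase_eq; simpl; apply Rsqr_0_uniq; unfold Rsqr; nra.
Qed.

Lemma sol_comb V c1 z1 c2 z2 t : sol_at V z1 t -> sol_at V z2 t ->
  sol_at V (fun s => comb c1 (z1 s) c2 (z2 s)) t.
Proof.
  intros (a1 & a2 & a3 & a4) (b1 & b2 & b3 & b4). unfold sol_at, comb; cbn [dsp vel mdsp mvel].
  split4; dsolve; ring.
Qed.

Lemma sol_energy V z t : sol_at V z t ->
  is_derive (fun s => pair (z s) (z s)) t (mvel (z t) ^ 2 + V t * dsp (z t) ^ 2).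
Proof. intros (a1 & a2 & a3 & a4). unfold pair. dsolve. ring. Qed.

(** Lagrange identity: [omega] is conserved for equal potentials. For two spectral values the rate
    is lam - lam' times the product of the positions, the source of monotonicity in lam. *)
Lemma sol_omega V V' z w t : sol_at V z t -> sol_at V' w t ->
  is_derive (fun s => omega (z s) (w s)) t ((V t - V' t) * (dsp (z t) * dsp (w t))).
Proof.
  intros (a1 & a2 & a3 & a4) (b1 & b2 & b3 & b4). unfold omega, pair. dsolve. ring.
Qed.

(** * Gronwall estimates, uniqueness and comparison of two potentials *)

Section Gronwall.
Variables (V r : R -> R) (M rho a b : R) (e : R -> phase).
Hypotheses (ab : a <= b) (bV : forall t, a <= t <= b -> Rabs (V t) <= M)
  (br : forall t, a <= t <= b -> Rabs (r t) <= rho)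
  (e1 : forall t, a <= t <= b -> is_derive (fun s => dsp (e s)) t (vel (e t)))
  (e2 : forall t, a <= t <= b -> is_derive (fun s => vel (e s)) t (mvel (e t) - dsp (e t)))
  (e3 : forall t, a <= t <= b -> is_derive (fun s => mdsp (e s)) t (mvel (e t) + V t * dsp (e t) + r t))
  (e4 : forall t, a <= t <= b -> is_derive (fun s => mvel (e s)) t (- mdsp (e t))).

Let N' t := 2 * (vel (e t) * mvel (e t) + mdsp (e t) * (V t * dsp (e t)) + mdsp (e t) * r t).

Let dN t : a <= t <= b -> is_derive (fun s => nsq (e s)) t (N' t).
Proof.
  intros h. specialize (e1 t h). specialize (e2 t h). specialize (e3 t h). specialize (e4 t h).
  unfold nsq, N'. dsolve. ring.
Qed.

Let bN t : a <= t <= b -> Rabs (N' t) <= (M + 2) * (nsq (e t) + rho ^ 2).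
Proof.
  intros h. specialize (bV t h). specialize (br t h).
  assert (M0 : 0 <= M) by (assert (q := Rabs_pos (V t)); lra).
  assert (r2 : r t ^ 2 <= rho ^ 2).
  { rewrite <- (pow2_abs (r t)). apply pow_incr. split; [apply Rabs_pos | assumption]. }
  unfold N', nsq. set (x := dsp (e t)). set (y := vel (e t)). set (p := mdsp (e t)). set (q := mvel (e t)).
  assert (A1 : Rabs (2 * (y * q)) <= y ^ 2 + q ^ 2).
  { apply Rabs_le. assert (0 <= (y - q) ^ 2) by apply pow2_ge_0. assert (0 <= (y + q) ^ 2) by apply pow2_ge_0. lra. }
  assert (A2 : Rabs (2 * (p * x)) <= p ^ 2 + x ^ 2).
  { apply Rabs_le. assert (0 <= (p - x) ^ 2) by apply pow2_ge_0. assert (0 <= (p + x) ^ 2) by apply pow2_ge_0. lra. }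
  assert (A3 : Rabs (2 * (p * r t)) <= p ^ 2 + r t ^ 2).
  { apply Rabs_le. assert (0 <= (p - r t) ^ 2) by apply pow2_ge_0. assert (0 <= (p + r t) ^ 2) by apply pow2_ge_0. lra. }
  assert (A4 : Rabs (V t * (2 * (p * x))) <= M * (p ^ 2 + x ^ 2)).
  { rewrite Rabs_mult. apply Rmult_le_compat; try apply Rabs_pos; assumption. }
  replace (2 * (y * q + p * (V t * x) + p * r t)) with (2 * (y * q) + V t * (2 * (p * x)) + 2 * (p * r t)) by ring.
  eapply Rle_trans; [apply Rabs_triang|]. eapply Rle_trans; [apply Rplus_le_compat_r, Rabs_triang|].
  assert (0 <= M * (y ^ 2 + q ^ 2)) by (apply Rmult_le_pos; [assumption | nra]).
  assert (0 <= M * rho ^ 2) by (apply Rmult_le_pos; [assumption | nra]).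
  assert (0 <= y ^ 2) by apply pow2_ge_0. assert (0 <= q ^ 2) by apply pow2_ge_0.
  assert (0 <= p ^ 2) by apply pow2_ge_0. assert (0 <= x ^ 2) by apply pow2_ge_0.
  assert (0 <= rho ^ 2) by apply pow2_ge_0. lra.
Qed.

(** The source [r] stands for the difference of two potentials times the position of one solution,
    in the equation for a difference of solutions. Adding the constant rho^2 to [nsq] absorbs it,
    and the sum grows at rate at most M + 2. *)
Lemma gronwall_fwd : nsq (e b) <= (nsq (e a) + rho ^ 2) * exp ((M + 2) * (b - a)).
Proof.
  set (c := M + 2) in *.
  assert (q : - ((nsq (e a) + rho ^ 2) * exp (c * (b - a))) <= - ((nsq (e b) + rho ^ 2) * exp (c * (b - b)))).
  { apply (derive_nonneg_incr (fun t => - ((nsq (e t) + rho ^ 2) * exp (c * (b - t))))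
     (fun t => (c * (nsq (e t) + rho ^ 2) - N' t) * exp (c * (b - t))) a b ab).
    - intros t ht. specialize (dN t ht).
      assert (dE : is_derive (fun s => exp (c * (b - s))) t (- c * exp (c * (b - t)))) by (auto_derive; [trivial | unfold Rminus; ring]).
      dsolve. ring.
    - intros t ht. specialize (bN t ht). apply Rabs_le_between in bN.
      apply Rmult_le_pos; [lra | left; apply exp_pos]. }
  rewrite Rminus_diag, Rmult_0_r, exp_0 in q. assert (0 <= rho ^ 2) by nra. lra.
Qed.

Lemma gronwall_bwd : nsq (e a) <= (nsq (e b) + rho ^ 2) * exp ((M + 2) * (b - a)).
Proof.
  set (c := M + 2) in *.
  assert (q : (nsq (e a) + rho ^ 2) * exp (c * (a - a)) <= (nsq (e b) + rho ^ 2) * exp (c * (b - a))).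
  { apply (derive_nonneg_incr (fun t => (nsq (e t) + rho ^ 2) * exp (c * (t - a)))
     (fun t => (c * (nsq (e t) + rho ^ 2) + N' t) * exp (c * (t - a))) a b ab).
    - intros t ht. specialize (dN t ht).
      assert (dE : is_derive (fun s => exp (c * (s - a))) t (c * exp (c * (t - a)))) by (auto_derive; [trivial | unfold Rminus; ring]).
      dsolve. ring.
    - intros t ht. specialize (bN t ht). apply Rabs_le_between in bN.
      apply Rmult_le_pos; [lra | left; apply exp_pos]. }
  rewrite Rminus_diag, Rmult_0_r, exp_0 in q. assert (0 <= rho ^ 2) by nra. lra.
Qed.
End Gronwall.

Lemma sol_bound_fwd V M z a b : a <= b -> (forall t, a <= t <= b -> Rabs (V t) <= M) ->
  (forall t, a <= t <= b -> sol_at V z t) -> nsq (z b) <= nsq (z a) * exp ((M + 2) * (b - a)).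
Proof.
  intros ab bV s.
  assert (q := gronwall_fwd V (fun _ => 0) M 0 a b z ab bV
    ltac:(intros; cbv beta; rewrite Rabs_R0; lra) (fun t h => proj1 (s t h)) (fun t h => proj1 (proj2 (s t h)))).
  replace (nsq (z a)) with (nsq (z a) + 0 ^ 2) by ring. apply q.
  - intros t h. cbv beta. rewrite Rplus_0_r. destruct (s t h) as (a1 & a2 & a3 & a4); assumption.
  - intros t h. destruct (s t h) as (a1 & a2 & a3 & a4); assumption.
Qed.

Lemma sol_bound_bwd V M z a b : a <= b -> (forall t, a <= t <= b -> Rabs (V t) <= M) ->
  (forall t, a <= t <= b -> sol_at V z t) -> nsq (z a) <= nsq (z b) * exp ((M + 2) * (b - a)).
Proof.
  intros ab bV s.
  assert (q := gronwall_bwd V (fun _ => 0) M 0 a b z ab bV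
    ltac:(intros; cbv beta; rewrite Rabs_R0; lra) (fun t h => proj1 (s t h)) (fun t h => proj1 (proj2 (s t h)))).
  replace (nsq (z b)) with (nsq (z b) + 0 ^ 2) by ring. apply q.
  - intros t h. cbv beta. rewrite Rplus_0_r. destruct (s t h) as (a1 & a2 & a3 & a4); assumption.
  - intros t h. destruct (s t h) as (a1 & a2 & a3 & a4); assumption.
Qed.

Lemma sol_zero V M z t0 t :
  (forall s, Rabs (V s) <= M) -> (forall s, Rmin t0 t <= s <= Rmax t0 t -> sol_at V z s) ->
  z t0 = pzero -> z t = pzero.
Proof.
  intros bV s z0. apply nsq_zero.
  assert (n0 : nsq (z t0) = 0) by (rewrite z0; unfold nsq, pzero; simpl; ring).
  destruct (Rle_dec t0 t) as [l|l].
  - rewrite Rmin_left, Rmax_right in s by lra.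
    assert (q := sol_bound_fwd V M z t0 t l ltac:(intros; apply bV) s). rewrite n0 in q; lra.
  - rewrite Rmin_right, Rmax_left in s by lra.
    assert (q := sol_bound_bwd V M z t t0 ltac:(lra) ltac:(intros; apply bV) s). rewrite n0 in q; lra.
Qed.

Lemma sol_diff_bound V V' M z w c X a b : a <= b -> (forall t, Rabs (V' t) <= M) ->
  (forall t, V t - V' t = c) ->
  (forall t, a <= t <= b -> sol_at V z t) -> (forall t, a <= t <= b -> sol_at V' w t) ->
  (forall t, a <= t <= b -> Rabs (dsp (z t)) <= X) ->
  nsq (comb 1 (z b) (-1) (w b)) <=
  (nsq (comb 1 (z a) (-1) (w a)) + (c * X) ^ 2) * exp ((M + 2) * (b - a)).
Proof.
  intros ab bV dV sz sw bX.
  rewrite <- (pow2_abs (c * X)).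
  apply (gronwall_fwd V' (fun t => c * dsp (z t)) M (Rabs (c * X)) a b (fun t => comb 1 (z t) (-1) (w t)) ab).
  - intros; apply bV.
  - intros t h. rewrite !Rabs_mult. apply Rmult_le_compat_l; [apply Rabs_pos|].
    eapply Rle_trans; [apply bX; assumption | apply Rle_abs].
  - intros t h. destruct (sz t h) as (a1 & a2 & a3 & a4), (sw t h) as (b1 & b2 & b3 & b4). cbn [comb dsp vel mdsp mvel]. dsolve; ring.
  - intros t h. destruct (sz t h) as (a1 & a2 & a3 & a4), (sw t h) as (b1 & b2 & b3 & b4). cbn [comb dsp vel mdsp mvel]. dsolve; ring.
  - intros t h. destruct (sz t h) as (a1 & a2 & a3 & a4), (sw t h) as (b1 & b2 & b3 & b4). cbn [comb dsp vel mdsp mvel].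
    dsolve. rewrite <- (dV t). ring.
  - intros t h. destruct (sz t h) as (a1 & a2 & a3 & a4), (sw t h) as (b1 & b2 & b3 & b4). cbn [comb dsp vel mdsp mvel]. dsolve; ring.
Qed.

(** The energy density mvel^2 + V dsp^2 controls two components; the derivatives of these are, up to
    sign and known terms, the other two. *)
Lemma sol_zero_of_energy V z a b : a < b -> (forall t, a <= t <= b -> sol_at V z t) ->
  (forall t, a < t < b -> dsp (z t) = 0 /\ mvel (z t) = 0) ->
  forall t, a < t < b -> z t = pzero.
Proof.
  intros ab s h t ht.
  apply phase_eq; simpl; [apply h; assumption | | | apply h; assumption].
  - apply (derive_zero_on (fun s => dsp (z s)) (fun s => vel (z s)) a b); [apply h| |assumption].
    intros u hu. destruct (s u ltac:(lra)) as (a1 & a2 & a3 & a4); assumption.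
  - assert (q : - mdsp (z t) = 0); [|lra].
    apply (derive_zero_on (fun s => mvel (z s)) (fun s => - mdsp (z s)) a b); [apply h| |assumption].
    intros u hu. destruct (s u ltac:(lra)) as (a1 & a2 & a3 & a4); assumption.
Qed.

(** * Decay at minus infinity and its relation to the energy *)

Definition decays (z : R -> phase) : Prop :=
  is_lim (fun t => dsp (z t)) m_infty 0 /\ is_lim (fun t => vel (z t)) m_infty 0 /\
  is_lim (fun t => mdsp (z t)) m_infty 0 /\ is_lim (fun t => mvel (z t)) m_infty 0.

Lemma lim0_plus f g : is_lim f m_infty 0 -> is_lim g m_infty 0 -> is_lim (fun t => f t + g t) m_infty 0.
Proof.
  intros hf hg. replace (Finite 0) with (Finite (0 + 0)) by (f_equal; ring).
  apply (is_lim_plus' f g); assumption.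
Qed.

Lemma lim0_mult f g : is_lim f m_infty 0 -> is_lim g m_infty 0 -> is_lim (fun t => f t * g t) m_infty 0.
Proof.
  intros hf hg. replace (Finite 0) with (Finite (0 * 0)) by (f_equal; ring).
  apply (is_lim_mult f g _ _ _ hf hg). exact I.
Qed.

Lemma lim0_scal c f : is_lim f m_infty 0 -> is_lim (fun t => c * f t) m_infty 0.
Proof.
  intros hf. replace (Finite 0) with (Rbar_mult c 0) by (simpl; f_equal; ring).
  apply is_lim_scal_l; assumption.
Qed.

Lemma decays_comb c1 z1 c2 z2 : decays z1 -> decays z2 -> decays (fun t => comb c1 (z1 t) c2 (z2 t)).
Proof.
  intros (a1 & a2 & a3 & a4) (b1 & b2 & b3 & b4). unfold decays, comb; cbn [dsp vel mdsp mvel].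
  split4; apply lim0_plus; apply lim0_scal; assumption.
Qed.

Lemma decays_pair z w : decays z -> decays w -> is_lim (fun t => pair (z t) (w t)) m_infty 0.
Proof.
  intros (a1 & a2 & a3 & a4) (b1 & b2 & b3 & b4). unfold pair.
  apply lim0_plus; apply lim0_mult; assumption.
Qed.

Lemma decays_omega z w : decays z -> decays w -> is_lim (fun t => omega (z t) (w t)) m_infty 0.
Proof.
  intros hz hw. apply is_lim_ext with (fun t => pair (z t) (w t) + (-1) * pair (w t) (z t)).
  { intros t; unfold omega; ring. }
  apply lim0_plus; [|apply lim0_scal]; apply decays_pair; assumption.
Qed.

(** Takes the place of integration over (-oo, t]: the boundary term at minus infinity disappears
    without forming an improper integral. *)
Lemma incr_lim0_nonneg (F F' : R -> R) a :
  (forall t, t <= a -> is_derive F t (F' t)) -> (forall t, t <= a -> 0 <= F' t) ->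
  is_lim F m_infty 0 -> forall t, t <= a -> 0 <= F t.
Proof.
  intros dF pF l t ht. apply Rnot_lt_le; intros c.
  apply is_lim_spec in l. destruct (l (mkposreal (- F t) ltac:(lra))) as [T hT]. simpl in hT.
  set (s := Rmin t (T - 1)). assert (s1 := Rmin_l t (T - 1)). assert (s2 := Rmin_r t (T - 1)). fold s in s1, s2.
  specialize (hT s ltac:(lra)). rewrite Rminus_0_r in hT. apply Rabs_def2 in hT.
  assert (F s <= F t); [|lra].
  apply derive_nonneg_incr with F'; intros; try apply dF; try apply pF; lra.
Qed.

(** [omega] is conserved and tends to 0, so decaying solutions form an isotropic space. The
    one-sided inequality is applied in both orders. *)
Lemma omega_decaying V a z w : (forall t, t <= a -> sol_at V z t) -> (forall t, t <= a -> sol_at V w t) ->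
  decays z -> decays w -> omega (z a) (w a) = 0.
Proof.
  intros sz sw dz dw.
  assert (o : forall z w, (forall t, t <= a -> sol_at V z t) -> (forall t, t <= a -> sol_at V w t) ->
     decays z -> decays w -> 0 <= omega (z a) (w a)).
  { clear. intros z w sz sw dz dw.
    apply (incr_lim0_nonneg (fun t => omega (z t) (w t)) (fun _ => 0) a); try (intros; lra).
    - intros t ht. eapply is_derive_eq; [apply (sol_omega V V); auto | ring].
    - apply decays_omega; assumption. }
  assert (o1 := o z w sz sw dz dw). assert (o2 := o w z sw sz dw dz). unfold omega in *. lra.
Qed.

Section FarLeft.
Variables (V : R -> R) (M m0 a : R).
Hypotheses (m0_pos : 0 < m0) (bV : forall t, Rabs (V t) <= M) (pV : forall t, t <= a -> m0 <= V t).

(** [vel] and [- mdsp] are the derivatives of [dsp] and [mvel], whose second derivatives are square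
    integrable by the equations; interpolation gives the first ones. *)
Lemma L2_phase z : (forall t, t <= a -> sol_at V z t) ->
  L2 a (fun t => dsp (z t)) -> L2 a (fun t => mvel (z t)) ->
  L2 a (fun t => vel (z t)) /\ L2 a (fun t => mdsp (z t)).
Proof.
  intros s L1 L4. split.
  - apply L2_interpolation with (fun t => dsp (z t)) (fun t => mvel (z t) - dsp (z t)); try assumption.
    + intros t ht. destruct (s t ht) as (a1 & a2 & a3 & a4); assumption.
    + intros t ht. destruct (s t ht) as (a1 & a2 & a3 & a4); assumption.
    + apply L2_ext with (fun t => 1 * mvel (z t) + (-1) * dsp (z t)); [intros; ring|].
      apply L2_lin; assumption.
  - apply L2_ext with (fun t => (-1) * - mdsp (z t) + 0 * - mdsp (z t)); [intros; ring|].
    enough (L2 a (fun t => - mdsp (z t))) by (apply L2_lin; assumption).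
    apply L2_interpolation with (fun t => mvel (z t)) (fun t => - (mvel (z t) + V t * dsp (z t))); try assumption.
    + intros t ht. destruct (s t ht) as (a1 & a2 & a3 & a4); assumption.
    + intros t ht. destruct (s t ht) as (a1 & a2 & a3 & a4). dsolve. reflexivity.
    + apply L2_ext with (fun t => (-1) * mvel (z t) + (-1) * (V t * dsp (z t))); [intros; ring|].
      apply L2_lin; [assumption|]. apply L2_mult_bdd with M; [intros; apply bV | assumption].
Qed.

(** The energy itself is a dominating antiderivative: its derivative mvel^2 + V dsp^2 is at least
    mvel^2 and at least m0 dsp^2. *)
Lemma energy_L2 z B : (forall t, t <= a -> sol_at V z t) -> (forall t, t <= a -> B <= pair (z t) (z t)) ->
  L2 a (fun t => dsp (z t)) /\ L2 a (fun t => mvel (z t)).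
Proof.
  intros s hB.
  assert (dE : forall t, t <= a -> is_derive (fun s => pair (z s) (z s)) t (mvel (z t) ^ 2 + V t * dsp (z t) ^ 2))
    by (intros t ht; apply sol_energy; auto).
  split.
  - exists (fun t => / m0 * pair (z t) (z t)), (fun t => / m0 * (mvel (z t) ^ 2 + V t * dsp (z t) ^ 2)), (/ m0 * B).
    assert (im : 0 < / m0) by (apply Rinv_0_lt_compat; assumption).
    intros t ht. specialize (dE t ht). specialize (pV t ht). split; [|split].
    + dsolve. ring.
    + apply Rmult_le_reg_l with m0; [assumption|]. rewrite <- Rmult_assoc, Rinv_r, Rmult_1_l by lra.
      assert (m0 * dsp (z t) ^ 2 <= V t * dsp (z t) ^ 2) by (apply Rmult_le_compat_r; [apply pow2_ge_0 | assumption]).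
      assert (0 <= mvel (z t) ^ 2) by apply pow2_ge_0. lra.
    + apply Rmult_le_compat_l; [lra | auto].
  - exists (fun t => pair (z t) (z t)), (fun t => mvel (z t) ^ 2 + V t * dsp (z t) ^ 2), B.
    intros t ht. specialize (dE t ht). specialize (pV t ht). split; [|split].
    + assumption.
    + assert (0 <= V t * dsp (z t) ^ 2) by (apply Rmult_le_pos; [lra | apply pow2_ge_0]). lra.
    + auto.
Qed.

Lemma L2_decays z : (forall t, t <= a -> sol_at V z t) ->
  L2 a (fun t => dsp (z t)) -> L2 a (fun t => mvel (z t)) -> decays z.
Proof.
  intros s L1 L4. destruct (L2_phase z s L1 L4) as (L2' & L3). unfold decays.
  assert (s1 := fun t h => proj1 (s t h)). assert (s2 := fun t h => proj1 (proj2 (s t h))).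
  assert (s3 := fun t h => proj1 (proj2 (proj2 (s t h)))). assert (s4 := fun t h => proj2 (proj2 (proj2 (s t h)))).
  split4.
  - apply (L2_lim a _ _ s1); assumption.
  - apply (L2_lim a _ _ s2); [assumption|].
    apply L2_ext with (fun t => 1 * mvel (z t) + (-1) * dsp (z t)); [intros; ring|]. apply L2_lin; assumption.
  - apply (L2_lim a _ _ s3); [assumption|].
    apply L2_ext with (fun t => 1 * mvel (z t) + 1 * (V t * dsp (z t))); [intros; ring|].
    apply L2_lin; [assumption|]. apply L2_mult_bdd with M; [intros; apply bV | assumption].
  - apply (L2_lim a _ _ s4); [assumption|].
    apply L2_ext with (fun t => (-1) * mdsp (z t) + 0 * mdsp (z t)); [intros; ring|]. apply L2_lin; assumption.
Qed.

(** Together with [decays_energy_nonneg] this makes decay equivalent to a lower bound on the energy,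
    a condition that survives limits of solutions. *)
Lemma energy_decays z B : (forall t, t <= a -> sol_at V z t) ->
  (forall t, t <= a -> B <= pair (z t) (z t)) -> decays z.
Proof.
  intros s hB. destruct (energy_L2 z B s hB) as (L1 & L4). apply L2_decays; assumption.
Qed.
End FarLeft.

Lemma decays_energy_nonneg V a z : (forall t, t <= a -> 0 <= V t) ->
  (forall t, t <= a -> sol_at V z t) -> decays z -> forall t, t <= a -> 0 <= pair (z t) (z t).
Proof.
  intros pV s dz.
  apply incr_lim0_nonneg with (fun t => mvel (z t) ^ 2 + V t * dsp (z t) ^ 2).
  - intros t ht. apply sol_energy; auto.
  - intros t ht. assert (0 <= V t * dsp (z t) ^ 2) by (apply Rmult_le_pos; [auto | apply pow2_ge_0]).
    assert (0 <= mvel (z t) ^ 2) by apply pow2_ge_0. lra.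
  - apply decays_pair; assumption.
Qed.

Lemma energy_zero V M z a b : a < b -> (forall t, Rabs (V t) <= M) -> (forall t, a <= t <= b -> 0 < V t) ->
  (forall t, a <= t <= b -> sol_at V z t) -> pair (z b) (z b) <= pair (z a) (z a) -> z b = pzero.
Proof.
  intros ab bV pV s e.
  assert (P : forall t, a <= t <= b -> 0 <= mvel (z t) ^ 2 + V t * dsp (z t) ^ 2).
  { intros t ht. specialize (pV t ht). assert (0 <= V t * dsp (z t) ^ 2) by (apply Rmult_le_pos; [lra | apply pow2_ge_0]).
    assert (0 <= mvel (z t) ^ 2) by apply pow2_ge_0. lra. }
  assert (Z := derive_zero_of_const (fun t => pair (z t) (z t)) _ a b ab
    (fun t ht => sol_energy V z t (s t ht)) P e).
  assert (Z' : forall t, a < t < b -> dsp (z t) = 0 /\ mvel (z t) = 0).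
  { intros t ht. specialize (Z t ht). specialize (pV t ltac:(lra)). cbv beta in Z.
    assert (A1 := pow2_ge_0 (dsp (z t))). assert (A2 := pow2_ge_0 (mvel (z t))).
    assert (A3 : 0 <= V t * dsp (z t) ^ 2) by (apply Rmult_le_pos; lra).
    split; apply Rsqr_0_uniq; unfold Rsqr; [|nra].
    assert (V t * dsp (z t) ^ 2 = 0) by lra. destruct (Rmult_integral _ _ H); [lra | nra]. }
  assert (mid := sol_zero_of_energy V z a b ab s Z' ((a + b) / 2) ltac:(lra)).
  apply (sol_zero V M z ((a + b) / 2) b bV); [|assumption].
  intros t ht. apply s. rewrite Rmin_left, Rmax_right in ht by lra. lra.
Qed.

(** The energy is nonnegative at a - 1, nondecreasing, and 0 at a. Being constant in between, it
    forces the zero solution by [energy_zero]. *)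
Lemma decaying_dirichlet V M z a : (forall t, Rabs (V t) <= M) -> (forall t, t <= a -> 0 < V t) ->
  (forall t, t <= a -> sol_at V z t) -> decays z -> dsp (z a) = 0 -> vel (z a) = 0 -> z a = pzero.
Proof.
  intros bV pV s dz h1 h2.
  apply (energy_zero V M z (a - 1) a); try lra; try assumption.
  - intros; apply pV; lra.
  - intros; apply s; lra.
  - unfold pair at 1. rewrite h1, h2.
    assert (q := decays_energy_nonneg V a z (fun t h => Rlt_le _ _ (pV t h)) s dz (a - 1) ltac:(lra)). lra.
Qed.

(** * Existence of decaying solutions *)

Lemma det2_inj a11 a12 a21 a22 :
  (forall c1 c2, a11 * c1 + a12 * c2 = 0 -> a21 * c1 + a22 * c2 = 0 -> c1 = 0 /\ c2 = 0) ->
  a11 * a22 - a12 * a21 <> 0.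
Proof.
  intros h d.
  (* If the determinant vanished, both columns of the adjugate would lie in the kernel; all entries
     would then be 0, and (1, 0) would lie there too. *)
  destruct (h a22 (- a21)) as [e1 e2]; [lra | ring |].
  destruct (h (- a12) a11) as [e3 e4]; [ring | lra |].
  destruct (h 1 0) as [e5 _]; lra.
Qed.

Lemma det2_cramer a11 a12 a21 a22 x1 x2 : a11 * a22 - a12 * a21 <> 0 ->
  exists c1 c2, a11 * c1 + a12 * c2 = x1 /\ a21 * c1 + a22 * c2 = x2.
Proof.
  intros d. exists ((a22 * x1 - a12 * x2) / (a11 * a22 - a12 * a21)), ((a11 * x2 - a21 * x1) / (a11 * a22 - a12 * a21)).
  split; field; assumption.
Qed.

Lemma lim_seq_sq u v l : is_lim_seq v 0 -> (forall n, (l - u n) ^ 2 <= v n) -> is_lim_seq u l.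
Proof.
  intros hv h. apply is_lim_seq_spec. intros [eps e0]. simpl.
  apply is_lim_seq_spec in hv. destruct (hv (mkposreal (eps ^ 2) ltac:(nra))) as [N hN]. exists N.
  intros n hn. specialize (hN n hn). simpl in hN. rewrite Rminus_0_r in hN. apply Rabs_def2 in hN.
  specialize (h n). apply Rabs_def1; apply Rnot_le_lt; intros c; nra.
Qed.

Lemma lim_seq_comb_sq u (l : R) : is_lim_seq u l -> is_lim_seq (fun n => (1 * l + -1 * u n) ^ 2) 0.
Proof.
  intros hu.
  assert (h : is_lim_seq (fun n => 1 * l + -1 * u n) 0).
  { replace (Finite 0) with (Finite (1 * l + -1 * l)) by (f_equal; ring).
    apply is_lim_seq_plus'; [apply is_lim_seq_const|].
    apply (is_lim_seq_scal_l u (-1) l hu). }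
  apply is_lim_seq_ext with (fun n => (1 * l + -1 * u n) * (1 * l + -1 * u n)); [intros; ring|].
  replace (Finite 0) with (Finite (0 * 0)) by (f_equal; ring). apply is_lim_seq_mult'; assumption.
Qed.

Section DecayingSolutions.
Variables (V : R -> R) (M m0 s0 : R).
Hypotheses (m0_pos : 0 < m0) (cV : forall t, continuous V t)
  (bV : forall t, Rabs (V t) <= M) (pV : forall t, t <= s0 -> m0 <= V t).

Lemma dirichlet_unique z tau : tau < s0 -> (forall t, sol_at V z t) ->
  dsp (z s0) = 0 -> vel (z s0) = 0 -> dsp (z tau) = 0 -> vel (z tau) = 0 -> z s0 = pzero.
Proof.
  intros l s h1 h2 h3 h4. apply (energy_zero V M z tau s0); auto.
  - intros t ht; assert (q := pV t ltac:(lra)); lra.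
  - unfold pair. rewrite h1, h2, h3, h4. lra.
Qed.

(** Solutions with zero position at tau are parametrized by their momenta there. The linear map to
    the position at s0 is injective by [dirichlet_unique], hence onto. *)
Lemma dirichlet_exists tau x v : tau < s0 ->
  exists y, (forall t, sol_at V y t) /\ dsp (y s0) = x /\ vel (y s0) = v /\ dsp (y tau) = 0 /\ vel (y tau) = 0.
Proof.
  intros l.
  destruct (flow_exists V M tau (Phase 0 0 1 0) cV bV) as (y1 & i1 & s1).
  destruct (flow_exists V M tau (Phase 0 0 0 1) cV bV) as (y2 & i2 & s2).
  assert (d : dsp (y1 s0) * vel (y2 s0) - dsp (y2 s0) * vel (y1 s0) <> 0).
  { apply det2_inj. intros c1 c2 h1 h2.
    set (z := fun t => comb c1 (y1 t) c2 (y2 t)).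
    assert (sz : forall t, sol_at V z t) by (intros; apply sol_comb; auto).
    assert (zt : z tau = Phase 0 0 c1 c2) by (unfold z; rewrite i1, i2; apply phase_eq; simpl; ring).
    assert (z0 : z s0 = pzero).
    { apply (dirichlet_unique z tau l sz); try (rewrite zt; reflexivity); unfold z, comb; simpl; lra. }
    assert (zz : z tau = pzero) by (apply (sol_zero V M z s0 tau bV (fun t _ => sz t) z0)).
    rewrite zt in zz. injection zz; intros; split; assumption. }
  destruct (det2_cramer _ _ _ _ x v d) as (c1 & c2 & h1 & h2).
  exists (fun t => comb c1 (y1 t) c2 (y2 t)). split; [intros; apply sol_comb; auto|].
  unfold comb; rewrite i1, i2; simpl. split4; lra.
Qed.

(** The shift to n + 1 keeps the Dirichlet point strictly left of s0 when n = 0. *)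
Let Y x v n := proj1_sig (constructive_indefinite_description _
  (dirichlet_exists (s0 - (INR n + 1)) x v ltac:(assert (q := pos_INR n); lra))).

Let HY x v n : (forall t, sol_at V (Y x v n) t) /\ dsp (Y x v n s0) = x /\ vel (Y x v n s0) = v /\
  dsp (Y x v n (s0 - (INR n + 1))) = 0 /\ vel (Y x v n (s0 - (INR n + 1))) = 0.
Proof. unfold Y. apply proj2_sig. Qed.

Lemma energy_incr z a b : a <= b -> b <= s0 -> (forall t, sol_at V z t) ->
  pair (z a) (z a) <= pair (z b) (z b).
Proof.
  intros ab bs s.
  apply (derive_nonneg_incr (fun t => pair (z t) (z t)) (fun t => mvel (z t) ^ 2 + V t * dsp (z t) ^ 2) a b ab).
  - intros; apply sol_energy; auto.
  - intros t ht. assert (q := pV t ltac:(lra)). assert (0 <= V t * dsp (z t) ^ 2) by (apply Rmult_le_pos; [lra | apply pow2_ge_0]).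
    assert (0 <= mvel (z t) ^ 2) by apply pow2_ge_0. lra.
Qed.

Lemma omega_const z w a b : (forall t, sol_at V z t) -> (forall t, sol_at V w t) ->
  omega (z a) (w a) = omega (z b) (w b).
Proof.
  intros sz sw.
  assert (d : forall t, is_derive (fun s => omega (z s) (w s)) t 0).
  { intros t. eapply is_derive_eq; [apply (sol_omega V V z w t); auto | ring]. }
  assert (g : forall u v, u <= v -> omega (z u) (w u) = omega (z v) (w v)).
  { intros u v uv.
    assert (q1 := derive_nonneg_incr (fun s => omega (z s) (w s)) (fun _ => 0) u v uv (fun t _ => d t) (fun _ _ => Rle_refl 0)).
    assert (q2 := derive_nonneg_incr (fun s => - omega (z s) (w s)) (fun _ => - 0) u v uv
       (fun t _ => is_derive_Ropp _ _ _ (d t)) ltac:(intros; lra)). cbv beta in q1, q2. lra. }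
  destruct (Rle_dec a b); [apply g; assumption | symmetry; apply g; lra].
Qed.

Lemma Y_energy_nonneg x v n t : s0 - (INR n + 1) <= t <= s0 -> 0 <= pair (Y x v n t) (Y x v n t).
Proof.
  intros ht. destruct (HY x v n) as (s & _ & _ & h1 & h2).
  assert (q := energy_incr (Y x v n) (s0 - (INR n + 1)) t ltac:(lra) ltac:(lra) s).
  unfold pair at 1 in q. rewrite h1, h2 in q. lra.
Qed.

(** Domain monotonicity of a minimum: a longer interval also admits extensions by zero. The
    difference of the two solutions has zero position at s0, hence energy at most 0 at tau. This
    fixes the sign of [omega] at tau, and at s0 [omega] is the difference of the energies. *)
Lemma Y_energy_decr x v n : pair (Y x v (S n) s0) (Y x v (S n) s0) <= pair (Y x v n s0) (Y x v n s0).
Proof.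
  destruct (HY x v n) as (s & i1 & i2 & h1 & h2). destruct (HY x v (S n)) as (s' & i1' & i2' & _).
  set (tau := s0 - (INR n + 1)) in *.
  assert (n0 := pos_INR n).
  assert (e := energy_incr (fun t => comb 1 (Y x v n t) (-1) (Y x v (S n) t)) tau s0 ltac:(unfold tau; lra) ltac:(lra)
    ltac:(intros; apply sol_comb; auto)).
  assert (p := Y_energy_nonneg x v (S n) tau ltac:(rewrite S_INR; unfold tau; lra)).
  assert (o := omega_const (Y x v n) (Y x v (S n)) tau s0 s s').
  unfold omega, pair, comb in *. cbn [dsp vel mdsp mvel] in *.
  rewrite h1, h2, i1, i2, i1', i2' in *. lra.
Qed.

Lemma Y_comb x v x' v' n : Y (x + x') (v + v') n s0 = comb 1 (Y x v n s0) 1 (Y x' v' n s0).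
Proof.
  destruct (HY x v n) as (s & i1 & i2 & h1 & h2). destruct (HY x' v' n) as (s' & i1' & i2' & h1' & h2').
  destruct (HY (x + x') (v + v') n) as (t & j1 & j2 & k1 & k2).
  assert (e := dirichlet_unique (fun t => comb 1 (Y (x + x') (v + v') n t) (-1) (comb 1 (Y x v n t) 1 (Y x' v' n t)))
    (s0 - (INR n + 1)) ltac:(assert (q := pos_INR n); lra)
    ltac:(intros; apply sol_comb; [|apply sol_comb]; auto)).
  unfold comb in e at 1 2 3 4 5. cbn [dsp vel mdsp mvel comb] in e.
  assert (e' : comb 1 (Y (x + x') (v + v') n s0) (-1) (comb 1 (Y x v n s0) 1 (Y x' v' n s0)) = pzero).
  { apply e; rewrite ?i1, ?i2, ?h1, ?h2, ?i1', ?i2', ?h1', ?h2', ?j1, ?j2, ?k1, ?k2; ring. }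
  unfold comb, pzero in *; cbn [dsp vel mdsp mvel] in *. injection e'; intros.
  apply phase_eq; cbn [dsp vel mdsp mvel]; lra.
Qed.

Lemma Y_energy_lim x v : exists l : R, is_lim_seq (fun n => pair (Y x v n s0) (Y x v n s0)) l.
Proof.
  apply ex_finite_lim_seq_decr with 0.
  - intros n; apply Y_energy_decr.
  - intros n; apply Y_energy_nonneg. assert (q := pos_INR n); lra.
Qed.

(** Backward Gronwall carries convergence from s0 to each fixed t. There the energies are
    nonnegative once the Dirichlet point lies left of t, so the limit has nonnegative energy and
    decays. *)
Lemma limit_decays (y : nat -> R -> phase) (Z : R -> phase) :
  (forall n t, sol_at V (y n) t) -> (forall t, sol_at V Z t) ->
  (forall n t, s0 - (INR n + 1) <= t <= s0 -> 0 <= pair (y n t) (y n t)) ->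
  is_lim_seq (fun n => dsp (y n s0)) (dsp (Z s0)) -> is_lim_seq (fun n => vel (y n s0)) (vel (Z s0)) ->
  is_lim_seq (fun n => mdsp (y n s0)) (mdsp (Z s0)) -> is_lim_seq (fun n => mvel (y n s0)) (mvel (Z s0)) ->
  decays Z.
Proof.
  intros sy sZ py l1 l2 l3 l4.
  apply (energy_decays V M m0 s0 m0_pos bV pV Z 0); [auto|]. intros t ht.
  set (e := fun n => nsq (comb 1 (Z t) (-1) (y n t))).
  assert (le : is_lim_seq e 0).
  { apply is_lim_seq_le_le with (fun _ => 0)
      (fun n => nsq (comb 1 (Z s0) (-1) (y n s0)) * exp ((M + 2) * (s0 - t))).
    - intros n; split; [apply nsq_pos|].
      apply (sol_bound_bwd V M (fun t => comb 1 (Z t) (-1) (y n t)) t s0 ht); intros; [apply bV | apply sol_comb; auto].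
    - apply is_lim_seq_const.
    - replace (Finite 0) with (Finite (0 * exp ((M + 2) * (s0 - t)))) by (f_equal; ring).
      apply is_lim_seq_mult'; [|apply is_lim_seq_const].
      unfold nsq, comb; cbn [dsp vel mdsp mvel].
      replace (Finite 0) with (Finite (0 + 0 + 0 + 0)) by (f_equal; ring).
      repeat apply is_lim_seq_plus'; apply lim_seq_comb_sq; assumption. }
  assert (c : forall p : phase -> R, (forall n, (p (Z t) - p (y n t)) ^ 2 <= e n) ->
     is_lim_seq (fun n => p (y n t)) (p (Z t))).
  { intros p hp. apply lim_seq_sq with e; assumption. }
  assert (sq : forall n, e n = (dsp (Z t) - dsp (y n t)) ^ 2 + (vel (Z t) - vel (y n t)) ^ 2
     + (mdsp (Z t) - mdsp (y n t)) ^ 2 + (mvel (Z t) - mvel (y n t)) ^ 2).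
  { intros n; unfold e, nsq, comb; cbn [dsp vel mdsp mvel]. ring. }
  assert (L : is_lim_seq (fun n => pair (y n t) (y n t)) (pair (Z t) (Z t))).
  { unfold pair. apply is_lim_seq_plus'; apply is_lim_seq_mult'; apply c; intros n; rewrite sq;
      assert (q1 := pow2_ge_0 (dsp (Z t) - dsp (y n t))); assert (q2 := pow2_ge_0 (vel (Z t) - vel (y n t)));
      assert (q3 := pow2_ge_0 (mdsp (Z t) - mdsp (y n t))); assert (q4 := pow2_ge_0 (mvel (Z t) - mvel (y n t))); lra. }
  change (Rbar_le 0 (pair (Z t) (Z t))).
  apply (is_lim_seq_le_loc (fun _ => 0) (fun n => pair (y n t) (y n t))); [|apply is_lim_seq_const | exact L].
  destruct (nfloor_ex (s0 - t)) as [N hN]; [lra|]. exists N. intros n hn. apply py.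
  apply le_INR in hn. lra.
Qed.

(** Monotonicity yields convergence of energies only. Polarization over (1, 0), (0, 1), (1, 1), with
    the symmetry [sym], turns this into convergence of all momenta at s0. *)
Lemma decaying_exists x v :
  exists Z, (forall t, sol_at V Z t) /\ decays Z /\ dsp (Z s0) = x /\ vel (Z s0) = v.
Proof.
  destruct (Y_energy_lim 1 0) as [la ha]. destruct (Y_energy_lim 0 1) as [lc hc].
  (* The position (1, 1) is kept in the form that [Y_comb] can split. *)
  destruct (Y_energy_lim (1 + 0) (0 + 1)) as [ls hs].
  assert (i10 : forall n, dsp (Y 1 0 n s0) = 1 /\ vel (Y 1 0 n s0) = 0) by (intros; split; apply HY).
  assert (i01 : forall n, dsp (Y 0 1 n s0) = 0 /\ vel (Y 0 1 n s0) = 1) by (intros; split; apply HY).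
  assert (sym : forall n, mvel (Y 1 0 n s0) = mdsp (Y 0 1 n s0)).
  { intros n. destruct (HY 1 0 n) as (s & i1 & i2 & h1 & h2). destruct (HY 0 1 n) as (s' & i1' & i2' & h1' & h2').
    assert (o := omega_const (Y 1 0 n) (Y 0 1 n) (s0 - (INR n + 1)) s0 s s').
    unfold omega, pair in o. rewrite i1, i2, h1, h2, i1', i2', h1', h2' in o. lra. }
  assert (A1 : is_lim_seq (fun n => mdsp (Y 1 0 n s0)) la).
  { apply is_lim_seq_ext with (2 := ha). intros n. destruct (i10 n) as [e1 e2]. unfold pair. rewrite e1, e2. ring. }
  assert (A4 : is_lim_seq (fun n => mvel (Y 0 1 n s0)) lc).
  { apply is_lim_seq_ext with (2 := hc). intros n. destruct (i01 n) as [e1 e2]. unfold pair. rewrite e1, e2. ring. }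
  assert (A2 : is_lim_seq (fun n => mvel (Y 1 0 n s0)) (/ 2 * (ls + -1 * la + -1 * lc))).
  { apply is_lim_seq_ext with (fun n => / 2 * (pair (Y (1 + 0) (0 + 1) n s0) (Y (1 + 0) (0 + 1) n s0)
       + -1 * mdsp (Y 1 0 n s0) + -1 * mvel (Y 0 1 n s0))).
    - intros n. rewrite Y_comb. destruct (i10 n) as [e1 e2], (i01 n) as [e3 e4].
      unfold pair, comb; cbn [dsp vel mdsp mvel]. rewrite e1, e2, e3, e4, <- (sym n). lra.
    - apply (is_lim_seq_scal_l _ (/ 2) (ls + -1 * la + -1 * lc)).
      repeat apply is_lim_seq_plus'; [assumption | apply (is_lim_seq_scal_l _ (-1) la) | apply (is_lim_seq_scal_l _ (-1) lc)]; assumption. }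
  set (lb := / 2 * (ls + -1 * la + -1 * lc)) in *.
  assert (A3 : is_lim_seq (fun n => mdsp (Y 0 1 n s0)) lb).
  { apply is_lim_seq_ext with (2 := A2). exact sym. }
  destruct (flow_exists V M s0 (Phase 1 0 la lb) cV bV) as (Z1 & j1 & t1).
  destruct (flow_exists V M s0 (Phase 0 1 lb lc) cV bV) as (Z2 & j2 & t2).
  assert (D : forall x v Z, (forall t, sol_at V Z t) -> dsp (Z s0) = x -> vel (Z s0) = v ->
    is_lim_seq (fun n => mdsp (Y x v n s0)) (mdsp (Z s0)) ->
    is_lim_seq (fun n => mvel (Y x v n s0)) (mvel (Z s0)) -> decays Z).
  { intros x' v' Z sZ e1 e2 l3 l4. apply (limit_decays (Y x' v') Z); try assumption.
    - intros n; apply HY.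
    - intros; apply Y_energy_nonneg; assumption.
    - apply is_lim_seq_ext with (fun _ => x'); [intros n; symmetry; apply HY | rewrite e1; apply is_lim_seq_const].
    - apply is_lim_seq_ext with (fun _ => v'); [intros n; symmetry; apply HY | rewrite e2; apply is_lim_seq_const]. }
  assert (D1 : decays Z1) by (apply (D 1 0); rewrite ?j1; auto).
  assert (D2 : decays Z2) by (apply (D 0 1); rewrite ?j2; auto).
  exists (fun t => comb x (Z1 t) v (Z2 t)). split; [intros; apply sol_comb; auto|].
  split; [apply decays_comb; assumption|]. rewrite j1, j2; unfold comb; simpl. split; ring.
Qed.
End DecayingSolutions.

(** * Dependence on the spectral parameter *)

Lemma continuous_Rplus (f g : R -> R) x : continuous f x -> continuous g x -> continuous (fun t => f t + g t) x.
Proof. intros; apply (continuous_plus f g); assumption. Qed.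
Lemma continuous_Rminus (f g : R -> R) x : continuous f x -> continuous g x -> continuous (fun t => f t - g t) x.
Proof. intros; apply (continuous_minus f g); assumption. Qed.
Lemma continuous_Ropp (f : R -> R) x : continuous f x -> continuous (fun t => - f t) x.
Proof. intros; apply (continuous_opp f); assumption. Qed.
Lemma continuous_Rmult (f g : R -> R) x : continuous f x -> continuous g x -> continuous (fun t => f t * g t) x.
Proof. intros; apply (continuous_mult f g); assumption. Qed.
Lemma continuous_Rsqr (f : R -> R) x : continuous f x -> continuous (fun t => f t ^ 2) x.
Proof.
  intros h. apply continuous_ext with (fun t => f t * f t); [intros t; simpl; ring|].
  apply continuous_Rmult; assumption.
Qed.
Lemma continuous_Rinv_fun (f : R -> R) x : continuous f x -> f x <> 0 -> continuous (fun t => / f t) x.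
Proof. intros h n. apply (continuous_Rinv_comp f x h n). Qed.

Ltac cstep :=
  lazymatch goal with
  | |- continuous (fun _ => ?c) _ => apply continuous_const
  | |- continuous (fun t => t) _ => apply continuous_id
  | |- continuous (fun t => @?f t + @?g t) _ => apply (continuous_Rplus f g)
  | |- continuous (fun t => @?f t - @?g t) _ => apply (continuous_Rminus f g)
  | |- continuous (fun t => @?f t * @?g t) _ => apply (continuous_Rmult f g)
  | |- continuous (fun t => - @?f t) _ => apply (continuous_Ropp f)
  | |- continuous (fun t => @?f t ^ 2) _ => apply (continuous_Rsqr f)
  | |- continuous (fun t => / @?f t) _ => apply (continuous_Rinv_fun f)
  | |- continuous (fun t => @?f t / @?g t) _ => unfold Rdiv
  | |- _ => first [assumption | solve [auto]]
  end.
Ltac csolve := repeat cstep.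

Lemma continuous_pos_near (f : R -> R) x : continuous f x -> 0 < f x ->
  exists d, 0 < d /\ forall y, Rabs (y - x) < d -> 0 < f y.
Proof.
  intros c p. destruct (c (fun y => 0 < y)) as [d hd].
  { exists (mkposreal _ p). intros y hy.
    unfold ball in hy; simpl in hy; unfold AbsRing_ball, abs, minus, plus, opp in hy; simpl in hy.
    apply Rabs_def2 in hy; lra. }
  exists d. split; [apply cond_pos|]. intros y hy. apply hd. exact hy.
Qed.

Lemma continuous_of_sq_bound (g : R -> R) x C d : 0 < d ->
  (forall y, Rabs (y - x) < d -> (g x - g y) ^ 2 <= C * (y - x) ^ 2) -> continuous g x.
Proof.
  intros d0 h P [eps hP].
  assert (e0 := cond_pos eps).
  set (k := Rabs C + 1). assert (k1 : 1 <= k) by (unfold k; assert (q := Rabs_pos C); lra).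
  set (r := Rmin d (eps / k)).
  assert (r0 : 0 < r) by (apply Rmin_pos; [assumption | apply Rdiv_lt_0_compat; lra]).
  exists (mkposreal r r0). intros y hy. apply hP.
  unfold ball in *; simpl in *; unfold AbsRing_ball, abs, minus, plus, opp in *; simpl in *.
  fold (y - x) in hy. change (Rabs (g y - g x) < eps).
  assert (r1 := Rmin_l d (eps / k)). assert (r2 := Rmin_r d (eps / k)). fold r in r1, r2.
  specialize (h y ltac:(lra)).
  assert (hk : Rabs (y - x) * k < eps) by (apply Rlt_div_r; lra).
  assert (Ck : C <= k ^ 2) by (assert (q := Rle_abs C); unfold k in *; nra).
  assert (b : (g x - g y) ^ 2 <= (Rabs (y - x) * k) ^ 2).
  { rewrite Rpow_mult_distr, pow2_abs. eapply Rle_trans; [exact h|].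
    rewrite Rmult_comm. apply Rmult_le_compat_l; [apply pow2_ge_0 | assumption]. }
  assert (0 <= Rabs (y - x) * k) by (apply Rmult_le_pos; [apply Rabs_pos | lra]).
  apply Rabs_def1; apply Rnot_le_lt; intros c; nra.
Qed.

Lemma nsq_diff z w : nsq (comb 1 z (-1) w) = (dsp z - dsp w) ^ 2 + (vel z - vel w) ^ 2
  + (mdsp z - mdsp w) ^ 2 + (mvel z - mvel w) ^ 2.
Proof. unfold nsq, comb; cbn [dsp vel mdsp mvel]; ring. Qed.

Lemma comb_zero z w : comb 1 z (-1) w = pzero -> z = w.
Proof.
  destruct z as [z1 z2 z3 z4], w as [w1 w2 w3 w4]; unfold comb, pzero; cbn [dsp vel mdsp mvel]; intros e; injection e; intros.
  apply phase_eq; cbn [dsp vel mdsp mvel]; lra.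
Qed.

Definition shift (W : R -> R) (lam t : R) : R := lam + W t.

Section Family.
Variables (W : R -> R) (M : R).
Hypothesis (bW : forall t, Rabs (W t) <= M).

Lemma shift_bound lam t : Rabs (shift W lam t) <= Rabs lam + M.
Proof. unfold shift. eapply Rle_trans; [apply Rabs_triang|]. specialize (bW t); lra. Qed.

Lemma shift_bound_near lam lam' t : Rabs (lam' - lam) < 1 -> Rabs (shift W lam' t) <= Rabs lam + 1 + M.
Proof.
  intros h. assert (q := shift_bound lam' t).
  assert (Rabs lam' <= Rabs lam + 1); [|lra].
  replace lam' with (lam' - lam + lam) by ring. eapply Rle_trans; [apply Rabs_triang|]. lra.
Qed.

(** Passing from the square to the absolute value by |x| <= 1 + x^2 avoids a square root. *)
Lemma sol_dsp_bound z lam a b : (forall t, a <= t <= b -> sol_at (shift W lam) z t) ->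
  forall t, a <= t <= b -> Rabs (dsp (z t)) <= 1 + nsq (z a) * exp ((Rabs lam + M + 2) * (b - a)).
Proof.
  intros s t ht.
  assert (q := sol_bound_fwd (shift W lam) (Rabs lam + M) z a t ltac:(lra) (fun t _ => shift_bound lam t)
    ltac:(intros; apply s; lra)).
  assert (nsq (z a) * exp ((Rabs lam + M + 2) * (t - a)) <= nsq (z a) * exp ((Rabs lam + M + 2) * (b - a))).
  { apply Rmult_le_compat_l; [apply nsq_pos|].
    destruct (Req_dec t b) as [->|n]; [lra|]. left. apply exp_increasing.
    assert (0 <= Rabs lam) by apply Rabs_pos. assert (0 <= M) by (assert (u := bW 0); assert (v := Rabs_pos (W 0)); lra).
    apply Rmult_lt_compat_l; lra. }
  assert (dsp (z t) ^ 2 <= nsq (z t)) by (unfold nsq; nra).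
  assert (0 <= (1 - Rabs (dsp (z t))) ^ 2) by apply pow2_ge_0.
  assert (e := pow2_abs (dsp (z t))). assert (p := Rabs_pos (dsp (z t))). nra.
Qed.

Lemma exp_growth c a t b : 0 <= c -> t <= b -> exp (c * (t - a)) <= exp (c * (b - a)).
Proof.
  intros c0 tb. assert (h : c * (t - a) <= c * (b - a)) by (apply Rmult_le_compat_l; lra).
  destruct h as [h|h]; [left; apply exp_increasing; assumption | rewrite h; lra].
Qed.

Lemma family_bound z w lam lam' a b t : a <= t <= b -> Rabs (lam' - lam) < 1 ->
  (forall s, a <= s <= b -> sol_at (shift W lam) z s) -> (forall s, a <= s <= b -> sol_at (shift W lam') w s) ->
  nsq (comb 1 (z t) (-1) (w t)) <=
  (nsq (comb 1 (z a) (-1) (w a)) +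
    ((lam - lam') * (1 + nsq (z a) * exp ((Rabs lam + M + 2) * (b - a)))) ^ 2) *
  exp ((Rabs lam + 1 + M + 2) * (b - a)).
Proof.
  intros ht hl sz sw.
  eapply Rle_trans; [apply (sol_diff_bound (shift W lam) (shift W lam') (Rabs lam + 1 + M) z w (lam - lam')
     (1 + nsq (z a) * exp ((Rabs lam + M + 2) * (b - a))) a t)|].
  - lra.
  - intros; apply shift_bound_near; assumption.
  - intros; unfold shift; ring.
  - intros; apply sz; lra.
  - intros; apply sw; lra.
  - intros u hu; apply sol_dsp_bound; [assumption | lra].
  - apply Rmult_le_compat_l; [apply Rplus_le_le_0_compat; [apply nsq_pos | apply pow2_ge_0]|].
    apply exp_growth; [|lra].
    assert (0 <= Rabs lam) by apply Rabs_pos. assert (0 <= M) by (assert (u := bW 0); assert (v := Rabs_pos (W 0)); lra). lra.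
Qed.

(** Lipschitz dependence of the data at [a] is enough: the change of potential adds a term of order
    (lam' - lam)^2, and the flow multiplies by a Gronwall factor. The radius is capped at 1 to have
    one bound for all potentials involved. *)
Lemma family_continuous (z : R -> R -> phase) lam a t C d : a <= t -> 0 < d ->
  (forall lam', Rabs (lam' - lam) < d -> forall s, sol_at (shift W lam') (z lam') s) ->
  (forall lam', Rabs (lam' - lam) < d -> nsq (comb 1 (z lam a) (-1) (z lam' a)) <= C * (lam' - lam) ^ 2) ->
  continuous (fun l => dsp (z l t)) lam /\ continuous (fun l => vel (z l t)) lam /\
  continuous (fun l => mdsp (z l t)) lam /\ continuous (fun l => mvel (z l t)) lam.
Proof.
  intros ht d0 s h.
  set (Q := (1 + nsq (z lam a) * exp ((Rabs lam + M + 2) * (t - a))) ^ 2).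
  set (E := exp ((Rabs lam + 1 + M + 2) * (t - a))).
  assert (r0 : 0 < Rmin d 1) by (apply Rmin_pos; lra).
  assert (b : forall y, Rabs (y - lam) < Rmin d 1 ->
    nsq (comb 1 (z lam t) (-1) (z y t)) <= ((C + Q) * E) * (y - lam) ^ 2).
  { intros y hy. assert (r1 := Rmin_l d 1). assert (r2 := Rmin_r d 1).
    eapply Rle_trans; [apply (family_bound (z lam) (z y) lam y a t t ltac:(lra)); [lra| |]|].
    - intros u _. apply s. rewrite Rminus_diag, Rabs_R0. assumption.
    - intros u _. apply s. lra.
    - fold E. apply Rle_trans with ((C * (y - lam) ^ 2 + (y - lam) ^ 2 * Q) * E).
      + apply Rmult_le_compat_r; [left; apply exp_pos|]. specialize (h y ltac:(lra)).
        apply Rplus_le_compat; [assumption|]. apply Req_le. unfold Q. ring.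
      + apply Req_le; ring. }
  assert (g : forall p : phase -> R, (forall u v, (p u - p v) ^ 2 <= nsq (comb 1 u (-1) v)) ->
    continuous (fun l => p (z l t)) lam).
  { intros p hp. apply (continuous_of_sq_bound _ lam ((C + Q) * E) (Rmin d 1) r0).
    intros y hy. eapply Rle_trans; [apply hp | apply b; assumption]. }
  split4; apply g; intros u v; rewrite nsq_diff;
    assert (q1 := pow2_ge_0 (dsp u - dsp v)); assert (q2 := pow2_ge_0 (vel u - vel v));
    assert (q3 := pow2_ge_0 (mdsp u - mdsp v)); assert (q4 := pow2_ge_0 (mvel u - mvel v)); lra.
Qed.
End Family.

(** * Symmetric 2 x 2 matrices *)

Record mat := Mat { m11 : R; m12 : R; m21 : R; m22 : R }.

Definition det (A : mat) : R := m11 A * m22 A - m12 A * m21 A.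

Definition mul (A B : mat) : mat :=
  Mat (m11 A * m11 B + m12 A * m21 B) (m11 A * m12 B + m12 A * m22 B)
      (m21 A * m11 B + m22 A * m21 B) (m21 A * m12 B + m22 A * m22 B).

Definition inv (A : mat) : mat :=
  Mat (m22 A / det A) (- m12 A / det A) (- m21 A / det A) (m11 A / det A).

Definition ap1 (A : mat) (x v : R) : R := m11 A * x + m12 A * v.
Definition ap2 (A : mat) (x v : R) : R := m21 A * x + m22 A * v.

Lemma mat_eq A B : m11 A = m11 B -> m12 A = m12 B -> m21 A = m21 B -> m22 A = m22 B -> A = B.
Proof. destruct A, B; simpl; intros -> -> -> ->; reflexivity. Qed.

Lemma ap1_inv A x v : det A <> 0 -> ap1 A (ap1 (inv A) x v) (ap2 (inv A) x v) = x.
Proof. intros d. unfold ap1, ap2, inv, det in *; cbn [m11 m12 m21 m22]. field. exact d. Qed.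

Lemma ap2_inv A x v : det A <> 0 -> ap2 A (ap1 (inv A) x v) (ap2 (inv A) x v) = v.
Proof. intros d. unfold ap1, ap2, inv, det in *; cbn [m11 m12 m21 m22]. field. exact d. Qed.

Lemma ap1_mul A B x v : ap1 (mul A B) x v = ap1 A (ap1 B x v) (ap2 B x v).
Proof. unfold ap1, ap2, mul; cbn [m11 m12 m21 m22]. ring. Qed.

Lemma ap2_mul A B x v : ap2 (mul A B) x v = ap2 A (ap1 B x v) (ap2 B x v).
Proof. unfold ap1, ap2, mul; cbn [m11 m12 m21 m22]. ring. Qed.

Definition mcont (A : R -> mat) (x : R) : Prop :=
  continuous (fun t => m11 (A t)) x /\ continuous (fun t => m12 (A t)) x /\
  continuous (fun t => m21 (A t)) x /\ continuous (fun t => m22 (A t)) x.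

Lemma mcont_det A x : mcont A x -> continuous (fun t => det (A t)) x.
Proof. intros (a1 & a2 & a3 & a4). unfold det. csolve. Qed.

Lemma mcont_mul A B x : mcont A x -> mcont B x -> mcont (fun t => mul (A t) (B t)) x.
Proof.
  intros (a1 & a2 & a3 & a4) (b1 & b2 & b3 & b4). unfold mcont, mul; cbn [m11 m12 m21 m22]. split4; csolve.
Qed.

Lemma mcont_inv A x : mcont A x -> det (A x) <> 0 -> mcont (fun t => inv (A t)) x.
Proof.
  intros hA d. assert (c := mcont_det A x hA). destruct hA as (a1 & a2 & a3 & a4).
  unfold mcont, inv; cbn [m11 m12 m21 m22]. split4; csolve.
Qed.

Definition is_zero (x : R) : nat := if Req_EM_T x 0 then 1%nat else 0%nat.

(** Given by cases so that it also applies to the matrix [U], which need not be symmetric;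
    [corank_eig] reads it off the eigenvalues in the symmetric case. *)
Definition corank (A : mat) : nat :=
  if Req_EM_T (det A) 0 then
    if Req_EM_T (m11 A ^ 2 + m12 A ^ 2 + m21 A ^ 2 + m22 A ^ 2) 0 then 2%nat else 1%nat
  else 0%nat.

Lemma sum_sq4_zero a b c d : a ^ 2 + b ^ 2 + c ^ 2 + d ^ 2 = 0 -> a = 0 /\ b = 0 /\ c = 0 /\ d = 0.
Proof.
  intros h. assert (ha := pow2_ge_0 a). assert (hb := pow2_ge_0 b). assert (hc := pow2_ge_0 c). assert (hd := pow2_ge_0 d).
  split4; apply Rsqr_0_uniq; unfold Rsqr; lra.
Qed.

Lemma det_mul A B : det (mul A B) = det A * det B.
Proof. unfold det, mul; cbn [m11 m12 m21 m22]. ring. Qed.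

Lemma det_inv A : det A <> 0 -> det (inv A) = / det A.
Proof. intros d. unfold inv, det in *; cbn [m11 m12 m21 m22]. field. exact d. Qed.

Lemma mul_inv_r A X : det A <> 0 -> mul A (mul (inv A) X) = X.
Proof.
  intros d. unfold mul, inv, det in *; apply mat_eq; cbn [m11 m12 m21 m22]; field; exact d.
Qed.

Lemma mul_zero A B X : m11 X = 0 /\ m12 X = 0 /\ m21 X = 0 /\ m22 X = 0 ->
  m11 (mul A (mul X B)) = 0 /\ m12 (mul A (mul X B)) = 0 /\ m21 (mul A (mul X B)) = 0 /\ m22 (mul A (mul X B)) = 0.
Proof. intros (a & b & c & d). unfold mul; cbn [m11 m12 m21 m22]. rewrite a, b, c, d. split4; ring. Qed.

Lemma corank_mul A B X : det A <> 0 -> det B <> 0 -> corank (mul A (mul X (inv B))) = corank X.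
Proof.
  intros hA hB.
  assert (dd : det (mul A (mul X (inv B))) = det A * det X * / det B) by (rewrite !det_mul, det_inv by assumption; ring).
  set (Y := mul A (mul X (inv B))) in *.
  assert (XY : X = mul (inv A) (mul Y B)).
  { unfold Y. unfold mul, inv, det in *; apply mat_eq; cbn [m11 m12 m21 m22]; field; split; assumption. }
  assert (z : det Y = 0 <-> det X = 0).
  { rewrite dd. split; intros h.
    - destruct (Rmult_integral _ _ h) as [h'|h']; [|exfalso; apply (Rinv_neq_0_compat _ hB h')].
      destruct (Rmult_integral _ _ h'); [contradiction | assumption].
    - rewrite h; ring. }
  assert (ss : m11 Y ^ 2 + m12 Y ^ 2 + m21 Y ^ 2 + m22 Y ^ 2 = 0 <-> m11 X ^ 2 + m12 X ^ 2 + m21 X ^ 2 + m22 X ^ 2 = 0).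
  { split; intros h; apply sum_sq4_zero in h.
    - rewrite XY. destruct (mul_zero (inv A) B Y h) as (a & b & c & d). rewrite a, b, c, d. ring.
    - unfold Y. destruct (mul_zero A (inv B) X h) as (a & b & c & d). rewrite a, b, c, d. ring. }
  unfold corank.
  destruct (Req_EM_T (det Y) 0), (Req_EM_T (det X) 0); try tauto.
  destruct (Req_EM_T (m11 Y ^ 2 + m12 Y ^ 2 + m21 Y ^ 2 + m22 Y ^ 2) 0), (Req_EM_T (m11 X ^ 2 + m12 X ^ 2 + m21 X ^ 2 + m22 X ^ 2) 0); tauto.
Qed.

(** For symmetric matrices [eigp] and [eigm] below are the ordered eigenvalues. These closed
    formulas stay continuous where the eigenvalues collide, so no branch has to be followed. *)
Definition disc (A : mat) : R := (m11 A - m22 A) ^ 2 + 4 * m12 A ^ 2.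
Definition eigp (A : mat) : R := (m11 A + m22 A + sqrt (disc A)) / 2.
Definition eigm (A : mat) : R := (m11 A + m22 A - sqrt (disc A)) / 2.
Definition form (A : mat) (x v : R) : R := x * ap1 A x v + v * ap2 A x v.

Lemma disc_nonneg A : 0 <= disc A.
Proof. unfold disc. assert (a := pow2_ge_0 (m11 A - m22 A)). assert (b := pow2_ge_0 (m12 A)). lra. Qed.

Lemma disc_sqrt A : sqrt (disc A) ^ 2 = disc A.
Proof. simpl. rewrite Rmult_1_r. apply sqrt_sqrt, disc_nonneg. Qed.

Lemma eig_prod A : m12 A = m21 A -> eigp A * eigm A = det A.
Proof.
  intros s. assert (q := disc_sqrt A). unfold eigp, eigm, det. rewrite <- s. unfold disc in *.
  set (r := sqrt _) in *. replace ((m11 A + m22 A + r) / 2 * ((m11 A + m22 A - r) / 2))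
    with (((m11 A + m22 A) ^ 2 - r ^ 2) / 4) by field. rewrite q. field.
Qed.

Lemma corank_eig A : m12 A = m21 A -> corank A = (is_zero (eigp A) + is_zero (eigm A))%nat.
Proof.
  intros s. assert (p := eig_prod A s). unfold corank, is_zero.
  destruct (Req_EM_T (det A) 0) as [d|d].
  - rewrite d in p.
    destruct (Req_EM_T (m11 A ^ 2 + m12 A ^ 2 + m21 A ^ 2 + m22 A ^ 2) 0) as [h|h].
    + apply sum_sq4_zero in h. destruct h as (a & b & c & e).
      assert (r : sqrt (disc A) = 0) by (unfold disc; rewrite a, b, e; replace ((0 - 0) ^ 2 + 4 * 0 ^ 2) with 0 by ring; apply sqrt_0).
      unfold eigp, eigm. rewrite a, e, r.
      destruct (Req_EM_T ((0 + 0 + 0) / 2) 0), (Req_EM_T ((0 + 0 - 0) / 2) 0); try reflexivity; exfalso; lra.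
    + destruct (Req_EM_T (eigp A) 0) as [e1|e1], (Req_EM_T (eigm A) 0) as [e2|e2]; try reflexivity.
      * exfalso; apply h. unfold eigp, eigm in e1, e2.
        assert (r : sqrt (disc A) = 0) by lra. assert (q := disc_sqrt A). rewrite r in q. unfold disc in q.
        assert (a := pow2_ge_0 (m11 A - m22 A)). assert (b := pow2_ge_0 (m12 A)).
        assert (t : m22 A = - m11 A) by lra. rewrite <- s, t in *.
        replace (m11 A ^ 2 + m12 A ^ 2 + m12 A ^ 2 + (- m11 A) ^ 2) with (2 * m12 A ^ 2 + / 2 * (m11 A - - m11 A) ^ 2) by field. lra.
      * exfalso. destruct (Rmult_integral _ _ p); contradiction.
  - destruct (Req_EM_T (eigp A) 0) as [e|e]; [rewrite e in p; lra|].
    destruct (Req_EM_T (eigm A) 0) as [e'|e']; [rewrite e' in p; lra | reflexivity].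
Qed.

Lemma eigen_vector A mu : m12 A = m21 A -> (m11 A - mu) * (m22 A - mu) = m12 A ^ 2 ->
  exists x v, (x <> 0 \/ v <> 0) /\ form A x v = mu * (x ^ 2 + v ^ 2).
Proof.
  intros s h. unfold form, ap1, ap2. rewrite <- s.
  destruct (Req_EM_T (m12 A) 0) as [b|b].
  - rewrite b in *. destruct (Req_EM_T (m11 A) mu) as [e|e].
    + exists 1, 0. split; [left; lra|]. rewrite e. ring.
    + exists 0, 1. split; [right; lra|]. assert (m22 A = mu); [|subst; ring].
      destruct (Rmult_integral (m11 A - mu) (m22 A - mu)); [rewrite h; ring | lra | lra].
  - exists (m12 A), (mu - m11 A). split; [left; assumption|].
    replace (m12 A * (m11 A * m12 A + m12 A * (mu - m11 A)) + (mu - m11 A) * (m12 A * m12 A + m22 A * (mu - m11 A)))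
      with (mu * m12 A ^ 2 + (mu - m11 A) * (m12 A ^ 2 - (m11 A - mu) * (m22 A - mu) + mu * (mu - m11 A))) by ring.
    rewrite h. ring.
Qed.

Lemma eigp_char A : (m11 A - eigp A) * (m22 A - eigp A) = m12 A ^ 2.
Proof.
  assert (q := disc_sqrt A). unfold eigp, disc in *. set (r := sqrt _) in *.
  replace ((m11 A - (m11 A + m22 A + r) / 2) * (m22 A - (m11 A + m22 A + r) / 2))
    with ((r ^ 2 - (m11 A - m22 A) ^ 2) / 4) by field. rewrite q. field.
Qed.

Lemma eigm_char A : (m11 A - eigm A) * (m22 A - eigm A) = m12 A ^ 2.
Proof.
  assert (q := disc_sqrt A). unfold eigm, disc in *. set (r := sqrt _) in *.
  replace ((m11 A - (m11 A + m22 A - r) / 2) * (m22 A - (m11 A + m22 A - r) / 2))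
    with ((r ^ 2 - (m11 A - m22 A) ^ 2) / 4) by field. rewrite q. field.
Qed.

Lemma sqrt_disc_ge A : Rabs (m11 A - m22 A) <= sqrt (disc A).
Proof.
  rewrite <- sqrt_Rsqr_abs. apply sqrt_le_1_alt. unfold disc, Rsqr. assert (b := pow2_ge_0 (m12 A)). nra.
Qed.

Lemma psd_form a b c x v : 0 <= a -> 0 <= c -> a * c = b ^ 2 -> 0 <= a * x ^ 2 + 2 * b * x * v + c * v ^ 2.
Proof.
  intros ha hc h.
  destruct (Req_EM_T a 0) as [e|e].
  - rewrite e, Rmult_0_l in h. assert (b = 0) by (apply Rsqr_0_uniq; unfold Rsqr; lra). subst.
    assert (0 <= c * v ^ 2) by (apply Rmult_le_pos; [assumption | apply pow2_ge_0]). lra.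
  - apply Rmult_le_reg_l with a; [lra|].
    replace (a * (a * x ^ 2 + 2 * b * x * v + c * v ^ 2)) with ((a * x + b * v) ^ 2 + (a * c - b ^ 2) * v ^ 2) by ring.
    rewrite h. assert (q := pow2_ge_0 (a * x + b * v)). lra.
Qed.

(** The matrix [eigp A] times the identity minus A has zero determinant and nonnegative diagonal,
    hence is positive semidefinite by [psd_form]. *)
Lemma form_le_eigp A x v : m12 A = m21 A -> form A x v <= eigp A * (x ^ 2 + v ^ 2).
Proof.
  intros s. assert (q := sqrt_disc_ge A). apply Rabs_le_between in q.
  assert (p := psd_form (eigp A - m11 A) (- m12 A) (eigp A - m22 A) x v).
  assert (0 <= (eigp A - m11 A) * x ^ 2 + 2 * - m12 A * x * v + (eigp A - m22 A) * v ^ 2).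
  { apply p; [unfold eigp; lra | unfold eigp; lra |]. assert (c := eigp_char A). lra. }
  unfold form, ap1, ap2. rewrite <- s. lra.
Qed.

Lemma eigm_le_form A x v : m12 A = m21 A -> eigm A * (x ^ 2 + v ^ 2) <= form A x v.
Proof.
  intros s. assert (q := sqrt_disc_ge A). apply Rabs_le_between in q.
  assert (p := psd_form (m11 A - eigm A) (m12 A) (m22 A - eigm A) x v).
  assert (0 <= (m11 A - eigm A) * x ^ 2 + 2 * m12 A * x * v + (m22 A - eigm A) * v ^ 2).
  { apply p; [unfold eigm; lra | unfold eigm; lra |]. exact (eigm_char A). }
  unfold form, ap1, ap2. rewrite <- s. lra.
Qed.

Lemma sq_sum_pos x v : x <> 0 \/ v <> 0 -> 0 < x ^ 2 + v ^ 2.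
Proof.
  intros h. assert (a := pow2_ge_0 x). assert (b := pow2_ge_0 v).
  destruct h as [h|h]; apply pow2_gt_0 in h; lra.
Qed.

(** Min-max: the top eigenvector of [A] is a test vector for [eigp B], the bottom eigenvector of [B]
    one for [eigm A]. *)
Lemma eig_strict A B : m12 A = m21 A -> m12 B = m21 B ->
  (forall x v, x <> 0 \/ v <> 0 -> form A x v < form B x v) -> eigp A < eigp B /\ eigm A < eigm B.
Proof.
  intros sA sB h. split.
  - destruct (eigen_vector A (eigp A) sA (eigp_char A)) as (x & v & nz & e).
    assert (q := form_le_eigp B x v sB). specialize (h x v nz).
    apply Rmult_lt_reg_r with (x ^ 2 + v ^ 2); [apply sq_sum_pos; assumption | lra].
  - destruct (eigen_vector B (eigm B) sB (eigm_char B)) as (x & v & nz & e).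
    assert (q := eigm_le_form A x v sA). specialize (h x v nz).
    apply Rmult_lt_reg_r with (x ^ 2 + v ^ 2); [apply sq_sum_pos; assumption | lra].
Qed.

Lemma eig_continuous A x : mcont A x ->
  continuous (fun t => eigp (A t)) x /\ continuous (fun t => eigm (A t)) x.
Proof.
  intros (a1 & a2 & a3 & a4).
  assert (c : continuous (fun t => sqrt (disc (A t))) x).
  { apply (continuous_comp (fun t => disc (A t)) sqrt); [unfold disc; csolve|].
    apply continuous_sqrt. }
  unfold eigp, eigm. split; csolve; apply (continuous_const (/ 2)).
Qed.

(** * Counting *)

Fixpoint sumf (f : R -> nat) (l : list R) : nat :=
  match l with nil => 0%nat | x :: l => (f x + sumf f l)%nat end.

(** The list may contain points where [f] vanishes, so that two functions can share one list in
    [Count_add]. Filtering restores positive multiplicities in [count_with_mult_of_Count]. *)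
Definition Count (P : R -> Prop) (f : R -> nat) (n : nat) : Prop :=
  exists l, NoDup l /\ (forall x, In x l -> P x) /\ (forall x, P x -> (0 < f x)%nat -> In x l) /\ sumf f l = n.

Lemma sumf_perm f l l' : Permutation l l' -> sumf f l = sumf f l'.
Proof. induction 1; simpl; lia. Qed.

Lemma sumf_app f l l' : sumf f (l ++ l') = (sumf f l + sumf f l')%nat.
Proof. induction l; simpl; lia. Qed.

Lemma sumf_filter f l : sumf f (filter (fun x => Nat.ltb 0 (f x)) l) = sumf f l.
Proof.
  induction l as [|x l IH]; [reflexivity|]. simpl. destruct (f x) eqn:e; simpl; lia.
Qed.

Lemma Count_list_unique P f l l' :
  NoDup l -> (forall x, In x l -> P x) -> (forall x, P x -> (0 < f x)%nat -> In x l) ->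
  NoDup l' -> (forall x, In x l' -> P x) -> (forall x, P x -> (0 < f x)%nat -> In x l') -> sumf f l = sumf f l'.
Proof.
  intros n1 p1 c1 n2 p2 c2. rewrite <- (sumf_filter f l), <- (sumf_filter f l').
  apply sumf_perm, NoDup_Permutation; try (apply NoDup_filter; assumption).
  intros x. rewrite !filter_In, Nat.ltb_lt. split; intros [h1 h2]; split; auto.
Qed.

Lemma Count_unique P f n n' : Count P f n -> Count P f n' -> n = n'.
Proof.
  intros (l & n1 & p1 & c1 & <-) (l' & n2 & p2 & c2 & <-). apply (Count_list_unique P); assumption.
Qed.

Lemma Count_ext P Q f g n : (forall x, P x <-> Q x) -> (forall x, P x -> f x = g x) -> Count P f n -> Count Q g n.
Proof.
  intros pq fg (l & n1 & p1 & c1 & e). exists l. split4.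
  - assumption.
  - intros x hx. apply pq, p1, hx.
  - intros x hx h. apply pq in hx. rewrite <- (fg x hx) in h. auto.
  - rewrite <- e. clear - fg p1. induction l as [|x l IH]; [reflexivity|]. simpl. rewrite (fg x) by (apply p1; left; reflexivity).
    rewrite IH; [reflexivity|]. intros y hy; apply p1; right; assumption.
Qed.

Lemma Count_zero P f : (forall x, P x -> f x = 0%nat) -> Count P f 0.
Proof.
  intros h. exists nil. split4; [constructor | intros x [] | | reflexivity].
  intros x hx p. rewrite (h x hx) in p. lia.
Qed.

Lemma Count_split P Q S f n n' : (forall x, P x -> Q x -> False) -> (forall x, S x <-> P x \/ Q x) ->
  Count P f n -> Count Q f n' -> Count S f (n + n').
Proof.
  intros d e (l & n1 & p1 & c1 & e1) (l' & n2 & p2 & c2 & e2). exists (l ++ l'). split4.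
  - apply NoDup_app; auto. intros x h1 h2. apply (d x); auto.
  - intros x hx. apply e. apply in_app_or in hx. destruct hx; auto.
  - intros x hx p. apply in_or_app. apply e in hx. destruct hx; auto.
  - rewrite sumf_app. lia.
Qed.

Lemma Count_add P f g n n' : Count P f n -> Count P g n' -> Count P (fun x => f x + g x)%nat (n + n').
Proof.
  intros (l & n1 & p1 & c1 & e1) (l' & n2 & p2 & c2 & e2).
  set (k := nodup Req_EM_T (l ++ l')).
  assert (nk : NoDup k) by apply NoDup_nodup.
  assert (pk : forall x, In x k -> P x).
  { intros x hx. apply nodup_In, in_app_or in hx. destruct hx; auto. }
  assert (ck : forall x, In x l \/ In x l' -> In x k) by (intros x hx; apply nodup_In, in_or_app; assumption).
  exists k. split4; try assumption.
  - intros x hx h. apply ck. destruct (f x) eqn:e; [right; apply c2; [assumption | lia] | left; apply c1; [assumption | lia]].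
  - rewrite <- e1, <- e2.
    rewrite (Count_list_unique P f l k), (Count_list_unique P g l' k); auto.
    clear. induction k as [|x k IH]; simpl; lia.
Qed.

Lemma Count_single P f x : P x -> (forall y, P y -> y <> x -> f y = 0%nat) -> Count P f (f x).
Proof.
  intros hx h. exists (x :: nil). split4.
  - repeat constructor. intros [].
  - intros y [<-|[]]; assumption.
  - intros y hy p. left. destruct (Req_EM_T y x) as [e|e]; [auto|]. rewrite (h y hy e) in p; lia.
  - simpl; lia.
Qed.

Definition is_neg (x : R) : nat := if Rlt_dec x 0 then 1%nat else 0%nat.

(** The half-open interval matches the strictness of [is_neg]: for a < b, a zero at [a] is counted
    and is followed by negative values, while a zero at [b] is neither counted nor negative. *)
Lemma Count_decr_zeros (g : R -> R) a b : a <= b -> (forall x, a <= x <= b -> continuous g x) ->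
  (forall x y, a <= x -> x < y -> y <= b -> g y < g x) ->
  exists n, Count (fun x => a <= x < b) (fun x => is_zero (g x)) n /\ (n + is_neg (g a) = is_neg (g b))%nat.
Proof.
  intros ab c h.
  assert (noz : (forall x, a <= x < b -> g x <> 0) -> Count (fun x => a <= x < b) (fun x => is_zero (g x)) 0).
  { intros nz. apply Count_zero. intros x hx. unfold is_zero. destruct (Req_EM_T (g x) 0); [exfalso; apply (nz x hx); assumption | reflexivity]. }
  unfold is_neg. destruct (Rlt_dec (g a) 0) as [na|na].
  - exists 0%nat. split.
    + apply noz. intros x hx e. destruct (Req_dec a x) as [->|ne]; [lra|]. specialize (h a x ltac:(lra) ltac:(lra) ltac:(lra)). lra.
    + destruct (Rlt_dec (g b) 0) as [nb|nb]; [reflexivity|]. destruct (Req_dec a b) as [->|ne]; [contradiction|].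
      specialize (h a b ltac:(lra) ltac:(lra) ltac:(lra)). lra.
  - destruct (Rlt_dec (g b) 0) as [nb|nb].
    + assert (l : a < b) by (destruct (Req_dec a b) as [->|ne]; [contradiction | lra]).
      assert (exists x, a <= x < b /\ g x = 0) as (x & hx & e).
      { destruct (Req_dec (g a) 0) as [e|ne]; [exists a; split; [lra | assumption]|].
        destruct (Ranalysis5.IVT_interv (fun x => - g x) a b) as (x & hx & e); try lra.
        - intros y hy. apply continuity_pt_filterlim. apply (continuous_Ropp g y), c; assumption.
        - exists x. assert (g x = 0) by lra. split; [|assumption].
          destruct (Req_dec x b) as [->|]; lra. }
      exists 1%nat. split; [|reflexivity].
      replace 1%nat with (is_zero (g x)) by (unfold is_zero; destruct (Req_EM_T (g x) 0); [reflexivity | contradiction]).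
      apply (Count_single _ (fun x => is_zero (g x)) x); [assumption|].
      intros y hy ne. unfold is_zero. destruct (Req_EM_T (g y) 0) as [e'|]; [|reflexivity].
      destruct (Rtotal_order y x) as [q|[q|q]]; [|contradiction|].
      * specialize (h y x ltac:(lra) q ltac:(lra)). lra.
      * specialize (h x y ltac:(lra) q ltac:(lra)). lra.
    + exists 0%nat. split; [|reflexivity].
      apply noz. intros x hx e. specialize (h x b ltac:(lra) ltac:(lra) ltac:(lra)). lra.
Qed.

Lemma sumf_map_opp f l : sumf f (map Ropp l) = sumf (fun x => f (- x)) l.
Proof. induction l; simpl; lia. Qed.

Lemma Count_opp P f n : Count P f n -> Count (fun x => P (- x)) (fun x => f (- x)) n.
Proof.
  intros (l & n1 & p1 & c1 & e1). exists (map Ropp l). split4.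
  - apply FinFun.Injective_map_NoDup; [|assumption]. intros x y h. rewrite <- (Ropp_involutive x), h. apply Ropp_involutive.
  - intros x hx. apply in_map_iff in hx. destruct hx as (y & <- & hy). rewrite Ropp_involutive. auto.
  - intros x hx p. apply in_map_iff. exists (- x). split; [apply Ropp_involutive | auto].
  - rewrite sumf_map_opp. rewrite <- e1. clear. induction l as [|x l IH]; simpl; [reflexivity|]. rewrite Ropp_involutive. lia.
Qed.

(** Reflection x -> - x reverses the monotonicity and exchanges the open and the closed end. *)
Lemma Count_incr_zeros (g : R -> R) a b : a <= b -> (forall x, a <= x <= b -> continuous g x) ->
  (forall x y, a <= x -> x < y -> y <= b -> g x < g y) ->
  exists n, Count (fun x => a < x <= b) (fun x => is_zero (g x)) n /\ (n + is_neg (g b) = is_neg (g a))%nat.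
Proof.
  intros ab c h.
  destruct (Count_decr_zeros (fun x => g (- x)) (- b) (- a)) as (n & hn & e).
  - lra.
  - intros x hx. apply (continuous_comp (fun x => - x) g); [csolve | apply c; lra].
  - intros x y h1 h2 h3. apply h; lra.
  - exists n. rewrite !Ropp_involutive in e. split; [|exact e].
    apply Count_opp in hn. revert hn. apply Count_ext; [intros x; split; lra|].
    intros x _. rewrite Ropp_involutive. reflexivity.
Qed.

Definition negind (A : mat) : nat := (is_neg (eigp A) + is_neg (eigm A))%nat.

(** Each ordered eigenvalue is continuous and strictly decreasing by [eig_strict]; the two scalar
    counts add up to the corank. *)
Lemma Count_decr_corank (A : R -> mat) a b : a <= b -> (forall x, a <= x <= b -> mcont A x) ->
  (forall x, a <= x <= b -> m12 (A x) = m21 (A x)) ->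
  (forall x y, a <= x -> x < y -> y <= b -> forall u v, u <> 0 \/ v <> 0 -> form (A y) u v < form (A x) u v) ->
  exists n, Count (fun x => a <= x < b) (fun x => corank (A x)) n /\ (n + negind (A a) = negind (A b))%nat.
Proof.
  intros ab c s h.
  destruct (Count_decr_zeros (fun x => eigp (A x)) a b ab) as (n1 & h1 & e1).
  { intros x hx. apply (eig_continuous A x (c x hx)). }
  { intros x y hx xy hy. apply (eig_strict (A y) (A x)); [apply s; lra | apply s; lra | apply h; assumption]. }
  destruct (Count_decr_zeros (fun x => eigm (A x)) a b ab) as (n2 & h2 & e2).
  { intros x hx. apply (eig_continuous A x (c x hx)). }
  { intros x y hx xy hy. apply (eig_strict (A y) (A x)); [apply s; lra | apply s; lra | apply h; assumption]. }
  exists (n1 + n2)%nat. split; [|unfold negind; lia].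
  assert (q := Count_add _ _ _ _ _ h1 h2). revert q. apply Count_ext; [tauto|].
  intros x hx. symmetry. apply corank_eig, s; lra.
Qed.

Lemma Count_incr_corank (A : R -> mat) a b : a <= b -> (forall x, a <= x <= b -> mcont A x) ->
  (forall x, a <= x <= b -> m12 (A x) = m21 (A x)) ->
  (forall x y, a <= x -> x < y -> y <= b -> forall u v, u <> 0 \/ v <> 0 -> form (A x) u v < form (A y) u v) ->
  exists n, Count (fun x => a < x <= b) (fun x => corank (A x)) n /\ (n + negind (A b) = negind (A a))%nat.
Proof.
  intros ab c s h.
  destruct (Count_incr_zeros (fun x => eigp (A x)) a b ab) as (n1 & h1 & e1).
  { intros x hx. apply (eig_continuous A x (c x hx)). }
  { intros x y hx xy hy. apply (eig_strict (A x) (A y)); [apply s; lra | apply s; lra | apply h; assumption]. }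
  destruct (Count_incr_zeros (fun x => eigm (A x)) a b ab) as (n2 & h2 & e2).
  { intros x hx. apply (eig_continuous A x (c x hx)). }
  { intros x y hx xy hy. apply (eig_strict (A x) (A y)); [apply s; lra | apply s; lra | apply h; assumption]. }
  exists (n1 + n2)%nat. split; [|unfold negind; lia].
  assert (q := Count_add _ _ _ _ _ h1 h2). revert q. apply Count_ext; [tauto|].
  intros x hx. symmetry. apply corank_eig, s; lra.
Qed.

(** * Path independence over rectangles *)

Section Rectangles.
Variable nu : R -> R -> nat.

(* Path independence of the count from (a, k) to (b, l) along the sides of a rectangle. *)
Definition balanced (a b l k : R) : Prop :=
  exists n1 n2 n3 n4,
    Count (fun s => a <= s < b) (fun s => nu s l) n1 /\ Count (fun lam => l < lam <= k) (fun lam => nu a lam) n2 /\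
    Count (fun s => a <= s < b) (fun s => nu s k) n3 /\ Count (fun lam => l < lam <= k) (fun lam => nu b lam) n4 /\
    (n1 + n2 = n3 + n4)%nat.

Lemma balanced_vert a b l k j : l <= k <= j -> balanced a b l k -> balanced a b k j -> balanced a b l j.
Proof.
  intros h (n1 & n2 & n3 & n4 & c1 & c2 & c3 & c4 & e) (p1 & p2 & p3 & p4 & d1 & d2 & d3 & d4 & e').
  assert (q := Count_unique _ _ _ _ c3 d1).
  exists n1, (n2 + p2)%nat, p3, (n4 + p4)%nat. split; [assumption|]. split; [|split; [assumption|split]]; [| |lia].
  - apply (Count_split _ _ _ _ _ _) with (3 := c2) (4 := d2); intros; lra.
  - apply (Count_split _ _ _ _ _ _) with (3 := c4) (4 := d4); intros; lra.
Qed.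

Lemma balanced_horiz a b c l k : a <= b <= c -> balanced a b l k -> balanced b c l k -> balanced a c l k.
Proof.
  intros h (n1 & n2 & n3 & n4 & c1 & c2 & c3 & c4 & e) (p1 & p2 & p3 & p4 & d1 & d2 & d3 & d4 & e').
  assert (q := Count_unique _ _ _ _ c4 d2).
  exists (n1 + p1)%nat, n2, (n3 + p3)%nat, p4. split; [|split; [assumption|split; [|split; [assumption|lia]]]].
  - apply (Count_split _ _ _ _ _ _) with (3 := c1) (4 := d1); intros; lra.
  - apply (Count_split _ _ _ _ _ _) with (3 := c3) (4 := d3); intros; lra.
Qed.

(** [cousin] is used twice. For fixed s, the induction in lam carries the width of a strip inside
    the predicate, so that the cells stacked above s share a positive width; a second induction in s
    joins the strips. *)
Lemma balanced_of_local A B L J : A <= B -> L <= J ->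
  (forall s lam, A <= s <= B -> L <= lam <= J -> exists d, 0 < d /\ forall a b l k,
     A <= a -> a <= b -> b <= B -> L <= l -> l <= k -> k <= J ->
     s - d < a -> b < s + d -> lam - d < l -> k < lam + d -> balanced a b l k) -> balanced A B L J.
Proof.
  intros AB LJ loc.
  apply (cousin (fun a b => balanced a b L J) A B AB).
  { intros a b c h. apply balanced_horiz; assumption. }
  intros s hs.
  assert (st : exists d, 0 < d /\ forall a b, A <= a -> a <= b -> b <= B -> s - d < a -> b < s + d -> balanced a b L J).
  { apply (cousin (fun l k => exists d, 0 < d /\
       forall a b, A <= a -> a <= b -> b <= B -> s - d < a -> b < s + d -> balanced a b l k) L J LJ).
    - intros l k j h (d1 & p1 & g1) (d2 & p2 & g2). exists (Rmin d1 d2). split; [apply Rmin_pos; assumption|].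
      assert (r1 := Rmin_l d1 d2). assert (r2 := Rmin_r d1 d2).
      intros a b h1 h2 h3 h4 h5. apply balanced_vert with k; [assumption | apply g1; lra | apply g2; lra].
    - intros lam hl. destruct (loc s lam hs hl) as (d & d0 & g). exists d. split; [assumption|].
      intros l k h1 h2 h3 h4. exists d. split; [assumption|]. intros a b h5 h6 h7 h8 h9. apply g; lra. }
  destruct st as (d & d0 & g). exists d. split; [assumption|]. intros a b h1 h2 h3 h4. apply g; lra.
Qed.
End Rectangles.

(** * Short intervals *)

Lemma sol_zero_of_dsp V z a b : (forall t, a < t < b -> sol_at V z t) ->
  (forall t, a < t < b -> dsp (z t) = 0) -> forall t, a < t < b -> z t = pzero.
Proof.
  intros s h t ht.
  assert (s1 := fun t h => proj1 (s t h)). assert (s2 := fun t h => proj1 (proj2 (s t h))).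
  assert (s3 := fun t h => proj1 (proj2 (proj2 (s t h)))). assert (s4 := fun t h => proj2 (proj2 (proj2 (s t h)))).
  assert (h2 := derive_zero_on _ _ a b h s1). cbv beta in h2.
  assert (h3 := derive_zero_on _ _ a b h2 s2). cbv beta in h3.
  assert (h4 : forall t, a < t < b -> mvel (z t) = 0).
  { intros u hu. specialize (h3 u hu). rewrite (h u hu) in h3. lra. }
  assert (h5 := derive_zero_on _ _ a b h4 s4). cbv beta in h5.
  apply phase_eq; simpl; auto. specialize (h5 t ht). lra.
Qed.

(* A null Lagrangian: adding it makes the energy density positive definite on
   intervals of length at most 1/(K + 4) when the potential is at least - K,
   while it vanishes wherever the position does. *)
Definition nullform (K a t : R) (z : phase) : R := (K + 4) * (t - a) * dsp z ^ 2 + 2 * (dsp z * vel z).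

Definition density (K a V t : R) (z : phase) : R :=
  mvel z ^ 2 + V * dsp z ^ 2 + ((K + 4) * dsp z ^ 2 + (K + 4) * (t - a) * (2 * dsp z * vel z)
   + 2 * (vel z * vel z + dsp z * (mvel z - dsp z))).

(** Origin of K + 4: K compensates V, 2 compensates the term - 2 dsp^2, 1 completes the square with
    [mvel], and 1 pays for the cross term with factor (K + 4) (t - a). The length restriction keeps
    that factor at most 1. *)
Lemma density_eq K a V t z : density K a V t z =
  (mvel z + dsp z) ^ 2 + (V + K) * dsp z ^ 2 + (1 - (K + 4) * (t - a)) * (dsp z ^ 2 + vel z ^ 2)
   + (K + 4) * (t - a) * (dsp z + vel z) ^ 2 + vel z ^ 2.
Proof. unfold density. ring. Qed.

Lemma density_nonneg K a V t z : 0 <= K -> - K <= V -> a <= t <= a + / (K + 4) -> 0 <= density K a V t z.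
Proof.
  intros k0 kV ht. rewrite density_eq.
  assert (a0 : 0 <= (K + 4) * (t - a)) by (apply Rmult_le_pos; lra).
  assert (a1 : (K + 4) * (t - a) <= 1).
  { replace 1 with ((K + 4) * / (K + 4)) by (field; lra). apply Rmult_le_compat_l; lra. }
  assert (0 <= (mvel z + dsp z) ^ 2) by apply pow2_ge_0.
  assert (0 <= (V + K) * dsp z ^ 2) by (apply Rmult_le_pos; [lra | apply pow2_ge_0]).
  assert (q1 := pow2_ge_0 (dsp z)). assert (q2 := pow2_ge_0 (vel z)).
  assert (0 <= (1 - (K + 4) * (t - a)) * (dsp z ^ 2 + vel z ^ 2)) by (apply Rmult_le_pos; lra).
  assert (0 <= (K + 4) * (t - a) * (dsp z + vel z) ^ 2) by (apply Rmult_le_pos; [lra | apply pow2_ge_0]).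
  lra.
Qed.

Lemma density_zero K a V t z : 0 <= K -> - K <= V -> a < t < a + / (K + 4) -> density K a V t z = 0 ->
  dsp z = 0 /\ mvel z = 0.
Proof.
  intros k0 kV ht. rewrite density_eq.
  assert (a0 : 0 <= (K + 4) * (t - a)) by (apply Rmult_le_pos; lra).
  assert (a1 : (K + 4) * (t - a) < 1).
  { replace 1 with ((K + 4) * / (K + 4)) by (field; lra). apply Rmult_lt_compat_l; lra. }
  assert (h0 : 0 <= (mvel z + dsp z) ^ 2) by apply pow2_ge_0.
  assert (h1 : 0 <= (V + K) * dsp z ^ 2) by (apply Rmult_le_pos; [lra | apply pow2_ge_0]).
  assert (q1 := pow2_ge_0 (dsp z)). assert (q2 := pow2_ge_0 (vel z)).
  assert (h2 : 0 <= (1 - (K + 4) * (t - a)) * (dsp z ^ 2 + vel z ^ 2)) by (apply Rmult_le_pos; lra).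
  assert (h3 : 0 <= (K + 4) * (t - a) * (dsp z + vel z) ^ 2) by (apply Rmult_le_pos; [lra | apply pow2_ge_0]).
  intros e.
  assert (e1 : (1 - (K + 4) * (t - a)) * (dsp z ^ 2 + vel z ^ 2) = 0) by lra.
  destruct (Rmult_integral _ _ e1) as [f|f]; [lra|].
  assert (d0 : dsp z = 0) by (apply Rsqr_0_uniq; unfold Rsqr; lra).
  split; [assumption|]. rewrite d0 in *. apply Rsqr_0_uniq; unfold Rsqr. lra.
Qed.

Section Short.
Variables (W : R -> R) (M K a : R).
Hypotheses (bW : forall t, Rabs (W t) <= M) (K0 : 0 <= K).

Definition modenergy (z : R -> phase) (t : R) : R := pair (z t) (z t) + nullform K a t (z t).

Lemma modenergy_derive V z t : sol_at V z t ->
  is_derive (modenergy z) t (density K a (V t) t (z t)).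
Proof.
  intros (a1 & a2 & a3 & a4). unfold modenergy, nullform, pair, density. dsolve. ring.
Qed.

(** Counterpart of [energy_zero] in which shortness of the interval replaces positivity of the
    potential. *)
Lemma modenergy_zero lam z b c : a <= b < c -> c <= a + / (K + 4) -> (forall t, - K <= shift W lam t) ->
  (forall t, sol_at (shift W lam) z t) -> modenergy z c <= modenergy z b -> forall t, z t = pzero.
Proof.
  intros hb hc hK s e.
  assert (Z := derive_zero_of_const (modenergy z) _ b c ltac:(lra) (fun t _ => modenergy_derive _ z t (s t))
    (fun t ht => density_nonneg K a _ t (z t) K0 (hK t) ltac:(lra)) e). cbv beta in Z.
  assert (Z1 := sol_zero_of_energy (shift W lam) z b c ltac:(lra) (fun t _ => s t)
    (fun t ht => density_zero K a _ t (z t) K0 (hK t) ltac:(lra) (Z t ht)) ((b + c) / 2) ltac:(lra)).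
  intros t. exact (sol_zero (shift W lam) (Rabs lam + M) z ((b + c) / 2) t (shift_bound W M bW lam) (fun t _ => s t) Z1).
Qed.

Lemma modenergy_incr lam z b c : a <= b <= c -> c <= a + / (K + 4) -> (forall t, - K <= shift W lam t) ->
  (forall t, sol_at (shift W lam) z t) -> modenergy z b <= modenergy z c.
Proof.
  intros hb hc hK s.
  apply (derive_nonneg_incr (modenergy z) (fun t => density K a (shift W lam t) t (z t)) b c ltac:(lra)).
  - intros t _. apply modenergy_derive, s.
  - intros t ht. apply density_nonneg; [assumption | apply hK | lra].
Qed.

Lemma modenergy_dirichlet z t : dsp (z t) = 0 -> vel (z t) = 0 -> modenergy z t = 0.
Proof. intros h1 h2. unfold modenergy, nullform, pair. rewrite h1, h2. ring. Qed.

Lemma short_dirichlet_unique lam z s : a < s <= a + / (K + 4) -> (forall t, - K <= shift W lam t) ->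
  (forall t, sol_at (shift W lam) z t) -> dsp (z a) = 0 -> vel (z a) = 0 -> dsp (z s) = 0 -> vel (z s) = 0 ->
  forall t, z t = pzero.
Proof.
  intros hs hK sz h1 h2 h3 h4. apply (modenergy_zero lam z a s); try assumption; try lra.
  rewrite !modenergy_dirichlet by assumption. lra.
Qed.

(** The argument of [Y_energy_decr], made strict. At s, [modenergy] of the difference equals
    [modenergy w s] minus [omega (z s) (w s)] and is nonnegative, while [modenergy w s] is negative
    because it grows strictly to 0 at s'. *)
Lemma short_mono_s lam z w s s' : a < s -> s < s' -> s' <= a + / (K + 4) ->
  (forall t, - K <= shift W lam t) ->
  (forall t, sol_at (shift W lam) z t) -> (forall t, sol_at (shift W lam) w t) ->
  dsp (z a) = dsp (w a) -> vel (z a) = vel (w a) -> dsp (z s) = 0 -> vel (z s) = 0 ->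
  dsp (w s') = 0 -> vel (w s') = 0 -> dsp (w a) <> 0 \/ vel (w a) <> 0 ->
  omega (z a) (w a) < 0.
Proof.
  intros h1 h2 h3 hK sz sw e1 e2 e3 e4 e5 e6 nz.
  set (e := fun t => comb 1 (z t) (-1) (w t)).
  assert (se : forall t, sol_at (shift W lam) e t) by (intros; apply sol_comb; auto).
  assert (m1 := modenergy_incr lam e a s ltac:(lra) ltac:(lra) hK se).
  rewrite (modenergy_dirichlet e a) in m1;
    [| unfold e, comb; cbn [dsp]; rewrite e1; ring | unfold e, comb; cbn [vel]; rewrite e2; ring].
  assert (m2 : modenergy w s < 0).
  { apply Rnot_le_lt; intros c.
    assert (Z := modenergy_zero lam w s s' ltac:(lra) h3 hK sw).
    rewrite (modenergy_dirichlet w s' e5 e6) in Z. specialize (Z c a). rewrite Z in nz. simpl in nz. lra. }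
  rewrite (omega_const (shift W lam) z w a s sz sw).
  unfold modenergy, e, nullform, omega, pair, comb in *; cbn [dsp vel mdsp mvel] in *. rewrite e3, e4 in *. lra.
Qed.

Lemma short_mono_lam lam lam' z w s : lam' <= lam -> a < s <= a + / (K + 4) -> (forall t, - K <= shift W lam' t) ->
  (forall t, sol_at (shift W lam) z t) -> (forall t, sol_at (shift W lam') w t) ->
  dsp (z a) = dsp (w a) -> vel (z a) = vel (w a) -> dsp (z s) = 0 -> vel (z s) = 0 ->
  dsp (w s) = 0 -> vel (w s) = 0 -> omega (z a) (w a) <= 0.
Proof.
  intros ll hs hK sz sw e1 e2 e3 e4 e5 e6.
  set (e := fun t => comb 1 (z t) (-1) (w t)).
  (* Adding [omega] cancels the cross terms: the derivative becomes the density of the difference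
     for the smaller parameter lam' plus (lam - lam') times dsp^2 of [z], both nonnegative. At the
     two ends [modenergy e] is 0. *)
  assert (q : modenergy e a + omega (z a) (w a) <= modenergy e s + omega (z s) (w s)).
  { apply (derive_nonneg_incr (fun t => modenergy e t + omega (z t) (w t))
      (fun t => density K a (shift W lam' t) t (e t) + (lam - lam') * dsp (z t) ^ 2) a s ltac:(lra)).
    - intros t _. destruct (sz t) as (a1 & a2 & a3 & a4), (sw t) as (b1 & b2 & b3 & b4).
      unfold modenergy, nullform, e, omega, pair, comb, density; cbn [dsp vel mdsp mvel]. dsolve. unfold shift. ring.
    - intros t ht. assert (d := density_nonneg K a (shift W lam' t) t (e t) K0 (hK t) ltac:(lra)).
      assert (0 <= (lam - lam') * dsp (z t) ^ 2) by (apply Rmult_le_pos; [lra | apply pow2_ge_0]). lra. }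
  rewrite (modenergy_dirichlet e a), (modenergy_dirichlet e s) in q;
    try (unfold e, comb; cbn [dsp vel]; rewrite ?e1, ?e2, ?e3, ?e4, ?e5, ?e6; ring).
  unfold omega, pair in *. rewrite e3, e4, e5, e6 in q. lra.
Qed.
End Short.

(** * The decaying subspace *)

Section Decaying.
Variables (W : R -> R) (M m s0 : R).
Hypotheses (cW : forall t, continuous W t) (bW : forall t, Rabs (W t) <= M)
  (m_pos : 0 < m) (pW : forall t, t <= s0 + 1 -> 2 * m <= W t).

Lemma shift_continuous lam t : continuous (shift W lam) t.
Proof. unfold shift. csolve. Qed.

(** The condition on lam stands inside the existential so that a frame can be chosen for every real
    lam. Admitting lam > - m gives lam = 0 a two-sided neighbourhood, as continuity requires; the
    margin 2 m keeps the potential above m there. *)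
Lemma frame_exists lam : exists Z : (R -> phase) * (R -> phase), - m < lam ->
  ((forall t, sol_at (shift W lam) (fst Z) t) /\ decays (fst Z) /\ dsp (fst Z s0) = 1 /\ vel (fst Z s0) = 0) /\
  ((forall t, sol_at (shift W lam) (snd Z) t) /\ decays (snd Z) /\ dsp (snd Z s0) = 0 /\ vel (snd Z s0) = 1).
Proof.
  destruct (Rlt_dec (- m) lam) as [l|l]; [|exists (fun _ => pzero, fun _ => pzero); intros; lra].
  assert (ex := decaying_exists (shift W lam) (Rabs lam + M) m s0 m_pos (shift_continuous lam) (shift_bound W M bW lam)
    ltac:(intros t ht; unfold shift; specialize (pW t ltac:(lra)); lra)).
  destruct (ex 1 0) as (Z1 & h1). destruct (ex 0 1) as (Z2 & h2). exists (Z1, Z2). intros _. split; assumption.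
Qed.

Definition frame lam := proj1_sig (constructive_indefinite_description _ (frame_exists lam)).

(* Decaying solution with position (x, v) at s0; junk when [lam <= - m]. *)
Definition esol (lam x v t : R) : phase := comb x (fst (frame lam) t) v (snd (frame lam) t).

Lemma esol_spec lam x v : - m < lam ->
  (forall t, sol_at (shift W lam) (esol lam x v) t) /\ decays (esol lam x v) /\
  dsp (esol lam x v s0) = x /\ vel (esol lam x v s0) = v.
Proof.
  intros l. assert (F := proj2_sig (constructive_indefinite_description _ (frame_exists lam)) l).
  change (proj1_sig (constructive_indefinite_description _ (frame_exists lam))) with (frame lam) in F. destruct F as ((a1 & a2 & a3 & a4) & (b1 & b2 & b3 & b4)).
  unfold esol. split4.
  - intros; apply sol_comb; auto.
  - apply decays_comb; assumption.
  - cbn [comb dsp vel]. rewrite a3, b3. ring.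
  - cbn [comb dsp vel]. rewrite a4, b4. ring.
Qed.

Lemma shift_pos lam t : - m < lam -> t <= s0 + 1 -> m < shift W lam t.
Proof. intros l ht. unfold shift. specialize (pW t ht). lra. Qed.

(** The difference from the matching [esol] has zero position at s0, so [decaying_dirichlet]
    applies. The equation is assumed on (-oo, a] only, because an eigenfunction satisfies it only up
    to the end point. *)
Lemma esol_span lam z a : - m < lam -> s0 <= a -> (forall t, t <= a -> sol_at (shift W lam) z t) ->
  decays z -> forall t, t <= a -> z t = esol lam (dsp (z s0)) (vel (z s0)) t.
Proof.
  intros l hs s dz t ht.
  destruct (esol_spec lam (dsp (z s0)) (vel (z s0)) l) as (se & de & e1 & e2).
  set (w := esol lam (dsp (z s0)) (vel (z s0))) in *.
  set (e := fun t => comb 1 (z t) (-1) (w t)).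
  assert (se' : forall t, t <= a -> sol_at (shift W lam) e t) by (intros; apply sol_comb; auto).
  assert (e0 : e s0 = pzero).
  { apply (decaying_dirichlet (shift W lam) (Rabs lam + M)).
    - apply shift_bound; assumption.
    - intros u hu. assert (q := shift_pos lam u l ltac:(lra)). lra.
    - intros u hu. apply se'; lra.
    - apply decays_comb; assumption.
    - unfold e, comb; cbn [dsp vel mdsp mvel]. rewrite e1. ring.
    - unfold e, comb; cbn [dsp vel mdsp mvel]. rewrite e2. ring. }
  assert (et : e t = pzero).
  { apply (sol_zero (shift W lam) (Rabs lam + M) e s0 t (shift_bound W M bW lam)); [|assumption].
    intros u hu. apply se'. destruct hu as [_ hu]. eapply Rle_trans; [exact hu|]. apply Rmax_lub; assumption. }
  apply comb_zero. exact et.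
Qed.

Definition energy (lam x v : R) : R := pair (esol lam x v s0) (esol lam x v s0).

Lemma esol_sym lam x v x' v' : - m < lam ->
  pair (esol lam x v s0) (esol lam x' v' s0) = pair (esol lam x' v' s0) (esol lam x v s0).
Proof.
  intros l. destruct (esol_spec lam x v l) as (s & d & _). destruct (esol_spec lam x' v' l) as (s' & d' & _).
  assert (o := omega_decaying (shift W lam) s0 _ _ (fun t _ => s t) (fun t _ => s' t) d d'). unfold omega in o. lra.
Qed.

(** The comparison of [short_mono_lam] on the half-line: the positions at s0 agree, so there
    [pair (e s0) (e s0)] is 0 and [omega] is the difference of the energies. *)
Lemma energy_mono lam lam' x v : - m < lam' -> lam' <= lam -> energy lam' x v <= energy lam x v.
Proof.
  intros l ll. destruct (esol_spec lam x v ltac:(lra)) as (s & d & e1 & e2).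
  destruct (esol_spec lam' x v l) as (s' & d' & e1' & e2'). unfold energy.
  set (z := esol lam x v) in *. set (w := esol lam' x v) in *.
  set (e := fun t => comb 1 (z t) (-1) (w t)).
  assert (h : 0 <= pair (e s0) (e s0) + omega (z s0) (w s0)).
  { apply (incr_lim0_nonneg (fun t => pair (e t) (e t) + omega (z t) (w t))
      (fun t => mvel (e t) ^ 2 + shift W lam' t * dsp (e t) ^ 2 + (lam - lam') * dsp (z t) ^ 2) s0); try lra.
    - intros t _. destruct (s t) as (a1 & a2 & a3 & a4), (s' t) as (b1 & b2 & b3 & b4).
      unfold e, omega, pair, comb; cbn [dsp vel mdsp mvel]. dsolve. unfold shift. ring.
    - intros t ht. assert (q := shift_pos lam' t l ltac:(lra)).
      assert (0 <= shift W lam' t * dsp (e t) ^ 2) by (apply Rmult_le_pos; [lra | apply pow2_ge_0]).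
      assert (0 <= (lam - lam') * dsp (z t) ^ 2) by (apply Rmult_le_pos; [lra | apply pow2_ge_0]).
      assert (0 <= mvel (e t) ^ 2) by apply pow2_ge_0. lra.
    - apply lim0_plus; [apply decays_pair | apply decays_omega]; try assumption; apply decays_comb; assumption. }
  unfold e, omega, pair, comb in *; cbn [dsp vel mdsp mvel] in *. rewrite e1, e2, e1', e2' in *. lra.
Qed.

(** The solution for lam' competes in the minimum problem for lam. Its excess is lam - lam' times
    the integral of its squared position, and m times that integral is at most its own energy. *)
Lemma energy_lip lam lam' x v : - m < lam' -> lam' <= lam ->
  energy lam x v - energy lam' x v <= (lam - lam') / m * energy lam' x v.
Proof.
  intros l ll. destruct (esol_spec lam x v ltac:(lra)) as (s & d & e1 & e2).
  destruct (esol_spec lam' x v l) as (s' & d' & e1' & e2'). unfold energy.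
  set (z := esol lam x v) in *. set (w := esol lam' x v) in *.
  set (e := fun t => comb 1 (z t) (-1) (w t)).
  assert (c0 : 0 <= (lam - lam') / m) by (apply Rmult_le_pos; [lra | left; apply Rinv_0_lt_compat; lra]).
  assert (h : 0 <= (lam - lam') / m * pair (w s0) (w s0) + (pair (e s0) (e s0) + (-1) * omega (z s0) (w s0))).
  { apply (incr_lim0_nonneg (fun t => (lam - lam') / m * pair (w t) (w t) + (pair (e t) (e t) + (-1) * omega (z t) (w t)))
      (fun t => (lam - lam') / m * (mvel (w t) ^ 2 + shift W lam' t * dsp (w t) ^ 2) +
         (mvel (e t) ^ 2 + shift W lam t * dsp (e t) ^ 2 - (lam - lam') * dsp (w t) ^ 2)) s0); try lra.
    - intros t _. destruct (s t) as (a1 & a2 & a3 & a4), (s' t) as (b1 & b2 & b3 & b4).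
      unfold e, omega, pair, comb; cbn [dsp vel mdsp mvel]. dsolve. unfold shift. ring.
    - intros t ht. assert (q' := shift_pos lam' t l ltac:(lra)). assert (q := shift_pos lam t ltac:(lra) ltac:(lra)).
      assert (0 <= shift W lam t * dsp (e t) ^ 2) by (apply Rmult_le_pos; [lra | apply pow2_ge_0]).
      assert (0 <= mvel (e t) ^ 2) by apply pow2_ge_0.
      assert ((lam - lam') / m * (m * dsp (w t) ^ 2) <= (lam - lam') / m * (mvel (w t) ^ 2 + shift W lam' t * dsp (w t) ^ 2)).
      { apply Rmult_le_compat_l; [assumption|]. assert (0 <= mvel (w t) ^ 2) by apply pow2_ge_0.
        assert (m * dsp (w t) ^ 2 <= shift W lam' t * dsp (w t) ^ 2) by (apply Rmult_le_compat_r; [apply pow2_ge_0 | lra]). lra. }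
      replace ((lam - lam') / m * (m * dsp (w t) ^ 2)) with ((lam - lam') * dsp (w t) ^ 2) in H1 by (field; lra). lra.
    - apply lim0_plus; [apply lim0_scal, decays_pair; assumption|].
      apply lim0_plus; [apply decays_pair | apply lim0_scal, decays_omega]; try assumption; apply decays_comb; assumption. }
  unfold e, omega, pair, comb in *; cbn [dsp vel mdsp mvel] in *. rewrite e1, e2, e1', e2' in *. lra.
Qed.

Lemma energy_nonneg lam x v : - m < lam -> 0 <= energy lam x v.
Proof.
  intros l. destruct (esol_spec lam x v l) as (s & d & _).
  apply (decays_energy_nonneg (shift W lam) s0); auto; try lra.
  intros t ht. assert (q := shift_pos lam t l ltac:(lra)). lra.
Qed.

Definition U (lam t : R) : mat :=
  Mat (dsp (fst (frame lam) t)) (dsp (snd (frame lam) t)) (vel (fst (frame lam) t)) (vel (snd (frame lam) t)).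

Lemma esol_dsp lam x v t : dsp (esol lam x v t) = ap1 (U lam t) x v.
Proof. unfold esol, ap1, U, comb; cbn [dsp m11 m12]. ring. Qed.

Lemma esol_vel lam x v t : vel (esol lam x v t) = ap2 (U lam t) x v.
Proof. unfold esol, ap2, U, comb; cbn [vel m21 m22]. ring. Qed.

Lemma esol_fst lam t : esol lam 1 0 t = fst (frame lam) t.
Proof. unfold esol, comb; apply phase_eq; cbn [dsp vel mdsp mvel]; ring. Qed.

Lemma esol_snd lam t : esol lam 0 1 t = snd (frame lam) t.
Proof. unfold esol, comb; apply phase_eq; cbn [dsp vel mdsp mvel]; ring. Qed.

(* The symmetric matrix whose graph is the decaying subspace at s0. *)
Lemma esol_momenta lam x v : - m < lam ->
  mdsp (esol lam x v s0) = x * energy lam 1 0 + v * ((energy lam 1 1 - energy lam 1 0 - energy lam 0 1) / 2) /\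
  mvel (esol lam x v s0) = x * ((energy lam 1 1 - energy lam 1 0 - energy lam 0 1) / 2) + v * energy lam 0 1.
Proof.
  intros l.
  destruct (esol_spec lam 1 0 l) as (_ & _ & e1 & e2). destruct (esol_spec lam 0 1 l) as (_ & _ & e3 & e4).
  assert (o := esol_sym lam 1 0 0 1 l).
  assert (E1 : energy lam 1 0 = mdsp (esol lam 1 0 s0)) by (unfold energy, pair; rewrite e1, e2; ring).
  assert (E2 : energy lam 0 1 = mvel (esol lam 0 1 s0)) by (unfold energy, pair; rewrite e3, e4; ring).
  unfold pair in o. rewrite e1, e2, e3, e4 in o.
  assert (E3 : energy lam 1 1 = energy lam 1 0 + 2 * mvel (esol lam 1 0 s0) + energy lam 0 1).
  { rewrite E1, E2. unfold energy.
    replace (esol lam 1 1 s0) with (comb 1 (esol lam 1 0 s0) 1 (esol lam 0 1 s0))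
      by (rewrite esol_fst, esol_snd; reflexivity).
    unfold pair, comb; cbn [dsp vel mdsp mvel]. rewrite e1, e2, e3, e4. lra. }
  assert (C : esol lam x v s0 = comb x (esol lam 1 0 s0) v (esol lam 0 1 s0)).
  { rewrite esol_fst, esol_snd. reflexivity. }
  rewrite C; unfold comb; cbn [mdsp mvel]. rewrite E3. split; [rewrite <- E1 | rewrite <- E2]; nra.
Qed.

Lemma energy_quad lam x v : - m < lam -> energy lam x v =
  x ^ 2 * energy lam 1 0 + x * v * (energy lam 1 1 - energy lam 1 0 - energy lam 0 1) + v ^ 2 * energy lam 0 1.
Proof.
  intros l. destruct (esol_momenta lam x v l) as [h1 h2]. destruct (esol_spec lam x v l) as (_ & _ & e1 & e2).
  unfold energy at 1, pair. rewrite h1, h2, e1, e2. field.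
Qed.

(** All parameters involved lie below lam + 1, so by monotonicity one coefficient serves for every
    lam'. *)
Lemma energy_near lam lam' x v : - m < lam -> - m < lam' -> Rabs (lam' - lam) < 1 ->
  Rabs (energy lam x v - energy lam' x v) <= Rabs (lam' - lam) / m * energy (lam + 1) x v.
Proof.
  intros l l' h.
  assert (im : 0 < / m) by (apply Rinv_0_lt_compat; assumption).
  assert (mon : forall mu, - m < mu -> mu <= lam + 1 -> 0 <= energy mu x v <= energy (lam + 1) x v).
  { intros mu h1 h2. split; [apply energy_nonneg | apply energy_mono]; assumption. }
  assert (c0 : 0 <= Rabs (lam' - lam) / m) by (apply Rmult_le_pos; [apply Rabs_pos | lra]).
  destruct (Rle_dec lam' lam) as [q|q].
  - assert (a := energy_mono lam lam' x v l' q).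
    assert (b := energy_lip lam lam' x v l' q).
    rewrite Rabs_right by lra. rewrite (Rabs_left1 (lam' - lam)) in * by lra.
    replace (- (lam' - lam)) with (lam - lam') in * by ring.
    eapply Rle_trans; [exact b|]. apply Rmult_le_compat_l; [assumption|]. apply mon; lra.
  - apply Rnot_le_lt in q.
    assert (a := energy_mono lam' lam x v l (Rlt_le _ _ q)).
    assert (b := energy_lip lam' lam x v l (Rlt_le _ _ q)).
    rewrite Rabs_minus_sym, Rabs_right by lra. rewrite (Rabs_right (lam' - lam)) in * by lra.
    eapply Rle_trans; [exact b|]. apply Rmult_le_compat_l; [assumption|]. apply mon; lra.
Qed.

Lemma esol_continuous lam x v t : - m < lam -> s0 <= t ->
  continuous (fun l => dsp (esol l x v t)) lam /\ continuous (fun l => vel (esol l x v t)) lam /\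
  continuous (fun l => mdsp (esol l x v t)) lam /\ continuous (fun l => mvel (esol l x v t)) lam.
Proof.
  intros l ht.
  set (k1 := energy (lam + 1) 1 0 / m). set (k2 := energy (lam + 1) 0 1 / m). set (k3 := energy (lam + 1) 1 1 / m).
  apply (family_continuous W M bW (fun l => esol l x v) lam s0 t
     (((Rabs x + Rabs v) * (k1 + k2 + k3)) ^ 2 + ((Rabs x + Rabs v) * (k1 + k2 + k3)) ^ 2) (Rmin 1 (lam + m)) ht).
  - apply Rmin_pos; lra.
  - intros y hy. assert (r1 := Rmin_r 1 (lam + m)). apply Rabs_def2 in hy.
    apply (esol_spec y x v ltac:(lra)).
  - intros y hy. assert (r1 := Rmin_r 1 (lam + m)). assert (r2 := Rmin_l 1 (lam + m)).
    assert (hy' := Rabs_def2 _ _ hy).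
    destruct (esol_spec y x v ltac:(lra)) as (_ & _ & e1 & e2). destruct (esol_spec lam x v l) as (_ & _ & e3 & e4).
    destruct (esol_momenta y x v ltac:(lra)) as (p1 & p2). destruct (esol_momenta lam x v l) as (p3 & p4).
    rewrite nsq_diff, e1, e2, e3, e4, p1, p2, p3, p4.
    assert (E : forall a b, Rabs (energy lam a b - energy y a b) <= Rabs (y - lam) * (energy (lam + 1) a b / m)).
    { intros a b. eapply Rle_trans; [apply energy_near; lra|]. apply Req_le; field; lra. }
    assert (E1 := E 1 0). assert (E2 := E 0 1). assert (E3 := E 1 1). fold k1 in E1. fold k2 in E2. fold k3 in E3.
    set (d1 := energy lam 1 0 - energy y 1 0) in *. set (d2 := energy lam 0 1 - energy y 0 1) in *.
    set (d3 := energy lam 1 1 - energy y 1 1) in *.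
    assert (r0 := Rabs_pos (y - lam)).
    assert (bb : forall a b, Rabs a <= Rabs (y - lam) * (k1 + k2 + k3) -> Rabs b <= Rabs (y - lam) * (k1 + k2 + k3) ->
      (x * a + v * b) ^ 2 <= ((Rabs x + Rabs v) * (k1 + k2 + k3)) ^ 2 * (y - lam) ^ 2).
    { intros a b ha hb. rewrite <- (pow2_abs (y - lam)), <- Rpow_mult_distr.
      rewrite <- (pow2_abs (x * a + v * b)). apply pow_incr. split; [apply Rabs_pos|].
      eapply Rle_trans; [apply Rabs_triang|]. rewrite !Rabs_mult.
      assert (Rabs x * Rabs a <= Rabs x * (Rabs (y - lam) * (k1 + k2 + k3))) by (apply Rmult_le_compat_l; [apply Rabs_pos | assumption]).
      assert (Rabs v * Rabs b <= Rabs v * (Rabs (y - lam) * (k1 + k2 + k3))) by (apply Rmult_le_compat_l; [apply Rabs_pos | assumption]).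
      lra. }
    apply Rabs_le_between in E1. apply Rabs_le_between in E2. apply Rabs_le_between in E3.
    assert (q1 := bb d1 ((d3 - d1 - d2) / 2) ltac:(apply Rabs_le; lra) ltac:(apply Rabs_le; lra)).
    assert (q2 := bb ((d3 - d1 - d2) / 2) d2 ltac:(apply Rabs_le; lra) ltac:(apply Rabs_le; lra)).
    replace (x * energy lam 1 0 + v * ((energy lam 1 1 - energy lam 1 0 - energy lam 0 1) / 2) -
      (x * energy y 1 0 + v * ((energy y 1 1 - energy y 1 0 - energy y 0 1) / 2)))
      with (x * d1 + v * ((d3 - d1 - d2) / 2)) by (unfold d1, d2, d3; field).
    replace (x * ((energy lam 1 1 - energy lam 1 0 - energy lam 0 1) / 2) + v * energy lam 0 1 -
      (x * ((energy y 1 1 - energy y 1 0 - energy y 0 1) / 2) + v * energy y 0 1))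
      with (x * ((d3 - d1 - d2) / 2) + v * d2) by (unfold d1, d2, d3; field).
    rewrite !Rminus_diag. lra.
Qed.

Lemma U_continuous lam t : - m < lam -> s0 <= t -> mcont (fun l => U l t) lam.
Proof.
  intros l ht.
  destruct (esol_continuous lam 1 0 t l ht) as (a1 & a2 & _). destruct (esol_continuous lam 0 1 t l ht) as (b1 & b2 & _).
  unfold mcont, U; cbn [m11 m12 m21 m22]. split4.
  - apply continuous_ext with (2 := a1). intros y; rewrite esol_fst; reflexivity.
  - apply continuous_ext with (2 := b1). intros y; rewrite esol_snd; reflexivity.
  - apply continuous_ext with (2 := a2). intros y; rewrite esol_fst; reflexivity.
  - apply continuous_ext with (2 := b2). intros y; rewrite esol_snd; reflexivity.
Qed.

(** By polarization [omega] is half of D(x, v) + D(x', v') - D(x - x', v - v'), where D is the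
    difference of the two energy forms. The first two terms have the sign of lam - lam'; the third
    is linear in that difference and quadratic in the change of position, which is small when
    applied. *)
Lemma omega_s0_bound lam lam' x v x' v' : - m < lam -> - m < lam' -> Rabs (lam' - lam) < 1 ->
  - ((lam - lam') ^ 2 / (2 * m) * energy (lam + 1) (x - x') (v - v')) <=
  (lam - lam') * omega (esol lam x v s0) (esol lam' x' v' s0).
Proof.
  intros l l' h.
  destruct (esol_spec lam x v l) as (_ & _ & e1 & e2). destruct (esol_spec lam' x' v' l') as (_ & _ & e3 & e4).
  destruct (esol_momenta lam x v l) as (p1 & p2). destruct (esol_momenta lam' x' v' l') as (p3 & p4).
  assert (o : omega (esol lam x v s0) (esol lam' x' v' s0) =
    / 2 * ((energy lam x v - energy lam' x v) + (energy lam x' v' - energy lam' x' v')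
     - (energy lam (x - x') (v - v') - energy lam' (x - x') (v - v')))).
  { unfold omega, pair. rewrite e1, e2, e3, e4, p1, p2, p3, p4.
    rewrite (energy_quad lam x v l), (energy_quad lam' x v l'), (energy_quad lam x' v' l), (energy_quad lam' x' v' l'),
      (energy_quad lam (x - x') (v - v') l), (energy_quad lam' (x - x') (v - v') l'). field. }
  rewrite o.
  assert (n := energy_near lam lam' (x - x') (v - v') l l' h).
  assert (sg : forall a b, 0 <= (lam - lam') * (energy lam a b - energy lam' a b)).
  { intros a b. destruct (Rle_dec lam' lam) as [q|q].
    - assert (u := energy_mono lam lam' a b l' q). apply Rmult_le_pos; lra.
    - assert (u := energy_mono lam' lam a b l ltac:(lra)).
      replace ((lam - lam') * (energy lam a b - energy lam' a b)) with ((lam' - lam) * (energy lam' a b - energy lam a b)) by ring.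
      apply Rmult_le_pos; lra. }
  assert (s1 := sg x v). assert (s2 := sg x' v').
  assert (s3 : (lam - lam') * (energy lam (x - x') (v - v') - energy lam' (x - x') (v - v')) <=
     (lam - lam') ^ 2 / m * energy (lam + 1) (x - x') (v - v')).
  { eapply Rle_trans; [apply Rle_abs|]. rewrite Rabs_mult.
    eapply Rle_trans; [apply Rmult_le_compat_l; [apply Rabs_pos | exact n]|].
    apply Req_le. rewrite <- (pow2_abs (lam - lam')), (Rabs_minus_sym lam' lam). field. lra. }
  replace ((lam - lam') ^ 2 / (2 * m) * energy (lam + 1) (x - x') (v - v')) with
    (/ 2 * ((lam - lam') ^ 2 / m * energy (lam + 1) (x - x') (v - v'))) by (field; lra).
  lra.
Qed.

(* Decaying solution with position (x, v) at s1; junk when [det (U lam s1) = 0]. *)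
Definition esol_at (s1 lam x v : R) : R -> phase :=
  esol lam (ap1 (inv (U lam s1)) x v) (ap2 (inv (U lam s1)) x v).

Lemma esol_at_spec s1 lam x v : - m < lam -> det (U lam s1) <> 0 ->
  (forall t, sol_at (shift W lam) (esol_at s1 lam x v) t) /\ decays (esol_at s1 lam x v) /\
  dsp (esol_at s1 lam x v s1) = x /\ vel (esol_at s1 lam x v s1) = v.
Proof.
  intros l d. destruct (esol_spec lam (ap1 (inv (U lam s1)) x v) (ap2 (inv (U lam s1)) x v) l) as (a1 & a2 & _).
  unfold esol_at. split; [assumption|]. split; [assumption|].
  rewrite esol_dsp, esol_vel. split; [apply ap1_inv | apply ap2_inv]; assumption.
Qed.

Lemma esol_at_continuous s1 lam x v : s0 <= s1 -> - m < lam -> det (U lam s1) <> 0 ->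
  continuous (fun l => dsp (esol_at s1 l x v s0)) lam /\ continuous (fun l => vel (esol_at s1 l x v s0)) lam /\
  continuous (fun l => mdsp (esol_at s1 l x v s0)) lam /\ continuous (fun l => mvel (esol_at s1 l x v s0)) lam.
Proof.
  intros hs l d.
  destruct (mcont_inv _ _ (U_continuous lam s1 l hs) d) as (a1 & a2 & a3 & a4).
  assert (c1 : continuous (fun l => ap1 (inv (U l s1)) x v) lam) by (unfold ap1; csolve).
  assert (c2 : continuous (fun l => ap2 (inv (U l s1)) x v) lam) by (unfold ap2; csolve).
  destruct (esol_continuous lam 1 0 s0 l (Rle_refl _)) as (b1 & b2 & b3 & b4).
  destruct (esol_continuous lam 0 1 s0 l (Rle_refl _)) as (d1 & d2 & d3 & d4).
  assert (e : forall l, esol_at s1 l x v s0 =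
    comb (ap1 (inv (U l s1)) x v) (esol l 1 0 s0) (ap2 (inv (U l s1)) x v) (esol l 0 1 s0)).
  { intros y. unfold esol_at. rewrite (esol_fst), (esol_snd). reflexivity. }
  split4; eapply continuous_ext; try (intros y; rewrite e; reflexivity); unfold comb; cbn [dsp vel mdsp mvel]; csolve.
Qed.

(** From s0 to s1 [omega] gains lam - lam' times an integral close to that of dsp^2 of [z], which is
    positive; by [omega_s0_bound] the value at s0 costs at most a small multiple of (lam - lam')^2.
    Up to that square factor there remains a continuous lower bound, positive at lam. *)
Lemma esol_at_strict s1 lam x v : s0 < s1 -> - m < lam -> det (U lam s1) <> 0 -> x <> 0 \/ v <> 0 ->
  exists d, 0 < d /\ forall lam', Rabs (lam' - lam) < d -> lam' <> lam ->
    0 < (lam - lam') * omega (esol_at s1 lam x v s1) (esol_at s1 lam' x v s1).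
Proof.
  intros hs l dU nz.
  destruct (esol_at_spec s1 lam x v l dU) as (sz & dz & z1 & z2).
  set (z := esol_at s1 lam x v) in *.
  set (h := fun t => dsp (z t) ^ 2).
  assert (ch : forall t, continuous h t).
  { intros t. unfold h. destruct (sz t) as (a1 & _). apply is_derive_cont in a1. csolve. }
  assert (dI := fun t => is_derive_RInt_cont h s0 t ch).
  set (I := fun t => RInt h s0 t) in *.
  assert (I0 : I s0 = 0) by exact (RInt_point s0 h).
  assert (Ipos : 0 < I s1).
  { apply Rnot_le_lt; intros c.
    assert (Z := derive_zero_of_const I h s0 s1 hs (fun t _ => dI t) (fun t _ => pow2_ge_0 _) ltac:(lra)).
    assert (Z' := sol_zero_of_dsp (shift W lam) z s0 s1 (fun t _ => sz t)
      (fun t ht => Rsqr_0_uniq _ (eq_trans (Rsqr_pow2 _) (Z t ht))) ((s0 + s1) / 2) ltac:(lra)).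
    assert (Z1 : z s1 = pzero) by (apply (sol_zero (shift W lam) (Rabs lam + M) z ((s0 + s1) / 2) s1
      (shift_bound W M bW lam) (fun t _ => sz t) Z')).
    rewrite Z1 in z1, z2. simpl in z1, z2. lra. }
  destruct (esol_at_continuous s1 lam x v ltac:(lra) l dU) as (b1 & b2 & b3 & b4).
  set (X := 1 + nsq (z s0) * exp ((Rabs lam + M + 2) * (s1 - s0))).
  set (E := exp ((Rabs lam + 1 + M + 2) * (s1 - s0))).
  (* [kap] bounds the squared distance of the two solutions on [s0, s1] and tends to 0 as l' tends
     to lam. *)
  set (kap := fun l' => ((dsp (z s0) - dsp (esol_at s1 l' x v s0)) ^ 2 + (vel (z s0) - vel (esol_at s1 l' x v s0)) ^ 2 +
     (mdsp (z s0) - mdsp (esol_at s1 l' x v s0)) ^ 2 + (mvel (z s0) - mvel (esol_at s1 l' x v s0)) ^ 2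
     + ((lam - l') * X) ^ 2) * E).
  (* [en] is the energy form at lam + 1 of the change of position at s0, expanded so that its
     continuity in l' is visible. *)
  set (en := fun l' => (dsp (z s0) - dsp (esol_at s1 l' x v s0)) ^ 2 * energy (lam + 1) 1 0 +
     (dsp (z s0) - dsp (esol_at s1 l' x v s0)) * (vel (z s0) - vel (esol_at s1 l' x v s0)) *
       (energy (lam + 1) 1 1 - energy (lam + 1) 1 0 - energy (lam + 1) 0 1) +
     (vel (z s0) - vel (esol_at s1 l' x v s0)) ^ 2 * energy (lam + 1) 0 1).
  destruct (continuous_pos_near (fun l' => / 2 * I s1 - / 2 * kap l' * (s1 - s0) - / (2 * m) * en l') lam) as (d1 & d1p & hd1).
  { unfold kap, en. csolve. }
  { unfold kap, en. fold z. rewrite !Rminus_diag.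
    match goal with |- 0 < ?e => replace e with (/ 2 * I s1) by (field; lra) end. lra. }
  destruct (continuous_pos_near (fun l' => det (U l' s1) ^ 2) lam) as (d2 & d2p & hd2).
  { assert (c := mcont_det _ _ (U_continuous lam s1 l ltac:(lra))). csolve. }
  { apply pow2_gt_0; assumption. }
  exists (Rmin (Rmin d1 d2) (Rmin 1 (lam + m))).
  split; [repeat apply Rmin_pos; lra|].
  intros l' hl' ne.
  assert (r1 := Rmin_l (Rmin d1 d2) (Rmin 1 (lam + m))). assert (r2 := Rmin_r (Rmin d1 d2) (Rmin 1 (lam + m))).
  assert (r3 := Rmin_l d1 d2). assert (r4 := Rmin_r d1 d2).
  assert (r5 := Rmin_l 1 (lam + m)). assert (r6 := Rmin_r 1 (lam + m)).
  specialize (hd1 l' ltac:(lra)). specialize (hd2 l' ltac:(lra)).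
  assert (hl1 : Rabs (l' - lam) < 1) by lra.
  assert (l'm : - m < l') by (assert (q := Rabs_def2 _ _ hl'); lra).
  assert (dU' : det (U l' s1) <> 0) by (intros q; rewrite q in hd2; lra).
  destruct (esol_at_spec s1 l' x v l'm dU') as (sw & dw & w1 & w2).
  assert (kb : forall t, s0 <= t <= s1 -> nsq (comb 1 (z t) (-1) (esol_at s1 l' x v t)) <= kap l').
  { intros t ht. eapply Rle_trans; [apply (family_bound W M bW z (esol_at s1 l' x v) lam l' s0 s1 t ht hl1)|]; auto.
    rewrite nsq_diff. apply Rle_refl. }
  assert (ob := omega_s0_bound lam l' (ap1 (inv (U lam s1)) x v) (ap2 (inv (U lam s1)) x v)
    (ap1 (inv (U l' s1)) x v) (ap2 (inv (U l' s1)) x v) l l'm hl1).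
  fold (esol_at s1 lam x v) in ob. fold (esol_at s1 l' x v) in ob. fold z in ob.
  assert (en_eq : energy (lam + 1) (ap1 (inv (U lam s1)) x v - ap1 (inv (U l' s1)) x v)
     (ap2 (inv (U lam s1)) x v - ap2 (inv (U l' s1)) x v) = en l').
  { rewrite energy_quad by lra. unfold en, z, esol_at.
    destruct (esol_spec lam (ap1 (inv (U lam s1)) x v) (ap2 (inv (U lam s1)) x v) l) as (_ & _ & f1 & f2).
    destruct (esol_spec l' (ap1 (inv (U l' s1)) x v) (ap2 (inv (U l' s1)) x v) l'm) as (_ & _ & f3 & f4).
    rewrite f1, f2, f3, f4. reflexivity. }
  rewrite en_eq in ob.
  set (w := esol_at s1 l' x v) in *. set (c := lam - l') in *.
  (* The product of the positions is at least half of dsp^2 of [z] minus half of [kap], by expanding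
     the square of their difference. *)
  assert (q := derive_le_incr (fun t => c ^ 2 * (/ 2 * I t - / 2 * kap l' * (t - s0))) (fun t => c * omega (z t) (w t))
    (fun t => c ^ 2 * (/ 2 * h t - / 2 * kap l')) (fun t => c * (c * (dsp (z t) * dsp (w t)))) s0 s1 ltac:(lra)).
  cbv beta in q. rewrite I0, Rminus_diag in q.
  assert (c2 : 0 < c ^ 2) by (apply pow2_gt_0; unfold c; lra).
  assert (fin : c ^ 2 * (/ 2 * I s1 - / 2 * kap l' * (s1 - s0)) - c ^ 2 * (/ 2 * 0 - / 2 * kap l' * 0) <=
     c * omega (z s1) (w s1) - c * omega (z s0) (w s0)).
  { apply q.
    - intros t ht. specialize (dI t). dsolve. ring.
    - intros t ht. assert (do := sol_omega (shift W lam) (shift W l') z w t (sz t) (sw t)). dsolve. unfold shift, c. ring.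
    - intros t ht. specialize (kb t ht). rewrite nsq_diff in kb.
      assert (q2 := pow2_ge_0 (vel (z t) - vel (w t))). assert (q3 := pow2_ge_0 (mdsp (z t) - mdsp (w t))).
      assert (q4 := pow2_ge_0 (mvel (z t) - mvel (w t))).
      replace (c * (c * (dsp (z t) * dsp (w t)))) with (c ^ 2 * (dsp (z t) * dsp (w t))) by ring.
      apply Rmult_le_compat_l; [lra|]. unfold h. assert (q5 := pow2_ge_0 (dsp (w t))).
      assert (q6 : dsp (z t) * dsp (w t) = / 2 * (dsp (z t) ^ 2 + dsp (w t) ^ 2 - (dsp (z t) - dsp (w t)) ^ 2)) by field.
      lra. }
  replace (c ^ 2 / (2 * m) * en l') with (c ^ 2 * (/ (2 * m) * en l')) in ob by (field; lra).
  assert (0 < c ^ 2 * (/ 2 * I s1 - / 2 * kap l' * (s1 - s0) - / (2 * m) * en l')) by (apply Rmult_lt_0_compat; assumption).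
  lra.
Qed.

(** * Monotone crossing matrices *)

Section Cell.
Variable s1 : R.
Hypothesis hs1 : s0 < s1.

(** A frame of the vertical plane at s1: adding these solutions changes the momenta at s1 and leaves
    the position. *)
Lemma dual_exists lam : exists Z : (R -> phase) * (R -> phase),
  ((forall t, sol_at (shift W lam) (fst Z) t) /\ fst Z s1 = Phase 0 0 1 0) /\
  ((forall t, sol_at (shift W lam) (snd Z) t) /\ snd Z s1 = Phase 0 0 0 1).
Proof.
  destruct (flow_exists (shift W lam) (Rabs lam + M) s1 (Phase 0 0 1 0) (shift_continuous lam) (shift_bound W M bW lam)) as (y1 & i1 & t1).
  destruct (flow_exists (shift W lam) (Rabs lam + M) s1 (Phase 0 0 0 1) (shift_continuous lam) (shift_bound W M bW lam)) as (y2 & i2 & t2).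
  exists (y1, y2). cbn [fst snd]. tauto.
Qed.

Definition dual lam := proj1_sig (constructive_indefinite_description _ (dual_exists lam)).

Definition dsol (lam p q t : R) : phase := comb p (fst (dual lam) t) q (snd (dual lam) t).

Lemma dual_spec lam : 
  ((forall t, sol_at (shift W lam) (fst (dual lam)) t) /\ fst (dual lam) s1 = Phase 0 0 1 0) /\
  ((forall t, sol_at (shift W lam) (snd (dual lam)) t) /\ snd (dual lam) s1 = Phase 0 0 0 1).
Proof. exact (proj2_sig (constructive_indefinite_description _ (dual_exists lam))). Qed.

Lemma dsol_spec lam p q : (forall t, sol_at (shift W lam) (dsol lam p q) t) /\ dsol lam p q s1 = Phase 0 0 p q.
Proof.
  destruct (dual_spec lam) as ((a1 & a2) & (b1 & b2)). unfold dsol. split; [intros; apply sol_comb; auto|].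
  rewrite a2, b2. apply phase_eq; unfold comb; cbn [dsp vel mdsp mvel]; ring.
Qed.

Definition dual_mat (lam t : R) : mat :=
  Mat (dsp (fst (dual lam) t)) (dsp (snd (dual lam) t)) (vel (fst (dual lam) t)) (vel (snd (dual lam) t)).

Lemma dsol_dsp lam p q t : dsp (dsol lam p q t) = ap1 (dual_mat lam t) p q.
Proof. unfold dsol, ap1, dual_mat, comb; cbn [dsp m11 m12]. ring. Qed.

Lemma dsol_vel lam p q t : vel (dsol lam p q t) = ap2 (dual_mat lam t) p q.
Proof. unfold dsol, ap2, dual_mat, comb; cbn [vel m21 m22]. ring. Qed.

(** - K bounds the potentials from below for all lam > - m at once, so that a whole cell shares one
    admissible length. *)
Let K := M + m.

Let K0 : 0 <= K.
Proof. assert (q := bW 0). assert (q' := Rabs_pos (W 0)). unfold K; lra. Qed.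

Let hK lam : - m < lam -> forall t, - K <= shift W lam t.
Proof. intros l t. assert (q := bW t). apply Rabs_le_between in q. unfold K, shift. lra. Qed.

Let short (s : R) := s1 < s <= s1 + / (K + 4).

(** Here shortness acts: no nonzero solution has zero position at both s1 and s, so the plane of
    solutions vanishing at s is a graph over positions at s1. *)
Lemma det_dual_mat lam s : - m < lam -> short s -> det (dual_mat lam s) <> 0.
Proof.
  intros l hs. apply det2_inj. intros p q h1 h2.
  destruct (dsol_spec lam p q) as (sd & d0).
  assert (Z := short_dirichlet_unique W M K s1 bW K0 lam (dsol lam p q) s hs (hK lam l) sd
    ltac:(rewrite d0; reflexivity) ltac:(rewrite d0; reflexivity)
    ltac:(rewrite dsol_dsp; exact h1) ltac:(rewrite dsol_vel; exact h2) s1).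
  rewrite d0 in Z. injection Z; intros; split; assumption.
Qed.

Lemma dual_mat_cont_t lam t : mcont (fun t => dual_mat lam t) t.
Proof.
  destruct (dual_spec lam) as ((a & _) & (b & _)).
  destruct (a t) as (a1 & a2 & _), (b t) as (b1 & b2 & _).
  unfold mcont, dual_mat; cbn [m11 m12 m21 m22]. split4; eapply is_derive_cont; eassumption.
Qed.

Lemma U_cont_t lam t : - m < lam -> mcont (fun t => U lam t) t.
Proof.
  intros l.
  destruct (esol_spec lam 1 0 l) as (a & _). destruct (esol_spec lam 0 1 l) as (b & _).
  destruct (a t) as (a1 & a2 & _), (b t) as (b1 & b2 & _).
  apply is_derive_cont in a1. apply is_derive_cont in a2. apply is_derive_cont in b1. apply is_derive_cont in b2.
  unfold mcont, U; cbn [m11 m12 m21 m22]. split4.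
  - apply continuous_ext with (2 := a1). intros y; rewrite esol_fst; reflexivity.
  - apply continuous_ext with (2 := b1). intros y; rewrite esol_snd; reflexivity.
  - apply continuous_ext with (2 := a2). intros y; rewrite esol_fst; reflexivity.
  - apply continuous_ext with (2 := b2). intros y; rewrite esol_snd; reflexivity.
Qed.

Lemma dual_mat_cont_lam lam t : s1 <= t -> mcont (fun l => dual_mat l t) lam.
Proof.
  intros ht.
  assert (z0 : forall z, nsq (comb 1 z (-1) z) <= 0) by (intros; rewrite nsq_diff, !Rminus_diag; lra).
  destruct (family_continuous W M bW (fun l => fst (dual l)) lam s1 t 0 1 ht Rlt_0_1) as (a1 & a2 & _).
  { intros y _. apply dual_spec. }
  { intros y _. destruct (dual_spec y) as ((_ & e) & _). destruct (dual_spec lam) as ((_ & e') & _).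
    rewrite e, e', Rmult_0_l. apply z0. }
  destruct (family_continuous W M bW (fun l => snd (dual l)) lam s1 t 0 1 ht Rlt_0_1) as (b1 & b2 & _).
  { intros y _. apply dual_spec. }
  { intros y _. destruct (dual_spec y) as (_ & (_ & e)). destruct (dual_spec lam) as (_ & (_ & e')).
    rewrite e, e', Rmult_0_l. apply z0. }
  unfold mcont, dual_mat; cbn [m11 m12 m21 m22]. split4; assumption.
Qed.

(* In position coordinates at s1 the decaying subspace is the graph of some S, the
   subspace of solutions vanishing to first order at s that of some - R; then
   [crossing lam s = S + R]. *)
Definition crossing (lam s : R) : mat := mul (inv (dual_mat lam s)) (mul (U lam s) (inv (U lam s1))).

(** The solution with position (x, v) at s1 and zero position at s: the decaying solution is
    corrected by vertical momenta at s1, and the correction is exactly [crossing]. *)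
Definition rsol (lam s x v t : R) : phase :=
  comb 1 (esol_at s1 lam x v t) (-1) (dsol lam (ap1 (crossing lam s) x v) (ap2 (crossing lam s) x v) t).

Lemma rsol_spec lam s x v : - m < lam -> det (U lam s1) <> 0 -> short s ->
  (forall t, sol_at (shift W lam) (rsol lam s x v) t) /\
  dsp (rsol lam s x v s1) = x /\ vel (rsol lam s x v s1) = v /\
  mdsp (rsol lam s x v s1) = mdsp (esol_at s1 lam x v s1) - ap1 (crossing lam s) x v /\
  mvel (rsol lam s x v s1) = mvel (esol_at s1 lam x v s1) - ap2 (crossing lam s) x v /\
  dsp (rsol lam s x v s) = 0 /\ vel (rsol lam s x v s) = 0.
Proof.
  intros l dU hs. destruct (esol_at_spec s1 lam x v l dU) as (sb & _ & b1 & b2).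
  destruct (dsol_spec lam (ap1 (crossing lam s) x v) (ap2 (crossing lam s) x v)) as (sd & d0).
  assert (dB := det_dual_mat lam s l hs).
  assert (ds : dsp (dsol lam (ap1 (crossing lam s) x v) (ap2 (crossing lam s) x v) s) = dsp (esol_at s1 lam x v s) /\
               vel (dsol lam (ap1 (crossing lam s) x v) (ap2 (crossing lam s) x v) s) = vel (esol_at s1 lam x v s)).
  { rewrite dsol_dsp, dsol_vel, <- ap1_mul, <- ap2_mul. unfold crossing. rewrite mul_inv_r by assumption.
    unfold esol_at. rewrite esol_dsp, esol_vel, <- ap1_mul, <- ap2_mul. split; reflexivity. }
  destruct ds as (ds1 & ds2). unfold rsol.
  split; [intros; apply sol_comb; auto|].
  unfold comb; cbn [dsp vel mdsp mvel]. rewrite d0, b1, b2, ds1, ds2. cbn [dsp vel mdsp mvel].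
  repeat split; ring.
Qed.

(** The positions at s1 agree, so each [omega] is a difference of quadratic forms. The change of the
    crossing form thus splits into a decaying part and a Dirichlet part, each of which has its own
    monotonicity lemma. *)
Lemma omega_rsol lam lam' s s' x v : - m < lam -> - m < lam' -> det (U lam s1) <> 0 -> det (U lam' s1) <> 0 ->
  short s -> short s' ->
  omega (rsol lam s x v s1) (rsol lam' s' x v s1) =
  omega (esol_at s1 lam x v s1) (esol_at s1 lam' x v s1) - form (crossing lam s) x v + form (crossing lam' s') x v.
Proof.
  intros l l' d d' hs hs'.
  destruct (rsol_spec lam s x v l d hs) as (_ & r1 & r2 & r3 & r4 & _).
  destruct (rsol_spec lam' s' x v l' d' hs') as (_ & r1' & r2' & r3' & r4' & _).
  destruct (esol_at_spec s1 lam x v l d) as (_ & _ & b1 & b2). destruct (esol_at_spec s1 lam' x v l' d') as (_ & _ & b1' & b2').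
  unfold omega, pair, form. rewrite r1, r2, r3, r4, r1', r2', r3', r4', b1, b2, b1', b2'. ring.
Qed.

(** Both planes are isotropic: [omega] vanishes on decaying solutions by their limit, and on
    solutions with zero position at s because it is conserved. *)
Lemma crossing_sym lam s : - m < lam -> det (U lam s1) <> 0 -> short s -> m12 (crossing lam s) = m21 (crossing lam s).
Proof.
  intros l d hs.
  destruct (rsol_spec lam s 1 0 l d hs) as (t1 & r1 & r2 & r3 & r4 & r5 & r6).
  destruct (rsol_spec lam s 0 1 l d hs) as (t2 & q1 & q2 & q3 & q4 & q5 & q6).
  destruct (esol_at_spec s1 lam 1 0 l d) as (sb & db & b1 & b2). destruct (esol_at_spec s1 lam 0 1 l d) as (sb' & db' & b1' & b2').
  assert (o := omega_const (shift W lam) _ _ s1 s t1 t2).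
  assert (ob := omega_decaying (shift W lam) s1 _ _ (fun t _ => sb t) (fun t _ => sb' t) db db').
  unfold omega, pair in *. rewrite r1, r2, r3, r4, r5, r6, q1, q2, q3, q4, q5, q6 in o.
  rewrite b1, b2, b1', b2' in *. unfold ap1, ap2 in o. lra.
Qed.

(** At a single lam the decaying part of [omega_rsol] is 0, and [short_mono_s] gives the sign of the
    rest. *)
Lemma crossing_mono_s lam s s' x v : - m < lam -> det (U lam s1) <> 0 -> short s -> short s' -> s < s' ->
  x <> 0 \/ v <> 0 -> form (crossing lam s') x v < form (crossing lam s) x v.
Proof.
  intros l d hs hs' ss nz.
  destruct (rsol_spec lam s x v l d hs) as (t1 & r1 & r2 & _ & _ & r5 & r6).
  destruct (rsol_spec lam s' x v l d hs') as (t2 & q1 & q2 & _ & _ & q5 & q6).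
  assert (o := short_mono_s W M K s1 bW K0 lam (rsol lam s x v) (rsol lam s' x v) s s'
    (proj1 hs) ss (proj2 hs') (hK lam l) t1 t2 ltac:(congruence) ltac:(congruence) r5 r6 q5 q6
    ltac:(rewrite q1, q2; assumption)).
  rewrite omega_rsol in o by assumption. unfold omega in o. lra.
Qed.

(** The two parts of [omega_rsol] push in the same direction. The Dirichlet part is only weakly
    monotone; strictness comes from the decaying part. *)
Lemma crossing_strict_lam lam s x v : - m < lam -> det (U lam s1) <> 0 -> short s -> x <> 0 \/ v <> 0 ->
  exists d, 0 < d /\ forall lam', Rabs (lam' - lam) < d -> lam' <> lam -> - m < lam' -> det (U lam' s1) <> 0 ->
    0 < (form (crossing lam' s) x v - form (crossing lam s) x v) * (lam' - lam).
Proof.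
  intros l dU hs nz.
  destruct (esol_at_strict s1 lam x v hs1 l dU nz) as (d & d0 & h).
  exists d. split; [assumption|]. intros l' hl ne l'm dU'. specialize (h l' hl ne).
  destruct (rsol_spec lam s x v l dU hs) as (t1 & r1 & r2 & _ & _ & r5 & r6).

  destruct (rsol_spec l' s x v l'm dU' hs) as (t2 & q1 & q2 & _ & _ & q5 & q6).
  assert (o := omega_rsol lam l' s s x v l l'm dU dU' hs hs).
  assert (c : (lam - l') * omega (rsol lam s x v s1) (rsol l' s x v s1) <= 0).
  { destruct (Rle_dec l' lam) as [q|q].
    - assert (u := short_mono_lam W K s1 K0 lam l' (rsol lam s x v) (rsol l' s x v) s q hs (hK l' l'm) t1 t2
        ltac:(congruence) ltac:(congruence) r5 r6 q5 q6).
      assert (0 <= (lam - l') * - omega (rsol lam s x v s1) (rsol l' s x v s1)) by (apply Rmult_le_pos; lra). lra.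
    - assert (u := short_mono_lam W K s1 K0 l' lam (rsol l' s x v) (rsol lam s x v) s ltac:(lra) hs (hK lam l) t2 t1
        ltac:(congruence) ltac:(congruence) q5 q6 r5 r6).
      assert (e : omega (rsol lam s x v s1) (rsol l' s x v s1) = - omega (rsol l' s x v s1) (rsol lam s x v s1))
        by (unfold omega; ring). rewrite e.
      assert (0 <= (l' - lam) * - omega (rsol l' s x v s1) (rsol lam s x v s1)) by (apply Rmult_le_pos; lra). lra. }
  rewrite o in c. lra.
Qed.

Lemma crossing_corank lam s : - m < lam -> det (U lam s1) <> 0 -> short s -> corank (crossing lam s) = corank (U lam s).
Proof.
  intros l d hs. unfold crossing. apply corank_mul; [|assumption].
  rewrite det_inv by (apply det_dual_mat; assumption). apply Rinv_neq_0_compat, det_dual_mat; assumption.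
Qed.

Lemma crossing_cont_s lam s : - m < lam -> short s -> mcont (fun s => crossing lam s) s.
Proof.
  intros l hs. unfold crossing. apply mcont_mul.
  - apply mcont_inv; [apply dual_mat_cont_t | apply det_dual_mat; assumption].
  - apply mcont_mul; [apply U_cont_t; assumption|]. split4; apply continuous_const.
Qed.

Lemma crossing_cont_lam lam s : - m < lam -> det (U lam s1) <> 0 -> short s -> mcont (fun l => crossing l s) lam.
Proof.
  intros l d hs. assert (hs' : s1 < s) by (destruct hs; assumption). unfold crossing. apply mcont_mul.
  - apply mcont_inv; [apply dual_mat_cont_lam; lra | apply det_dual_mat; assumption].
  - apply mcont_mul; [apply U_continuous; lra|]. apply mcont_inv; [apply U_continuous; lra | assumption].
Qed.

End Cell.

(* If det U vanished on an interval, the two basis solutions, whose Wronskian in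
   the position alone is det U, would be proportional there. *)
Lemma det_U_nonzero lam a b : - m < lam -> a < b -> exists s, a < s < b /\ det (U lam s) <> 0.
Proof.
  intros l ab.
  destruct (classic (exists s, a < s < b /\ det (U lam s) <> 0)) as [|no]; [assumption|exfalso].
  assert (Z : forall s, a < s < b -> det (U lam s) = 0).
  { intros s hs. destruct (Req_dec (det (U lam s)) 0); [assumption|]. exfalso; apply no; exists s; split; assumption. }
  destruct (esol_spec lam 1 0 l) as (sy & _ & y1 & y2). destruct (esol_spec lam 0 1 l) as (sz & _ & z1 & z2).
  set (y := esol lam 1 0) in *. set (z := esol lam 0 1) in *.
  assert (W0 : forall s, a < s < b -> dsp (y s) * vel (z s) - dsp (z s) * vel (y s) = 0).
  { intros s hs. specialize (Z s hs). unfold det, U in Z; cbn [m11 m12 m21 m22] in Z.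
    unfold y, z. rewrite esol_fst, esol_snd. lra. }
  assert (zero_s0 : forall w c, (forall t, sol_at (shift W lam) w t) -> w c = pzero -> w s0 = pzero).
  { intros w c sw wc. apply (sol_zero (shift W lam) (Rabs lam + M) w c s0 (shift_bound W M bW lam)); [intros; apply sw | assumption]. }
  destruct (classic (exists c, a < c < b /\ dsp (y c) <> 0)) as [(c & hc & yc)|ny].
  - assert (cy : continuous (fun t => dsp (y t) ^ 2) c).
    { destruct (sy c) as (a1 & _). apply is_derive_cont in a1. csolve. }
    destruct (continuous_pos_near _ c cy (pow2_gt_0 _ yc)) as (d & d0 & hd).
    set (e := Rmin d (Rmin (c - a) (b - c))).
    assert (e0 : 0 < e) by (repeat apply Rmin_pos; lra).
    assert (r1 := Rmin_l d (Rmin (c - a) (b - c))). assert (r2 := Rmin_r d (Rmin (c - a) (b - c))). fold e in r1, r2.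
    assert (r3 := Rmin_l (c - a) (b - c)). assert (r4 := Rmin_r (c - a) (b - c)).
    assert (yn : forall t, c - e < t < c + e -> dsp (y t) <> 0).
    { intros t ht q. specialize (hd t ltac:(apply Rabs_def1; lra)). rewrite q in hd. lra. }
    set (k := dsp (z c) / dsp (y c)).
    assert (rat : forall t, c - e < t < c + e -> dsp (z t) / dsp (y t) = k).
    { assert (dr : forall t, c - e < t < c + e -> is_derive (fun t => dsp (z t) / dsp (y t)) t 0).
      { intros t ht. destruct (sy t) as (a1 & _), (sz t) as (b1 & _). specialize (yn t ht).
        eapply is_derive_eq; [apply (is_derive_div (fun t => dsp (z t)) (fun t => dsp (y t)) t _ _ b1 a1 yn)|].
        transitivity ((dsp (y t) * vel (z t) - dsp (z t) * vel (y t)) / dsp (y t) ^ 2); [field; assumption|].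
        rewrite (W0 t) by lra. unfold Rdiv; ring. }
      assert (gen : forall u v, c - e < u -> u <= v -> v < c + e -> dsp (z u) / dsp (y u) = dsp (z v) / dsp (y v)).
      { intros u v hu uv hv.
        assert (q1 := derive_nonneg_incr (fun t => dsp (z t) / dsp (y t)) (fun _ => 0) u v uv ltac:(intros; apply dr; lra) ltac:(intros; lra)).
        assert (q2 := derive_nonneg_incr (fun t => - (dsp (z t) / dsp (y t))) (fun _ => - 0) u v uv
           ltac:(intros; apply (is_derive_Ropp (fun t => dsp (z t) / dsp (y t))), dr; lra) ltac:(intros; lra)).
        cbv beta in q1, q2. lra. }
      intros t ht. unfold k. destruct (Rle_dec t c); [apply gen; lra | symmetry; apply gen; lra]. }
    set (w := fun t => comb 1 (z t) (- k) (y t)).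
    assert (sw : forall t, sol_at (shift W lam) w t) by (intros; apply sol_comb; auto).
    assert (wz := sol_zero_of_dsp (shift W lam) w (c - e) (c + e) (fun t _ => sw t)).
    assert (wc : w c = pzero).
    { apply wz; [|lra]. intros t ht. unfold w, comb; cbn [dsp]. rewrite <- (rat t ht). field. apply yn; assumption. }
    assert (q := f_equal vel (zero_s0 w c sw wc)). unfold w, comb in q. cbn [vel pzero] in q. rewrite y2, z2 in q. lra.
  - assert (yz := sol_zero_of_dsp (shift W lam) y a b (fun t _ => sy t)).
    assert (ym : y ((a + b) / 2) = pzero).
    { apply yz; [|lra]. intros t ht. destruct (Req_dec (dsp (y t)) 0); [assumption|]. exfalso; apply ny; exists t; split; assumption. }
    assert (q := zero_s0 y _ sy ym). rewrite q in y1. simpl in y1. lra.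
Qed.

(** * Local balance and the global count *)

Definition conj_mult (s lam : R) : nat := corank (U lam s).

Lemma balanced_local s lam : s0 + 1 <= s -> 0 <= lam -> exists d, 0 < d /\ forall a b l k,
  a <= b -> l <= k -> s - d < a -> b < s + d -> lam - d < l -> k < lam + d -> balanced conj_mult a b l k.
Proof.
  intros hs hl.
  assert (M0 : 0 <= M) by (assert (q := bW 0); assert (q' := Rabs_pos (W 0)); lra).
  (* [eps] is the admissible length 1/(K + 4). As s >= s0 + 1, choosing r <= 1 keeps s1 right of s0,
     and r <= eps / 2 reserves the other half of [eps] for the part of the cell beyond s. *)
  set (eps := / (M + m + 4)). assert (eps0 : 0 < eps) by (apply Rinv_0_lt_compat; lra).
  set (r := Rmin 1 (eps / 2)). assert (r0 : 0 < r) by (apply Rmin_pos; lra).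
  assert (r1 := Rmin_l 1 (eps / 2)). assert (r2 := Rmin_r 1 (eps / 2)). fold r in r1, r2.
  destruct (det_U_nonzero lam (s - r) s ltac:(lra) ltac:(lra)) as (s1 & hs1 & dU).
  assert (hs01 : s0 < s1) by lra.
  destruct (continuous_pos_near (fun l' => det (U l' s1) ^ 2) lam) as (d1 & d1p & hd1).
  { assert (c := mcont_det _ _ (U_continuous lam s1 ltac:(lra) ltac:(lra))). csolve. }
  { apply pow2_gt_0; assumption. }
  (* [d1] keeps the decaying plane a graph at s1, [m] keeps the parameters above - m, s - s1 keeps
     the cell right of s1, and eps / 2 keeps it within the admissible length. *)
  set (d := Rmin (Rmin d1 m) (Rmin (s - s1) (eps / 2))).
  assert (q1 := Rmin_l (Rmin d1 m) (Rmin (s - s1) (eps / 2))). assert (q2 := Rmin_r (Rmin d1 m) (Rmin (s - s1) (eps / 2))). fold d in q1, q2.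
  assert (q3 := Rmin_l d1 m). assert (q4 := Rmin_r d1 m).
  assert (q5 := Rmin_l (s - s1) (eps / 2)). assert (q6 := Rmin_r (s - s1) (eps / 2)).
  exists d. split; [repeat apply Rmin_pos; lra|].
  intros a b l k ab lk ha hb hl1 hk1.
  assert (hd : forall l', l <= l' <= k -> det (U l' s1) <> 0).
  { intros l' h q. specialize (hd1 l' ltac:(apply Rabs_def1; lra)). rewrite q in hd1. lra. }
  assert (hm : forall l', l <= l' <= k -> - m < l') by (intros; lra).
  assert (hr : forall t, a <= t <= b -> s1 < t <= s1 + / (M + m + 4)) by (intros; fold eps; lra).
  set (A := crossing s1).
  assert (horiz : forall l', l <= l' <= k -> exists n, Count (fun t => a <= t < b) (fun t => conj_mult t l') n /\
     (n + negind (A l' a) = negind (A l' b))%nat).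
  { intros l' hl'.
    destruct (Count_decr_corank (fun t => A l' t) a b ab) as (n & c & e).
    - intros t ht. apply crossing_cont_s; auto.
    - intros t ht. apply crossing_sym; auto.
    - intros t t' h1 h2 h3 u v nz. apply crossing_mono_s; auto; apply hr; lra.
    - exists n. split; [|assumption]. revert c. apply Count_ext; [tauto|]. intros t ht. apply crossing_corank; auto. apply hr; lra. }
  assert (vert : forall t, a <= t <= b -> exists n, Count (fun l' => l < l' <= k) (fun l' => conj_mult t l') n /\
     (n + negind (A k t) = negind (A l t))%nat).
  { intros t ht.
    destruct (Count_incr_corank (fun l' => A l' t) l k lk) as (n & c & e).
    - intros l' hl'. apply crossing_cont_lam; auto.
    - intros l' hl'. apply crossing_sym; auto.
    - intros l1 l2 h1 h2 h3 u v nz. apply (strict_incr_of_local (fun l' => form (A l' t) u v) l1 l2 h2).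
      intros x hx. destruct (crossing_strict_lam s1 hs01 x t u v (hm x ltac:(lra)) (hd x ltac:(lra)) (hr t ht) nz) as (d' & d'0 & h).
      exists d'. split; [assumption|]. intros y hy hy' ne. apply h; [assumption | assumption | apply hm; lra | apply hd; lra].
    - exists n. split; [|assumption]. revert c. apply Count_ext; [tauto|]. intros l' hl'. apply crossing_corank; auto; [apply hm | apply hd]; lra. }
  destruct (horiz l ltac:(lra)) as (n1 & c1 & e1). destruct (horiz k ltac:(lra)) as (n3 & c3 & e3).
  destruct (vert a ltac:(lra)) as (n2 & c2 & e2). destruct (vert b ltac:(lra)) as (n4 & c4 & e4).
  (* Both sums equal [negind (A l b)] minus [negind (A k a)]. *)
  exists n1, n2, n3, n4. repeat (split; [assumption|]). lia.
Qed.

Lemma conj_mult_zero s lam : - m < lam -> (forall t, t <= s -> 0 < shift W lam t) -> conj_mult s lam = 0%nat.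
Proof.
  intros l pV. unfold conj_mult, corank.
  destruct (Req_EM_T (det (U lam s)) 0) as [e|]; [exfalso|reflexivity]. revert e.
  apply det2_inj. intros c1 c2 h1 h2.
  destruct (esol_spec lam c1 c2 l) as (se & de & e1 & e2).
  assert (z : esol lam c1 c2 s = pzero).
  { apply (decaying_dirichlet (shift W lam) (Rabs lam + M)); auto.
    - apply shift_bound; assumption.
    - rewrite esol_dsp. exact h1.
    - rewrite esol_vel. exact h2. }
  assert (z0 : esol lam c1 c2 s0 = pzero)
    by (apply (sol_zero (shift W lam) (Rabs lam + M) (esol lam c1 c2) s s0 (shift_bound W M bW lam)); auto).
  rewrite z0 in e1, e2. simpl in e1, e2. split; lra.
Qed.

Lemma count_identity L Lam : s0 + 1 <= L -> M < Lam ->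
  exists n, Count (fun s => s < L) (fun s => conj_mult s 0) n /\ Count (fun lam => 0 < lam) (fun lam => conj_mult L lam) n.
Proof.
  intros hL hLam.
  assert (M0 : 0 <= M) by (assert (q := bW 0); assert (q' := Rabs_pos (W 0)); lra).
  destruct (balanced_of_local conj_mult (s0 + 1) L 0 Lam hL ltac:(lra)) as (n1 & n2 & n3 & n4 & c1 & c2 & c3 & c4 & e).
  { intros s lam hs hl. destruct (balanced_local s lam ltac:(lra) ltac:(lra)) as (d & d0 & g). exists d. split; [assumption|].
    intros a b l k; intros; apply g; lra. }
  assert (far : forall s lam, s <= s0 + 1 -> 0 <= lam -> conj_mult s lam = 0%nat).
  { intros s lam hs hl. apply conj_mult_zero; [lra|]. intros t ht. unfold shift. assert (q := pW t ltac:(lra)). lra. }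
  assert (top : forall s lam, M < lam -> conj_mult s lam = 0%nat).
  { intros s lam hl. apply conj_mult_zero; [lra|]. intros t _. assert (q := bW t). apply Rabs_le_between in q. unfold shift. lra. }
  assert (z2 : n2 = 0%nat).
  { apply (Count_unique _ _ _ _ c2). apply Count_zero. intros lam hl. apply far; lra. }
  assert (z3 : n3 = 0%nat).
  { apply (Count_unique _ _ _ _ c3). apply Count_zero. intros s hs. apply top; lra. }
  exists n1. split.
  (* The open ends at s = L and at lam = 0 are those of the strict inequalities in the conclusion;
     [far] and [top] show that extending the edges to half-lines adds nothing. *)
  - rewrite <- (Nat.add_0_r n1). apply (Count_split _ (fun s => s < s0 + 1) _ _ _ _) with (3 := c1); try (intros; lra).
    apply Count_zero; intros s hs; apply far; lra.
  - replace n1 with n4 by lia.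
    rewrite <- (Nat.add_0_r n4). apply (Count_split _ (fun lam => Lam < lam) _ _ _ _) with (3 := c4); try (intros; lra).
    apply Count_zero; intros lam hl; apply top; lra.
Qed.

End Decaying.

(** * Eigenfunctions and conjugate points *)

Lemma line_of_row a b x v : a <> 0 \/ b <> 0 -> a * x + b * v = 0 -> exists s, x = s * (- b) /\ v = s * a.
Proof.
  intros nz h. assert (p := sq_sum_pos a b nz).
  exists ((a * v - b * x) / (a ^ 2 + b ^ 2)). split; apply Rmult_eq_reg_r with (a ^ 2 + b ^ 2); try lra.
  - replace ((a * v - b * x) / (a ^ 2 + b ^ 2) * - b * (a ^ 2 + b ^ 2)) with (- b * (a * v - b * x)) by (field; lra).
    assert (a * (a * x + b * v) = 0) by (rewrite h; ring). lra.
  - replace ((a * v - b * x) / (a ^ 2 + b ^ 2) * a * (a ^ 2 + b ^ 2)) with (a * (a * v - b * x)) by (field; lra).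
    assert (b * (a * x + b * v) = 0) by (rewrite h; ring). lra.
Qed.

Lemma kernel_line A : det A = 0 -> m11 A ^ 2 + m12 A ^ 2 + m21 A ^ 2 + m22 A ^ 2 <> 0 ->
  exists k1 k2, (k1 <> 0 \/ k2 <> 0) /\ ap1 A k1 k2 = 0 /\ ap2 A k1 k2 = 0 /\
    forall x v, ap1 A x v = 0 -> ap2 A x v = 0 -> exists s, x = s * k1 /\ v = s * k2.
Proof.
  intros d nz. unfold det in d. unfold ap1, ap2.
  destruct (Req_dec (m11 A) 0) as [e1|n1]; [destruct (Req_dec (m12 A) 0) as [e2|n2]|].
  - assert (nz' : m21 A <> 0 \/ m22 A <> 0).
    { destruct (Req_dec (m21 A) 0) as [e3|]; [|tauto]. destruct (Req_dec (m22 A) 0) as [e4|]; [|tauto].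
      exfalso; apply nz. rewrite e1, e2, e3, e4; ring. }
    exists (- m22 A), (m21 A). split; [destruct nz'; [right | left]; lra|]. split; [rewrite e1, e2; ring|].
    split; [ring|]. intros x v _ h. apply line_of_row; assumption.
  - exists (- m12 A), (m11 A). split; [left; lra|]. split; [ring|]. split; [lra|].
    intros x v h _. apply line_of_row; [right|]; assumption.
  - exists (- m12 A), (m11 A). split; [right; lra|]. split; [ring|]. split; [lra|].
    intros x v h _. apply line_of_row; [left|]; assumption.
Qed.

(** Serves both multiplicities: eigenfunctions and conjugate vectors are alike the image of the
    kernel of [U] under a linear parametrization by the position at s0. *)
Lemma dim_on_kernel (T : Type) (D : T -> Prop) (S : (T -> R) -> Prop) (A : mat) (w : R -> R -> T -> R) :
  (forall x v t, w x v t = x * w 1 0 t + v * w 0 1 t) ->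
  (forall x v, ap1 A x v = 0 -> ap2 A x v = 0 -> S (w x v)) ->
  (forall x v, (forall t, D t -> w x v t = 0) -> x = 0 /\ v = 0) ->
  (forall u, S u -> exists x v, ap1 A x v = 0 /\ ap2 A x v = 0 /\ forall t, D t -> u t = w x v t) ->
  dim_on D S (corank A).
Proof.
  intros lin mem inj surj. unfold corank.
  destruct (Req_EM_T (det A) 0) as [d|d]; [destruct (Req_EM_T _ 0) as [z|z]|].
  - apply sum_sq4_zero in z. destruct z as (z1 & z2 & z3 & z4).
    assert (K : forall x v, ap1 A x v = 0 /\ ap2 A x v = 0).
    { intros x v. unfold ap1, ap2. rewrite z1, z2, z3, z4. split; ring. }
    exists (fun i => match i with O => w 1 0 | _ => w 0 1 end). split; [|split].
    + intros [|i] hi; apply mem; apply K.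
    + intros c h i hi. destruct (inj (c 0%nat) (c 1%nat)) as [h1 h2].
      { intros t ht. rewrite lin. specialize (h t ht). simpl in h. lra. }
      destruct i as [|[|i]]; [assumption | assumption | lia].
    + intros u hu. destruct (surj u hu) as (x & v & _ & _ & h).
      exists (fun i => match i with O => x | _ => v end). intros t ht. rewrite (h t ht), lin. simpl. ring.
  - destruct (kernel_line A d z) as (k1 & k2 & nz & h1 & h2 & h3).
    exists (fun _ => w k1 k2). split; [|split].
    + intros i hi. apply mem; assumption.
    + intros c h i hi. assert (i = 0%nat) by lia. subst i.
      destruct (inj (c 0%nat * k1) (c 0%nat * k2)) as [e1 e2].
      { intros t ht. specialize (h t ht). simpl in h. rewrite lin in h |- *. lra. }
      destruct nz as [nz|nz]; [destruct (Rmult_integral _ _ e1) | destruct (Rmult_integral _ _ e2)]; tauto.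
    + intros u hu. destruct (surj u hu) as (x & v & g1 & g2 & h). destruct (h3 x v g1 g2) as (s & -> & ->).
      exists (fun _ => s). intros t ht. rewrite (h t ht). simpl. rewrite lin, (lin k1 k2). ring.
  - exists (fun _ _ => 0). split; [intros; lia|]. split; [intros; lia|].
    intros u hu. destruct (surj u hu) as (x & v & g1 & g2 & h).
    assert (x = 0 /\ v = 0) as [-> ->].
    { unfold ap1, ap2, det in *. split; apply Rmult_eq_reg_l with (m11 A * m22 A - m12 A * m21 A); try assumption.
      - assert (m22 A * (m11 A * x + m12 A * v) - m12 A * (m21 A * x + m22 A * v) = 0) by (rewrite g1, g2; ring). lra.
      - assert (m11 A * (m21 A * x + m22 A * v) - m21 A * (m11 A * x + m12 A * v) = 0) by (rewrite g1, g2; ring). lra. }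
    exists (fun _ => 0). intros t ht. rewrite (h t ht), lin. simpl. ring.
Qed.

Lemma count_with_mult_of_Count (P : R -> Prop) (mult : R -> nat -> Prop) (f : R -> nat) n :
  (forall x, P x -> mult x (f x)) -> Count P f n -> count_with_mult P mult n.
Proof.
  intros hm (l & n1 & p1 & c1 & e1).
  set (k := filter (fun x => Nat.ltb 0 (f x)) l).
  assert (fst_k : map fst (map (fun x => (x, f x)) k) = k).
  { rewrite map_map. simpl. apply map_id. }
  exists (map (fun x => (x, f x)) k). rewrite fst_k. split4.
  - apply NoDup_filter; assumption.
  - intros p hp. apply in_map_iff in hp. destruct hp as (x & <- & hx). simpl.
    apply filter_In in hx. destruct hx as [hx px]. apply Nat.ltb_lt in px. auto.
  - intros x hx nx. destruct (f x) eqn:e; [rewrite <- e; auto|].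
    exfalso; apply nx. apply filter_In. rewrite Nat.ltb_lt. split; [apply c1; [assumption|]|]; lia.
  - rewrite <- e1, <- sumf_filter. fold k. clear. induction k as [|x k IH]; simpl; [reflexivity|]. rewrite IH; reflexivity.
Qed.

Lemma continuous_all_of_ex_derive (g : R -> R) : (forall x, ex_derive g x) -> forall x, continuous g x.
Proof. intros h x. apply (ex_derive_continuous g x (h x)). Qed.

(** The antiderivative is the integral from s. Convergence bounds it far to the left, to within 1 of
    the limit, and monotonicity carries this lower bound to all t <= s. *)
Lemma L2_of_ex_RInt_gen (g : R -> R) s : (forall t, continuous g t) ->
  ex_RInt_gen (fun t => g t ^ 2) (Rbar_locally m_infty) (at_point s) -> L2 s g.
Proof.
  intros cg [l hl].
  assert (ch : forall t, continuous (fun t => g t ^ 2) t) by (intros t; specialize (cg t); csolve).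
  assert (dG := fun t => is_derive_RInt_cont (fun t => g t ^ 2) s t ch).
  destruct (hl (fun y => l - 1 < y < l + 1)) as [Q R HQ HR H].
  { exists (mkposreal 1 Rlt_0_1). intros y hy.
    unfold ball in hy; simpl in hy; unfold AbsRing_ball, abs, minus, plus, opp in hy; simpl in hy.
    apply Rabs_def2 in hy. lra. }
  destruct HQ as [T HT]. unfold at_point in HR.
  exists (fun t => RInt (fun t => g t ^ 2) s t), (fun t => g t ^ 2), (- l - 1).
  intros t ht. split; [apply dG|]. split; [lra|].
  set (t' := Rmin t (T - 1)). assert (r1 := Rmin_l t (T - 1)). assert (r2 := Rmin_r t (T - 1)). fold t' in r1, r2.
  apply Rle_trans with (RInt (fun t => g t ^ 2) s t').
  - destruct (H t' s (HT t' ltac:(lra)) HR) as (y & hy & b). cbn [fst snd] in hy.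
    rewrite <- (opp_RInt_swap (fun t => g t ^ 2)).
    + rewrite (is_RInt_unique _ _ _ _ hy). unfold opp; simpl. lra.
    + exists y; exact hy.
  - apply (derive_nonneg_incr (fun t => RInt (fun t => g t ^ 2) s t) (fun t => g t ^ 2) t' t r1).
    + intros; apply dG.
    + intros; apply pow2_ge_0.
Qed.

(** The integrals over [t, s] grow as t decreases and are bounded through the dominating
    antiderivative; their supremum is the improper integral. *)
Lemma ex_RInt_gen_of_L2 (g : R -> R) a s : a <= s -> (forall t, continuous g t) -> L2 a g ->
  ex_RInt_gen (fun t => g t ^ 2) (Rbar_locally m_infty) (at_point s).
Proof.
  intros as_ cg (G & G' & m & HG).
  assert (ch : forall t, continuous (fun t => g t ^ 2) t) by (intros t; specialize (cg t); csolve).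
  assert (dF := fun t => is_derive_RInt_cont (fun t => g t ^ 2) s t ch).
  set (F := fun t => RInt (fun t => g t ^ 2) s t) in *.
  assert (Fm : forall t t', t <= t' -> F t <= F t').
  { intros t t' h. apply (derive_nonneg_incr F (fun t => g t ^ 2)); [assumption | intros; apply dF | intros; apply pow2_ge_0]. }
  assert (Fb : forall t, - F t <= G a - m - F a).
  { assert (b : forall t, t <= a -> - F t <= G a - m - F a).
    { intros t ht. assert (q := derive_le_incr F G _ G' t a ht (fun t _ => dF t) ltac:(intros; apply HG; lra) ltac:(intros; apply HG; lra)).
      destruct (HG t ht) as (_ & _ & b). lra. }
    intros t. destruct (Rle_dec t a); [auto|]. specialize (b a (Rle_refl a)). specialize (Fm a t ltac:(lra)). lra. }
  destruct (completeness (fun y => exists t, y = - F t)) as [l [ub lub]].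
  { exists (G a - m - F a). intros y (t & ->). apply Fb. }
  { exists (- F s), s. reflexivity. }
  exists l. intros P [eps hP].
  assert (exists T, l - eps < - F T) as (T & q).
  { destruct (classic (exists T, l - eps < - F T)) as [|n]; [assumption|exfalso].
    assert (e0 := cond_pos eps). assert (l <= l - eps); [|lra]. apply lub. intros y (t & ->).
    destruct (Rle_dec (- F t) (l - eps)); [assumption|]. exfalso; apply n; exists t; lra. }
  apply (Filter_prod _ _ _ (fun t => t < T) (fun t => t = s)).
  - exists T. auto.
  - reflexivity.
  - intros t s' ht ->. exists (- F t). cbn [fst snd]. split.
    + assert (e : ex_RInt (fun t => g t ^ 2) s t) by (apply (ex_RInt_continuous (V := R_CompleteNormedModule)); intros; apply ch).
      apply (is_RInt_swap (fun t => g t ^ 2) t s (F t)). apply (RInt_correct (V := R_CompleteNormedModule)). exact e.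
    + apply hP. unfold ball; simpl; unfold AbsRing_ball, abs, minus, plus, opp; simpl.
      assert (- F t <= l) by (apply ub; exists t; reflexivity).
      specialize (Fm t T ltac:(lra)). apply Rabs_def1; lra.
Qed.

Lemma bounded_of_limits (g : R -> R) : (forall x, continuous g x) ->
  is_lim g p_infty 0 -> is_lim g m_infty 0 -> exists B, forall x, g x ^ 2 <= B.
Proof.
  intros c lp lm.
  apply is_lim_spec in lp. destruct (lp (mkposreal 1 Rlt_0_1)) as [b hb]. simpl in hb.
  apply is_lim_spec in lm. destruct (lm (mkposreal 1 Rlt_0_1)) as [a ha]. simpl in ha.
  (* The two thresholds come in no particular order, hence the minimum and the maximum. *)
  destruct (continuity_ab_maj (fun x => g x ^ 2) (Rmin a b) (Rmax a b)) as (Mx & hM & _).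
  { eapply Rle_trans; [apply Rmin_l | apply Rmax_l]. }
  { intros x _. apply continuity_pt_filterlim. specialize (c x). apply (continuous_Rsqr g x c). }
  assert (sm : forall x, Rabs (g x - 0) < 1 -> g x ^ 2 <= 1).
  { intros x h. rewrite Rminus_0_r in h. apply Rabs_def2 in h. nra. }
  exists (1 + g Mx ^ 2). intros x. assert (p := pow2_ge_0 (g Mx)).
  destruct (Rlt_dec b x) as [l|l]; [specialize (sm x (hb x l)); lra|].
  destruct (Rlt_dec x a) as [l'|l']; [specialize (sm x (ha x l')); lra|].
  assert (q := hM x ltac:(split; [eapply Rle_trans; [apply Rmin_l | lra] | eapply Rle_trans; [|apply Rmax_r]; lra])). lra.
Qed.

(** * Translation between phase space and the given equation *)

Lemma Derive_f nu mu u : Derive (Defs.f nu mu) u = 2 * nu * u - 3 * u ^ 2 - mu.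
Proof.
  apply is_derive_unique. unfold Defs.f. auto_derive; [trivial | ring].
Qed.

Definition potential (nu mu : R) (phi : R -> R) (t : R) : R := - Derive (Defs.f nu mu) (phi t).

(* The coordinates (u, u_xx, u_xxx + 2 u_x, u_x) of a phase point. *)
Definition coords (z : phase) (i : nat) : R :=
  match i with
  | 0%nat => dsp z
  | 1%nat => mvel z - dsp z
  | 2%nat => vel z - mdsp z
  | 3%nat => vel z
  | _ => 0
  end.

Definition of_coords (q : nat -> R) : phase :=
  Phase (q 0%nat) (q 3%nat) (q 3%nat - q 2%nat) (q 0%nat + q 1%nat).

Section Correspondence.
Variables (nu mu : R) (phi : R -> R).
Notation W := (potential nu mu phi).

Lemma sol_of_first_order lam q : first_order_sol nu mu phi lam q ->
  forall t, sol_at (shift W lam) (fun t => of_coords (q t)) t.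
Proof.
  intros [ex eq] t. destruct (eq t) as (e0 & e1 & e2 & e3).
  assert (d : forall i l, (i < 4)%nat -> Derive (fun t => q t i) t = l -> is_derive (fun t => q t i) t l).
  { intros i l hi <-. apply Derive_correct, ex; assumption. }
  assert (d0 := d 0%nat _ ltac:(lia) e0). assert (d1 := d 1%nat _ ltac:(lia) e1).
  assert (d2 := d 2%nat _ ltac:(lia) e2). assert (d3 := d 3%nat _ ltac:(lia) e3).
  unfold sol_at, of_coords; cbn [dsp vel mdsp mvel]. split4.
  - exact d0.
  - dsolve. ring.
  - dsolve. unfold shift, potential. ring.
  - dsolve. ring.
Qed.

Lemma first_order_of_sol lam z : (forall t, sol_at (shift W lam) z t) ->
  first_order_sol nu mu phi lam (fun t => coords (z t)).
Proof.
  intros s.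
  assert (d : forall t, is_derive (fun t => dsp (z t)) t (vel (z t)) /\
    is_derive (fun t => mvel (z t) - dsp (z t)) t (vel (z t) - mdsp (z t) - 2 * vel (z t)) /\
    is_derive (fun t => vel (z t) - mdsp (z t)) t ((- lam - 1 + Derive (Defs.f nu mu) (phi t)) * dsp (z t)) /\
    is_derive (fun t => vel (z t)) t (mvel (z t) - dsp (z t))).
  { intros t. destruct (s t) as (a1 & a2 & a3 & a4). split4.
    - assumption.
    - dsolve. ring.
    - dsolve. unfold shift, potential. ring.
    - assumption. }
  split.
  - intros i t hi. destruct (d t) as (d0 & d1 & d2 & d3).
    destruct i as [|[|[|[|i]]]]; [eexists; exact d0 | eexists; exact d1 | eexists; exact d2 | eexists; exact d3 | lia].
  - intros t. destruct (d t) as (d0 & d1 & d2 & d3). cbn [coords].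
    split4; apply is_derive_unique; assumption.
Qed.

Lemma sol_derivatives lam z : (forall t, sol_at (shift W lam) z t) ->
  (forall t, Derive_n (fun t => dsp (z t)) 1 t = vel (z t)) /\
  (forall t, Derive_n (fun t => dsp (z t)) 2 t = mvel (z t) - dsp (z t)) /\
  (forall t, Derive_n (fun t => dsp (z t)) 3 t = - mdsp (z t) - vel (z t)) /\
  (forall t, Derive_n (fun t => dsp (z t)) 4 t = (1 - shift W lam t) * dsp (z t) - 2 * mvel (z t)) /\
  (forall k t, (k <= 4)%nat -> ex_derive_n (fun t => dsp (z t)) k t).
Proof.
  intros s.
  assert (e1 : forall t, Derive_n (fun t => dsp (z t)) 1 t = vel (z t)).
  { intros t. destruct (s t) as (a1 & a2 & a3 & a4). apply is_derive_unique; assumption. }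
  assert (e2 : forall t, is_derive (Derive_n (fun t => dsp (z t)) 1) t (mvel (z t) - dsp (z t))).
  { intros t. destruct (s t) as (a1 & a2 & a3 & a4). apply is_derive_ext with (2 := a2). intros; symmetry; apply e1. }
  assert (e2' := fun t => is_derive_unique _ _ _ (e2 t)).
  assert (e3 : forall t, is_derive (Derive_n (fun t => dsp (z t)) 2) t (- mdsp (z t) - vel (z t))).
  { intros t. destruct (s t) as (a1 & a2 & a3 & a4). apply is_derive_ext with (fun t => mvel (z t) - dsp (z t)).
    - intros u; symmetry; apply e2'.
    - dsolve. ring. }
  assert (e3' := fun t => is_derive_unique _ _ _ (e3 t)).
  assert (e4 : forall t, is_derive (Derive_n (fun t => dsp (z t)) 3) t ((1 - shift W lam t) * dsp (z t) - 2 * mvel (z t))).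
  { intros t. destruct (s t) as (a1 & a2 & a3 & a4). apply is_derive_ext with (fun t => - mdsp (z t) - vel (z t)).
    - intros u; symmetry; apply e3'.
    - dsolve. ring. }
  assert (e4' := fun t => is_derive_unique _ _ _ (e4 t)).
  split; [exact e1|]. split; [exact e2'|]. split; [exact e3'|]. split; [exact e4'|].
  intros k t hk. destruct k as [|[|[|[|[|k]]]]].
  - exact I.
  - destruct (s t) as (a1 & a2 & a3 & a4). eexists; exact a1.
  - eexists; exact (e2 t).
  - eexists; exact (e3 t).
  - eexists; exact (e4 t).
  - lia.
Qed.

Lemma sol_of_eigenfunction s lam u : eigenspace nu mu phi s lam u ->
  forall t, t <= s -> sol_at (shift W lam)
    (fun t => Phase (u t) (Derive_n u 1 t) (- Derive_n u 3 t - Derive_n u 1 t) (u t + Derive_n u 2 t)) t.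
Proof.
  intros (ex & _ & _ & _ & eq) t ht.
  assert (d : forall k, (k <= 3)%nat -> is_derive (Derive_n u k) t (Derive_n u (S k) t)).
  { intros k hk. apply Derive_correct. apply (ex (S k) t). lia. }
  assert (d0 := d 0%nat ltac:(lia)). assert (d1 := d 1%nat ltac:(lia)).
  assert (d2 := d 2%nat ltac:(lia)). assert (d3 := d 3%nat ltac:(lia)). clear d.
  specialize (eq t ht). change (Derive_n u 0) with u in d0.
  change (is_derive (fun t => u t) t (Derive_n u 1 t)) in d0.
  set (u1 := Derive_n u 1) in *. set (u2 := Derive_n u 2) in *. set (u3 := Derive_n u 3) in *. set (u4 := Derive_n u 4) in *.
  change (is_derive (fun t => u1 t) t (u2 t)) in d1. change (is_derive (fun t => u2 t) t (u3 t)) in d2.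
  change (is_derive (fun t => u3 t) t (u4 t)) in d3.
  unfold sol_at; cbn [dsp vel mdsp mvel]. split4.
  - exact d0.
  - dsolve. ring.
  - dsolve. unfold shift, potential. lra.
  - dsolve. ring.
Qed.
End Correspondence.

Theorem theorem3 (nu mu : R) (phi : R -> R)
  (h1 : H1 nu mu phi) (h2 : H2 nu mu) (h3 : H3 nu mu phi) (L : R) :
  exists n : nat,
    count_with_mult (fun lam => 0 < lam)
      (fun lam m => dim_on (fun x => x <= L) (eigenspace nu mu phi L lam) m) n /\
    count_with_mult (fun x => x < L)
      (fun x m => dim_on idx4 (conj_space nu mu phi x) m) n.
Proof.
  destruct h1 as (smooth & _ & lp & lm).
  set (W := potential nu mu phi).
  assert (Weq : forall t, W t = mu + 3 * phi t ^ 2 - 2 * nu * phi t).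
  { intros t. unfold W, potential. rewrite Derive_f. ring. }
  assert (cphi := continuous_all_of_ex_derive phi (fun x => smooth 1%nat x)).
  assert (cW : forall t, continuous W t).
  { intros t. apply continuous_ext with (fun t => mu + 3 * phi t ^ 2 - 2 * nu * phi t); [intros; symmetry; apply Weq|].
    specialize (cphi t). csolve. }
  destruct (bounded_of_limits phi cphi lp lm) as [B hB].
  set (M := Rabs mu + 3 * B + Rabs nu * (1 + B)).
  assert (bW : forall t, Rabs (W t) <= M).
  { intros t. rewrite Weq. specialize (hB t). assert (p := pow2_ge_0 (phi t)).
    assert (q : Rabs (2 * phi t) <= 1 + B).
    { apply Rabs_le. assert (0 <= (phi t - 1) ^ 2) by apply pow2_ge_0. assert (0 <= (phi t + 1) ^ 2) by apply pow2_ge_0. lra. }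
    unfold M. replace (mu + 3 * phi t ^ 2 - 2 * nu * phi t) with (mu + 3 * phi t ^ 2 + nu * (- (2 * phi t))) by ring.
    eapply Rle_trans; [apply Rabs_triang|]. apply Rplus_le_compat.
    - eapply Rle_trans; [apply Rabs_triang|]. apply Rplus_le_compat; [lra|]. rewrite Rabs_right; lra.
    - rewrite Rabs_mult, Rabs_Ropp. apply Rmult_le_compat_l; [apply Rabs_pos | assumption]. }
  assert (mu0 : 0 < mu) by (unfold H2 in h2; rewrite Derive_f in h2; lra).
  (* The potential tends to - f'(0) = mu at minus infinity, so far to the left it is at least mu / 2
     = 2 m. *)
  assert (m_pos : 0 < mu / 4) by lra. set (m := mu / 4) in *.
  assert (exists T, forall t, t < T -> 2 * m <= W t) as [T hT].
  (* Chosen so that (2 |nu| + 1) e = mu / 2; the summand 1 covers nu = 0. *)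
  { set (e := mu / (2 * (2 * Rabs nu + 1))). assert (nn := Rabs_pos nu).
    assert (e0 : 0 < e) by (apply Rdiv_lt_0_compat; lra).
    apply is_lim_spec in lm. destruct (lm (mkposreal e e0)) as [T hT]. simpl in hT.
    exists T. intros t ht. specialize (hT t ht). rewrite Rminus_0_r in hT. rewrite Weq.
    assert (p := pow2_ge_0 (phi t)).
    assert (2 * nu * phi t <= mu / 2).
    { eapply Rle_trans; [apply Rle_abs|]. rewrite Rabs_mult.
      apply Rle_trans with ((2 * Rabs nu + 1) * e).
      - apply Rmult_le_compat; try apply Rabs_pos; [|lra].
        rewrite Rabs_mult, (Rabs_right 2) by lra. lra.
      - apply Req_le. unfold e. field. lra. }
    unfold m. lra. }
  (* T - 1 puts s0 + 1 strictly below the threshold of [hT]; the minimum with L gives the rectangle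
     its left edge at s0 + 1 <= L. *)
  set (s0 := Rmin (T - 1) L - 1).
  assert (r1 := Rmin_l (T - 1) L). assert (r2 := Rmin_r (T - 1) L).
  assert (pW : forall t, t <= s0 + 1 -> 2 * m <= W t) by (intros t ht; apply hT; unfold s0 in ht; lra).
  assert (hL : s0 + 1 <= L) by (unfold s0; lra).
  destruct (count_identity W M m s0 cW bW m_pos pW L (M + 1) hL ltac:(lra)) as (n & c1 & c2).
  set (es := esol W M m s0 cW bW m_pos pW).
  assert (spec := esol_spec W M m s0 cW bW m_pos pW).
  assert (inj : forall lam x v t, - m < lam -> es lam x v t = pzero -> x = 0 /\ v = 0).
  { intros lam x v t l h. destruct (spec lam x v l) as (s & _ & e1 & e2).
    assert (z0 := sol_zero (shift W lam) (Rabs lam + M) (es lam x v) t s0 (shift_bound W M bW lam) (fun t _ => s t) h).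
    fold es in e1, e2. rewrite z0 in e1, e2. simpl in e1, e2. split; lra. }
  assert (span := esol_span W M m s0 cW bW m_pos pW).
  exists n. split.
  - revert c2. apply count_with_mult_of_Count. intros lam hl.
    assert (l : - m < lam) by lra.
    apply (dim_on_kernel _ _ _ _ (fun x v t => dsp (es lam x v t))).
    + intros x v t. unfold es. rewrite esol_fst, esol_snd. unfold esol, comb; cbn [dsp]. ring.
    + intros x v k1 k2. destruct (spec lam x v l) as (s & d & _). fold es in s, d.
      set (z := es lam x v) in *.
      assert (zL1 : dsp (z L) = 0) by (unfold z, es; rewrite esol_dsp; exact k1).
      assert (zL2 : vel (z L) = 0) by (unfold z, es; rewrite esol_vel; exact k2).
      destruct (sol_derivatives nu mu phi lam z s) as (e1 & e2 & e3 & e4 & ex).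
      assert (pos0 : forall t, t <= s0 + 1 -> m <= shift W lam t) by (intros t ht; apply Rlt_le, (shift_pos W m s0 pW); assumption).
      assert (bV := shift_bound W M bW lam).
      destruct (energy_L2 (shift W lam) m (s0 + 1) m_pos pos0 z 0 ltac:(auto)
        ltac:(apply (decays_energy_nonneg (shift W lam)); auto; intros t ht; specialize (pos0 t ht); lra)) as (L1 & L4).
      destruct (L2_phase (shift W lam) (Rabs lam + M) (s0 + 1) bV z ltac:(auto) L1 L4) as (L2' & L3).
      split; [intros; apply ex; assumption|]. split; [|split; [assumption|split]].
      * assert (gen : forall (k : nat) (g : R -> R), (forall t, Derive_n (fun t => dsp (z t)) k t = g t) ->
          (forall t, continuous g t) -> L2 (s0 + 1) g ->
          ex_RInt_gen (fun t => Derive_n (fun t => dsp (z t)) k t ^ 2) (Rbar_locally m_infty) (at_point L)).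
        { intros k g e cg lg. apply (ex_RInt_gen_of_L2 _ (s0 + 1)); [lra | |].
          - intros t. apply continuous_ext with g; [intros; symmetry; apply e | apply cg].
          - apply L2_ext with g; [intros; symmetry; apply e | assumption]. }
        assert (cz : forall t, continuous (fun t => dsp (z t)) t /\ continuous (fun t => vel (z t)) t /\
           continuous (fun t => mdsp (z t)) t /\ continuous (fun t => mvel (z t)) t).
        { intros t. destruct (s t) as (a1 & a2 & a3 & a4). split4; eapply is_derive_cont; eassumption. }
        intros k hk. destruct k as [|[|[|[|[|k]]]]]; [| | | | |lia].
        -- exact (gen 0%nat (fun t => dsp (z t)) (fun t => eq_refl) (fun t => proj1 (cz t)) L1).
        -- exact (gen 1%nat (fun t => vel (z t)) e1 (fun t => proj1 (proj2 (cz t))) L2').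
        -- apply (gen 2%nat (fun t => mvel (z t) - dsp (z t))); [assumption | |].
           ++ intros t. destruct (cz t) as (z1 & z2 & z3 & z4). csolve.
           ++ apply L2_ext with (fun t => 1 * mvel (z t) + (-1) * dsp (z t)); [intros; ring|]. apply L2_lin; assumption.
        -- apply (gen 3%nat (fun t => - mdsp (z t) - vel (z t))); [assumption | |].
           ++ intros t. destruct (cz t) as (z1 & z2 & z3 & z4). csolve.
           ++ apply L2_ext with (fun t => (-1) * mdsp (z t) + (-1) * vel (z t)); [intros; ring|]. apply L2_lin; assumption.
        -- apply (gen 4%nat (fun t => (1 - shift W lam t) * dsp (z t) - 2 * mvel (z t))); [assumption | |].
           ++ intros t. destruct (cz t) as (z1 & z2 & z3 & z4). assert (cs := shift_continuous W cW lam t). csolve.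
           ++ apply L2_ext with (fun t => 1 * (1 * dsp (z t) + (-1) * (shift W lam t * dsp (z t))) + (-2) * mvel (z t)); [intros; ring|].
              apply L2_lin; [|assumption]. apply L2_lin; [assumption|].
              apply L2_mult_bdd with (Rabs lam + M); [intros; apply bV | assumption].
      * change (Derive_n (fun t => dsp (z t)) 1 L = 0). rewrite e1; assumption.
      * intros t _. rewrite e4, e2. unfold shift, W, potential. ring.
    + intros x v h. destruct (spec lam x v l) as (s & _). fold es in s.
      (* Functions are identified on (-oo, L] only, so vanishing is exploited on an open interval
         inside it. *)
      apply (inj lam x v (L - 1 / 2) l).
      apply (sol_zero_of_dsp (shift W lam) (es lam x v) (L - 1) L); [intros; apply s | intros; apply h; lra | lra].
    + intros u hu. assert (s := sol_of_eigenfunction nu mu phi L lam u hu). fold W in s.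
      destruct hu as (ex & int & u0 & u1 & _).
      set (z := fun t => Phase (u t) (Derive_n u 1 t) (- Derive_n u 3 t - Derive_n u 1 t) (u t + Derive_n u 2 t)) in *.
      assert (cd : forall k, (k <= 3)%nat -> forall t, continuous (Derive_n u k) t).
      { intros k hk. apply continuous_all_of_ex_derive. intros t. apply (ex (S k) t). lia. }
      (* Square integrability of u and u'' suffices, as it covers [dsp] and [mvel]; interpolation
         yields decay of the other components. *)
      assert (Lu := L2_of_ex_RInt_gen _ L (cd 0%nat ltac:(lia)) (int 0%nat ltac:(lia))).
      assert (Lu2 := L2_of_ex_RInt_gen _ L (cd 2%nat ltac:(lia)) (int 2%nat ltac:(lia))).
      assert (dz : decays z).
      { apply (L2_decays (shift W lam) (Rabs lam + M) L (shift_bound W M bW lam) z s).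
        - exact Lu.
        - apply L2_ext with (fun t => 1 * u t + 1 * Derive_n u 2 t); [intros; unfold z; cbn [mvel]; ring|].
          apply L2_lin; assumption. }
      assert (e := span lam z L l ltac:(lra) s dz). fold es in e.
      exists (dsp (z s0)), (vel (z s0)). split; [|split].
      * rewrite <- (esol_dsp W M m s0 cW bW m_pos pW). fold es. rewrite <- e by lra. exact u0.
      * rewrite <- (esol_vel W M m s0 cW bW m_pos pW). fold es. rewrite <- e by lra. exact u1.
      * intros t ht. rewrite <- e by assumption. reflexivity.
  - revert c1. apply count_with_mult_of_Count. intros x _.
    assert (l : - m < 0) by lra.
    apply (dim_on_kernel _ _ _ _ (fun y v i => coords (es 0 y v x) i)).
    + intros y v i. unfold es. rewrite esol_fst, esol_snd. unfold esol, comb.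
      destruct i as [|[|[|[|i]]]]; cbn [coords dsp vel mdsp mvel]; ring.
    + intros y v k1 k2. destruct (spec 0 y v l) as (s & d & _). fold es in s, d.
      split.
      * exists (fun t => coords (es 0 y v t)). split; [apply first_order_of_sol; exact s|]. split; [|reflexivity].
        destruct d as (d1 & d2 & d3 & d4). intros i hi.
        destruct i as [|[|[|[|i]]]]; cbn [coords]; [assumption | | | assumption | lia].
        -- apply is_lim_ext with (fun t => mvel (es 0 y v t) + (-1) * dsp (es 0 y v t)); [intros; ring|].
           apply lim0_plus; [|apply lim0_scal]; assumption.
        -- apply is_lim_ext with (fun t => vel (es 0 y v t) + (-1) * mdsp (es 0 y v t)); [intros; ring|].
           apply lim0_plus; [|apply lim0_scal]; assumption.
      * split; cbn [coords]; unfold es; [rewrite esol_dsp | rewrite esol_vel]; assumption.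
    + intros y v h. apply (inj 0 y v x l).
      assert (q0 := h 0%nat ltac:(unfold idx4; lia)). assert (q1 := h 1%nat ltac:(unfold idx4; lia)).
      assert (q2 := h 2%nat ltac:(unfold idx4; lia)). assert (q3 := h 3%nat ltac:(unfold idx4; lia)).
      cbn [coords] in *. apply phase_eq; cbn [dsp vel mdsp mvel pzero]; lra.
    + intros w ((q & hq & lq & wq) & w0 & w3).
      assert (s := sol_of_first_order nu mu phi 0 q hq). fold W in s.
      set (z := fun t => of_coords (q t)) in *.
      assert (dz : decays z).
      { assert (l0 := lq 0%nat ltac:(lia)). assert (l1 := lq 1%nat ltac:(lia)).
        assert (l2 := lq 2%nat ltac:(lia)). assert (l3 := lq 3%nat ltac:(lia)).
        unfold decays, z, of_coords; cbn [dsp vel mdsp mvel]. split4.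
        - assumption.
        - assumption.
        - apply is_lim_ext with (fun t => q t 3%nat + (-1) * q t 2%nat); [intros; ring|].
          apply lim0_plus; [|apply lim0_scal]; assumption.
        - apply lim0_plus; assumption. }
      assert (e := span 0 z (Rmax x s0) l (Rmax_r x s0) (fun t _ => s t) dz x (Rmax_l x s0)). fold es in e.
      exists (dsp (z s0)), (vel (z s0)). split; [|split].
      * rewrite <- (esol_dsp W M m s0 cW bW m_pos pW). fold es. rewrite <- e.
        unfold z, of_coords; cbn [dsp]. rewrite <- wq by lia. exact w0.
      * rewrite <- (esol_vel W M m s0 cW bW m_pos pW). fold es. rewrite <- e.
        unfold z, of_coords; cbn [vel]. rewrite <- wq by lia. exact w3.
      * intros i hi. rewrite <- e, wq by exact hi. unfold z, of_coords, idx4 in *.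
        destruct i as [|[|[|[|i]]]]; cbn [coords dsp vel mdsp mvel]; try ring; lia.
Qed.
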